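(* Let $p$ be a prime, let $R$ be an excellent regular local ring of characteristic $p$, and let $g\in R$ be an element. Then the set of $F$-jumping coefficients of $g$ (i.e. of the principal ideal $gR$) is a discrete subset of $\mathbb{R}$, and every $F$-jumping coefficient of $g$ is rational.
   Context: Rings are commutative and Noetherian of prime characteristic $p>0$. For an ideal $\mathfrak a\subset R$, $\mathfrak a^{[p^e]}$ denotes the ideal generated by the $p^e$-th powers of elements of $\mathfrak a$. For an integer $e\ge 1$, $I_e(\mathfrak a)$ is the intersection of all ideals $I$ of $R$ with $I^{[p^e]}\supset\mathfrak a$. An excellent regular local ring $R$ of characteristic $p$ satisfies $I_e(\mathfrak a)^{[p^e]}\supset \mathfrak a$ for all $\mathfrak a$ and $e$, and then for every real $c\ge 0$ the ideals $I_e(\mathfrak a^{\lceil cp^e\rceil})$, $e\ge1$, form an ascending chain (with $\mathfrak a^0=R$); the generalized test ideal $\tau(\mathfrak a^c)$ is the stable value of this chain, i.e. $\tau(\mathfrak a^c)=I_e(\mathfrak a^{\lceil cp^e\rceil})$ for all sufficiently large $e$. A positive real number $c$ is an $F$-jumping coefficient of $\mathfrak a$ if $\tau(\mathfrak a^c)\neq\tau(\mathfrak a^{c-\epsilon})$ for every $\epsilon$ with $0<\epsilon\le c$. Discrete means having no accumulation points in $\mathbb{R}$. *)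

(* Defs.v *)
From HB Require Import structures.
From mathcomp Require Import all_boot all_order all_algebra.
From mathcomp Require Import all_classical all_reals all_analysis.
Set Implicit Arguments.
Unset Strict Implicit.
Unset Printing Implicit Defensive.
Import Order.TTheory GRing.Theory Num.Theory.
Import numFieldNormedType.Exports.
Local Open Scope classical_set_scope.
Local Open Scope ring_scope.

(* Rings are [comPzRingType]s, so that the zero ring is allowed (it can be a
   quotient or a tensor product).  Ideals are Prop-valued sets and, unlike
   MathComp's [idealr_closed], need not be proper. *)

Definition is_ideal (R : comPzRingType) (I : set R) : Prop :=
  [/\ I 0, forall x y, I x -> I y -> I (x + y) & forall a x, I x -> I (a * x)].

Definition ideal_gen (R : comPzRingType) (A : set R) : set R :=
  smallest (@is_ideal R) A.

Definition ideal_mul (R : comPzRingType) (I J : set R) : set R :=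
  ideal_gen [set z | exists x y, [/\ I x, J y & z = x * y]].

Definition ideal_pow (R : comPzRingType) (I : set R) (n : nat) : set R :=
  iter n (ideal_mul I) setT.

Definition is_prime_ideal (R : comPzRingType) (P : set R) : Prop :=
  [/\ is_ideal P, ~ P 1 & forall x y, P (x * y) -> P x \/ P y].

Definition is_max_ideal (R : comPzRingType) (M : set R) : Prop :=
  [/\ is_ideal M, ~ M 1 &
      forall J, is_ideal J -> M `<=` J -> ~ J 1 -> J = M].

Definition noetherian (R : comPzRingType) : Prop :=
  forall I : set R, is_ideal I -> exists s : seq R, I = ideal_gen [set` s].

Definition local_ring (R : comPzRingType) : Prop :=
  exists! M : set R, is_max_ideal M.

(* P 0 < P 1 < ... < P n; the values P i for i > n are irrelevant. *)
Definition prime_chain (R : comPzRingType) (n : nat) (P : nat -> set R) : Prop :=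
  (forall i, (i <= n)%N -> is_prime_ideal (P i)) /\
  (forall i, (i < n)%N -> P i `<` P i.+1).

Definition krull_dim_eq (R : comPzRingType) (n : nat) : Prop :=
  (exists P : nat -> set R, prime_chain n P) /\
  ~ (exists P : nat -> set R, prime_chain n.+1 P).

Definition regular_local_ring (R : comPzRingType) : Prop :=
  [/\ noetherian R, local_ring R &
      exists (d : nat) (x : d.-tuple R),
        krull_dim_eq R d /\ is_max_ideal (ideal_gen [set` x])].

(* S, with structure map f, is the localization of R at the prime P.  This
   determines S up to a unique R-isomorphism. *)
Definition is_localization (R : comPzRingType) (P : set R) (S : comPzRingType)
    (f : {rmorphism R -> S}) : Prop :=
  [/\ forall s, ~ P s -> exists t, f s * t = 1,
      forall y, exists a s, ~ P s /\ y * f s = f a &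
      forall a, f a = 0 -> exists s, ~ P s /\ s * a = 0].

Definition regular_at (R : comPzRingType) (P : set R) : Prop :=
  forall (S : comPzRingType) (f : {rmorphism R -> S}),
    is_localization P f -> regular_local_ring S.

Definition regular_ring (R : comPzRingType) : Prop :=
  noetherian R /\ forall P : set R, is_prime_ideal P -> regular_at P.

(* S, with structure map f, is the I-adic completion of R, for a finitely
   generated ideal I: the maps R/I^n -> S/I^n S are bijective (first two
   clauses), and so is the map from S to the inverse limit of the S/I^n S
   (last two clauses). *)
Definition is_completion (R : comPzRingType) (I : set R) (S : comPzRingType)
    (f : {rmorphism R -> S}) : Prop :=
  let F n := ideal_gen (f @` ideal_pow I n) in
  [/\ forall n x, F n (f x) -> ideal_pow I n x,
      forall n y, exists x, F n (y - f x),
      forall y, (forall n, F n y) -> y = 0 &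
      forall u : nat -> S, (forall n, F n (u n.+1 - u n)) ->
        exists y, forall n, F n (y - u n)].

(* T, with the maps i and j, is the tensor product of B and L over A, i.e. the
   pushout of f and h in commutative rings. *)
Definition is_tensor (A B L T : comPzRingType)
    (f : {rmorphism A -> B}) (h : {rmorphism A -> L})
    (i : {rmorphism B -> T}) (j : {rmorphism L -> T}) : Prop :=
  (forall a, i (f a) = j (h a)) /\
  forall (U : comPzRingType) (u : {rmorphism B -> U}) (v : {rmorphism L -> U}),
    (forall a, u (f a) = v (h a)) ->
    exists w : {rmorphism T -> U},
      [/\ forall b, w (i b) = u b, forall l, w (j l) = v l &
          forall w' : {rmorphism T -> U}, (forall b, w' (i b) = u b) ->
            (forall l, w' (j l) = v l) -> forall t, w' t = w t].

(* The field L is a finite extension of the fraction field of h(A), i.e. of the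
   residue field of A at the prime ker h. *)
Definition finite_over_residue (A : comPzRingType) (L : fieldType)
    (h : {rmorphism A -> L}) : Prop :=
  exists s : seq L, forall y : L, exists (b : A) (a : nat -> A),
    h b != 0 /\ h b * y = \sum_(k < size s) h (a k) * s`_k.

(* The fibres of f : A -> B are geometrically regular: for every prime Q of A
   and every finite extension L of the residue field k(Q), the ring
   (B ⊗_A k(Q)) ⊗_{k(Q)} L = B ⊗_A L is regular.  A pair (Q, L) amounts to a
   map h : A -> L, with Q = ker h. *)
Definition geom_regular_fibres (A B : comPzRingType) (f : {rmorphism A -> B}) :
    Prop :=
  forall (L : fieldType) (h : {rmorphism A -> L}), finite_over_residue h ->
  forall (T : comPzRingType) (i : {rmorphism B -> T}) (j : {rmorphism L -> T}),
    is_tensor f h i j -> regular_ring T.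

Definition G_ring (R : comPzRingType) : Prop :=
  forall P : set R, is_prime_ideal P ->
  forall (A : comPzRingType) (l : {rmorphism R -> A}), is_localization P l ->
  forall M : set A, is_max_ideal M ->
  forall (B : comPzRingType) (f : {rmorphism A -> B}), is_completion M f ->
    geom_regular_fibres f.

Definition finite_type (R S : comPzRingType) (f : {rmorphism R -> S}) : Prop :=
  exists s : seq S, forall B : set S,
    range f `<=` B -> [set` s] `<=` B ->
    (forall x y, B x -> B y -> B (x + y)) ->
    (forall x y, B x -> B y -> B (x * y)) -> B = setT.

Definition chain_from_to (R : comPzRingType) (P Q : set R) (n : nat)
    (C : nat -> set R) : Prop :=
  [/\ prime_chain n C, C 0%N = P & C n = Q].

Definition saturated (R : comPzRingType) (n : nat) (C : nat -> set R) : Prop :=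
  forall i, (i < n)%N ->
    ~ exists P : set R, [/\ is_prime_ideal P, C i `<` P & P `<` C i.+1].

Definition catenary (R : comPzRingType) : Prop :=
  forall P Q : set R, is_prime_ideal P -> is_prime_ideal Q -> P `<=` Q ->
  exists n : nat, forall (k : nat) (C : nat -> set R), chain_from_to P Q k C ->
    (k <= n)%N /\ (saturated k C -> k = n).

Definition universally_catenary (R : comPzRingType) : Prop :=
  forall (S : comPzRingType) (f : {rmorphism R -> S}),
    finite_type f -> catenary S.

(* Zariski closed sets of primes are the sets V(E) = [set P | E `<=` P]. *)
Definition open_regular_locus (R : comPzRingType) : Prop :=
  exists E : set R, forall P : set R, is_prime_ideal P ->
    (regular_at P <-> ~ (E `<=` P)).

Definition J2_ring (R : comPzRingType) : Prop :=
  forall (S : comPzRingType) (f : {rmorphism R -> S}),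
    finite_type f -> open_regular_locus S.

Definition excellent (R : comPzRingType) : Prop :=
  [/\ noetherian R, universally_catenary R, G_ring R & J2_ring R].

Definition frobenius_power (R : comPzRingType) (q : nat) (I : set R) : set R :=
  ideal_gen [set x ^+ q | x in I].

Definition Ie (R : comPzRingType) (p e : nat) (a : set R) : set R :=
  \bigcap_(I in [set I | is_ideal I /\ a `<=` frobenius_power (p ^ e) I]) I.

(* The ideal I_e(a^ceil(c p^e)), for c >= 0; [Num.ceil] is valued in [int]. *)
Definition test_ideal_stage (K : realType) (R : comPzRingType) (p : nat)
    (a : set R) (c : K) (e : nat) : set R :=
  Ie p e (ideal_pow a `|Num.ceil (c * (p ^ e)%:R)|%N).

(* The stable value of the sequence of stages: an element belongs to it iff it
   belongs to all late enough stages (see [test_ideal_stable]). *)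
Definition test_ideal (K : realType) (R : comPzRingType) (p : nat)
    (a : set R) (c : K) : set R :=
  [set x | \forall e \near \oo, test_ideal_stage p a c e x].

Definition F_jumping (K : realType) (R : comPzRingType) (p : nat)
    (a : set R) : set K :=
  [set c | 0 < c /\ forall eps : K, 0 < eps -> eps <= c ->
             test_ideal p a c <> test_ideal p a (c - eps)].
Arguments F_jumping K {R} p a.

Lemma test_ideal_stable (K : realType) (R : comPzRingType) (p : nat)
    (a J : set R) (c : K) :
  (\forall e \near \oo, test_ideal_stage p a c e = J) -> test_ideal p a c = J.
Proof.
move=> [N _ NJ]; apply/seteqP; split => x.
  move=> [M _ Mx].
  rewrite -(NJ (maxn N M)) /=; last exact: leq_maxl.
  by apply: Mx; rewrite /= leq_maxr.
by move=> Jx; exists N => // e Ne /=; rewrite (NJ e Ne).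
Qed.

(* Main.v *)
(* Fix a regular local ring [R] with regular parameters [x].  The elements [x]
   are independent: a relation between monomials would make the lengths of
   [R / m^n] grow too slowly for [R] to have a chain of [d] primes.  Hence the
   same holds in the completion [S], and counting lengths gives the flatness of
   Frobenius in the form [(I : a)^[q] = I^[q] : a^q].  Together with Chevalley's
   theorem it yields in [S] a least ideal [I_e(A)] with [A] in [I_e(A)^[q]].
   The power [g^n] lies in [I^[q]] if and only if [I_e(g^n)], computed in [S],
   lies in [I S]; so the test ideals of [R] are functions of those of [S].

   In [S], for [c = n / (p^e - 1)], the ideals [tau(c (1 - p^(- e k)))] are the
   iterates of [X |-> I_e(g^n X)] on the unit ideal, and they stabilize: the
   colon ideals of successive iterates increase to some [A]; if [A] were proper,
   then at an associated prime [P = (A : s)] one element outside [P] would push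
   one iterate times [s] into the next, since those are squeezed in a
   finite-dimensional space over the residue field of [P].  So such a [c] is not
   a limit of jumps from below.  The limits from below, taken modulo 1, are
   well ordered by the ascending chain condition and stable under
   multiplication by [p].  If there were any, then among those that are minimal
   in their orbit the greatest would be periodic, hence of the form
   [n / (p^e - 1)].  Thus jumps are discrete, and since they too are stable
   under multiplication by [p] modulo 1, they are rational. *)
Require Import Defs.
From HB Require Import structures.
From mathcomp Require Import all_boot all_order all_algebra.
From mathcomp Require Import all_classical all_reals all_analysis.
From mathcomp Require Import ring lra zify.
Set Implicit Arguments.
Unset Strict Implicit.
Unset Printing Implicit Defensive.
Import Order.TTheory GRing.Theory Num.Theory.
Import numFieldNormedType.Exports.
Local Open Scope classical_set_scope.
Local Open Scope ring_scope.

(** * Ideals *)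

(** [R] need not be finite over its [q]-th powers, so [I_e] cannot be read off from coefficients in
    a basis. Its definition as an intersection becomes usable once Frobenius powers commute with
    that intersection: for two ideals this is flatness, for infinitely many it needs the compactness
    that Chevalley's theorem gives in a complete ring. This is why the completion [S] is built. Only
    equalities are brought back from [S]: the test ideals of [R] are values of some function at
    those of [S], so [R] can only have fewer jumps. Principality enters twice. Multiplying by [g]
    shifts the exponent by 1, which makes jumps periodic; and the passage from [c] to
    [(c + n) / p^e] becomes one operator on ideals. The fixed point of that map is [n / (p^e - 1)],
    whence these numbers. *)

Definition id_add (R : comPzRingType) (I J : set R) : set R :=
  [set z | exists2 a, I a & J (z - a)].

Definition id_scale (R : comPzRingType) (a : R) (I : set R) : set R :=
  [set z | exists2 b, I b & z = b * a].

Definition colon (R : comPzRingType) (I : set R) (a : R) : set R :=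
  [set z | I (z * a)].

Section Ideals.
Variable R : comPzRingType.
Implicit Types (I J X Y A : set R) (a b z : R).

Lemma idl0 I : is_ideal I -> I 0. Proof. by case. Qed.

Lemma idlD I a b : is_ideal I -> I a -> I b -> I (a + b).
Proof. by case=> _ h _; exact: h. Qed.

Lemma idlM I a b : is_ideal I -> I b -> I (a * b).
Proof. by case=> _ _; apply. Qed.

Lemma idlMr I a b : is_ideal I -> I a -> I (a * b).
Proof. by rewrite mulrC; exact: idlM. Qed.

Lemma idlN I a : is_ideal I -> I a -> I (- a).
Proof. by rewrite -mulN1r; exact: idlM. Qed.

Lemma idlB I a b : is_ideal I -> I a -> I b -> I (a - b).
Proof. by move=> iI Ia Ib; apply: idlD => //; exact: idlN. Qed.

Lemma idlBl I a b : is_ideal I -> I b -> I (a - b) -> I a.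
Proof. by move=> iI Ib /(idlD iI)/(_ Ib); rewrite subrK. Qed.

Lemma idl_sum (T : Type) (s : seq T) (P : pred T) (F : T -> R) I :
  is_ideal I -> (forall i, P i -> I (F i)) -> I (\sum_(i <- s | P i) F i).
Proof.
move=> iI IF; apply: big_ind => //; first exact: idl0.
by move=> a b; exact: idlD.
Qed.

Lemma ideal_setT : is_ideal [set: R]. Proof. by []. Qed.

Lemma ideal_eqT I : is_ideal I -> I 1 -> I = setT.
Proof.
by move=> iI I1; apply/seteqP; split=> // z _; rewrite -[z]mulr1; exact: idlM.
Qed.

Lemma ideal_setI I J : is_ideal I -> is_ideal J -> is_ideal (I `&` J).
Proof.
move=> iI iJ; split; first by split; exact: idl0.
  by move=> a b [Ia Ja] [Ib Jb]; split; exact: idlD.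
by move=> a b [Ib Jb]; split; exact: idlM.
Qed.

Lemma ideal_bigcap (T : Type) (D : set T) (F : T -> set R) :
  (forall i, D i -> is_ideal (F i)) -> is_ideal (\bigcap_(i in D) F i).
Proof.
move=> iF; split.
- by move=> i Di; exact: idl0 (iF i Di).
- by move=> a b Fa Fb i Di; apply: idlD (iF i Di) _ _; [exact: Fa|exact: Fb].
- by move=> a b Fb i Di; apply: idlM _ (iF i Di) _; exact: Fb.
Qed.

Lemma ideal_gen_ideal A : is_ideal (ideal_gen A).
Proof. by apply: ideal_bigcap => I []. Qed.

Lemma sub_ideal_gen A : A `<=` ideal_gen A.
Proof. exact: sub_gen_smallest. Qed.

Lemma ideal_gen_min A I : is_ideal I -> A `<=` I -> ideal_gen A `<=` I.
Proof. by move=> iI AI; apply: smallest_sub. Qed.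

Lemma ideal_gen_mono A B : A `<=` B -> ideal_gen A `<=` ideal_gen B.
Proof.
move=> AB; apply: ideal_gen_min; first exact: ideal_gen_ideal.
by move=> a /AB; exact: sub_ideal_gen.
Qed.

Lemma ideal_add I J : is_ideal I -> is_ideal J -> is_ideal (id_add I J).
Proof.
move=> iI iJ; split.
- by exists 0; rewrite ?subrr; exact: idl0.
- move=> a b [a' Ia Ja] [b' Ib Jb]; exists (a' + b'); first exact: idlD.
  by rewrite opprD addrACA; exact: idlD.
- move=> a b [b' Ib Jb]; exists (a * b'); first exact: idlM.
  by rewrite -mulrBr; exact: idlM.
Qed.

Lemma sub_addl I J : is_ideal J -> I `<=` id_add I J.
Proof. by move=> iJ a Ia; exists a => //; rewrite subrr; exact: idl0. Qed.

Lemma sub_addr I J : is_ideal I -> J `<=` id_add I J.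
Proof. by move=> iI a Ja; exists 0; [exact: idl0|rewrite subr0]. Qed.

Lemma add_min I J X : is_ideal X -> I `<=` X -> J `<=` X -> id_add I J `<=` X.
Proof. by move=> iX IX JX a [b /IX Xb /JX]; exact: idlBl. Qed.

Lemma add_mono I J I' J' : I `<=` I' -> J `<=` J' -> id_add I J `<=` id_add I' J'.
Proof. by move=> II JJ a [b /II Xb /JJ]; exists b. Qed.

Lemma ideal_scale a I : is_ideal I -> is_ideal (id_scale a I).
Proof.
move=> iI; split.
- by exists 0; [exact: idl0|rewrite mul0r].
- move=> _ _ [b Ib ->] [c Ic ->]; exists (b + c); first exact: idlD.
  by rewrite mulrDl.
- move=> c _ [b Ib ->]; exists (c * b); first exact: idlM.
  by rewrite mulrA.
Qed.

Lemma ideal_colon I a : is_ideal I -> is_ideal (colon I a).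
Proof.
move=> iI; split; rewrite /colon /=.
- by rewrite mul0r; exact: idl0.
- by move=> b c; rewrite mulrDl; exact: idlD.
- by move=> b c; rewrite -mulrA; exact: idlM.
Qed.

Lemma sub_colon I a : is_ideal I -> I `<=` colon I a.
Proof. by move=> iI b; exact: idlMr. Qed.

Lemma ideal_gen_nil z : ideal_gen [set` [::]] z -> z = 0 :> R.
Proof.
have /ideal_gen_min : is_ideal [set 0 : R].
  by split => //= a b; [move=> -> ->; rewrite addr0|move=> ->; rewrite mulr0].
by move=> /(_ [set` [::]]); apply.
Qed.

Lemma ideal_gen_cons b (s : seq R) z :
  ideal_gen [set` b :: s] z <-> exists r, ideal_gen [set` s] (z - r * b).
Proof.
have igs := ideal_gen_ideal [set` s]; have igb := ideal_gen_ideal [set` b :: s].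
split.
  have iX : is_ideal [set z | exists r, ideal_gen [set` s] (z - r * b)].
    split.
    - by exists 0; rewrite mul0r subr0; exact: (idl0 igs).
    - move=> u v [r hr] [r' hr']; exists (r + r').
      by rewrite mulrDl opprD addrACA; exact: (idlD igs).
    - by move=> a u [r hr]; exists (a * r); rewrite -mulrA -mulrBr; exact: (idlM _ igs).
  apply: (ideal_gen_min iX) => a /=; rewrite inE => /orP[/eqP->|sa].
    by exists 1; rewrite mul1r subrr; exact: (idl0 igs).
  by exists 0; rewrite mul0r subr0; apply: sub_ideal_gen.
move=> [r hz]; rewrite -[z](subrK (r * b)); apply: (idlD igb).
  apply: ideal_gen_mono hz => a /= sa.
  by rewrite inE sa orbT.
by apply: (idlM _ igb); apply: sub_ideal_gen; rewrite /= mem_head.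
Qed.

Lemma ideal_gen1P a z : ideal_gen [set a] z <-> exists r, z = r * a.
Proof.
split=> [|[r ->]]; last first.
  by apply: (idlM _ (ideal_gen_ideal _)); exact: sub_ideal_gen.
have iX : is_ideal [set z | exists r, z = r * a].
  split; first by exists 0; rewrite mul0r.
    by move=> _ _ [r ->] [r' ->]; exists (r + r'); rewrite mulrDl.
  by move=> b _ [r ->]; exists (b * r); rewrite mulrA.
by apply: (ideal_gen_min iX) => b /= ->; exists 1; rewrite mul1r.
Qed.

Lemma ideal_gen1_sub a I : is_ideal I -> (ideal_gen [set a] `<=` I) <-> I a.
Proof.
move=> iI; split; first by apply; exact: sub_ideal_gen.
by move=> Ia; apply: ideal_gen_min => // _ ->.
Qed.

Lemma ideal_mul_sub I J X : is_ideal X ->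
  (forall a b, I a -> J b -> X (a * b)) -> ideal_mul I J `<=` X.
Proof. by move=> iX h; apply: ideal_gen_min => // _ [a [b [Ia Jb ->]]]; exact: h. Qed.

Lemma mul_ideal_mul I J a b : I a -> J b -> ideal_mul I J (a * b).
Proof. by move=> Ia Jb; apply: sub_ideal_gen; exists a, b. Qed.

Lemma ideal_mul_add_gen1 I J a z : is_ideal I -> is_ideal J ->
  ideal_mul I (id_add J (ideal_gen [set a])) z -> exists2 m, I m & J (z - m * a).
Proof.
move=> iI iJ; pose X := [set w | exists2 m, I m & J (w - m * a)].
have iX : is_ideal X.
  split.
  - by exists 0; rewrite ?mul0r ?subrr; exact: idl0.
  - move=> b c [m Im Jb] [n In Jc]; exists (m + n); first exact: idlD.
    by rewrite mulrDl opprD addrACA; exact: idlD.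
  - move=> b c [m Im Jc]; exists (b * m); first exact: idlM.
    by rewrite -mulrA -mulrBr; exact: idlM.
move: z; apply: (ideal_mul_sub iX) => b w Ib [c Jc /ideal_gen1P[r /eqP]].
rewrite subr_eq => /eqP ->; exists (b * r); first by rewrite mulrC; exact: idlM.
by rewrite mulrDr mulrA addrC addKr; exact: idlM.
Qed.

Lemma ideal_pow_gen1 a n : ideal_pow (ideal_gen [set a]) n = ideal_gen [set a ^+ n].
Proof.
elim: n => [|n IH].
  rewrite expr0; apply/esym/ideal_eqT; first exact: ideal_gen_ideal.
  exact: sub_ideal_gen.
rewrite /ideal_pow iterS -/(ideal_pow _ n) IH; apply/seteqP; split.
  apply: ideal_mul_sub; first exact: ideal_gen_ideal.
  move=> _ _ /ideal_gen1P[r ->] /ideal_gen1P[t ->]; apply/ideal_gen1P.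
  by exists (r * t); rewrite exprS mulrACA.
apply/ideal_gen1_sub; first exact: ideal_gen_ideal.
by rewrite exprS; apply: mul_ideal_mul; exact: sub_ideal_gen.
Qed.

Lemma noetherian_acc (C : nat -> set R) : noetherian R ->
  (forall n, is_ideal (C n)) -> (forall n, C n `<=` C n.+1) ->
  exists N, forall n, (N <= n)%N -> C n = C N.
Proof.
move=> noR iC sC.
have leC m n : (m <= n)%N -> C m `<=` C n.
  move=> /subnK <-; elim: (n - m)%N => [//|k IH].
  by apply: subset_trans IH _; rewrite addSn; exact: sC.
have iU : is_ideal (\bigcup_n C n).
  split; first by exists 0%N => //; exact: idl0.
    move=> a b [m _ Ca] [n _ Cb]; exists (maxn m n) => //.
    apply: idlD => //.
      exact: leC (leq_maxl _ _) _ Ca.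
    exact: leC (leq_maxr _ _) _ Cb.
  by move=> a b [n _ Cb]; exists n => //; exact: idlM.
have [s sE] := noR _ iU.
have [N hN] : exists N, [set` s] `<=` C N.
  have : [set` s] `<=` \bigcup_n C n by rewrite sE; exact: sub_ideal_gen.
  elim: s {sE} => [|b s IH] hs; first by exists 0%N.
  have [N hN] : exists N, [set` s] `<=` C N.
    by apply: IH => a sa; apply: hs; rewrite /= inE sa orbT.
  have [M _ CM] : (\bigcup_n C n) b by apply: hs; rewrite /= mem_head.
  exists (maxn N M) => a /=; rewrite inE => /orP[/eqP->|sa].
    exact: leC (leq_maxr _ _) _ CM.
  exact: leC (leq_maxl _ _) _ (hN _ sa).
exists N => n Nn; apply/seteqP; split; last exact: leC.
apply: subset_trans (ideal_gen_min (iC N) hN).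
by rewrite -sE => a Ca; exists n.
Qed.

(* Dependent choice turns a nonempty family without maximal element into a
   strictly increasing chain. *)
Lemma noetherian_max (F : set (set R)) : noetherian R ->
  (forall I, F I -> is_ideal I) -> F !=set0 ->
  exists2 I, F I & forall J, F J -> I `<=` J -> J = I.
Proof.
move=> noR iF [I0 FI0]; apply: contrapT => nomax.
have nxt (I : set R) : exists J, F I -> F J /\ I `<` J.
  have [FI|] := pselect (F I); last by exists I.
  apply: contrapT => nJ; apply: nomax; exists I => // J FJ IJ.
  apply: contrapT => JI; apply: nJ; exists J => _; split => //.
  by rewrite properEneq; split => //; apply/eqP => IJ'; exact: JI.
have [f fP] := choice nxt.
pose C n := iter n f I0.
have FC n : F (C n) by elim: n => //= n /fP[].
have sC n : C n `<` C n.+1 by have [] := fP _ (FC n).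
have [N hN] := noetherian_acc noR (fun n => iF _ (FC n)) (fun n => properW (sC n)).
by have := sC N; rewrite (hN N.+1) // => /properxx.
Qed.

(** A maximal proper ideal of the form [colon A s] is prime: if [b * s] is outside [A], then
    [colon A (b * s)] contains [colon A s], hence equals it. *)
Lemma noetherian_associated_prime A : noetherian R -> is_ideal A -> ~ A 1 ->
  exists2 s, ~ A s & is_prime_ideal (colon A s).
Proof.
move=> noR iA A1.
pose F := [set J | exists2 s, ~ A s & J = colon A s].
have [||J [s As ->] hmax] := @noetherian_max F noR.
- by move=> J [s _ ->]; exact: ideal_colon.
- by exists (colon A 1); exists 1.
exists s => //; split; first exact: ideal_colon.
  by rewrite /colon /= mul1r.
move=> a b; rewrite /colon /= => Aabs.
have [Abs|Abs] := pselect (A (b * s)); first by right.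
left; rewrite -[A (a * s)]/(colon A s a) -(hmax (colon A (b * s))).
- by rewrite /colon /= mulrA.
- by exists (b * s).
- by move=> c; rewrite /colon /= mulrCA; exact: idlM.
Qed.

End Ideals.

(** * Lengths *)

(* [J / I] is zero or simple; no generator of it is singled out. *)
Definition simple_step (R : comPzRingType) (I J : set R) : Prop :=
  I `<=` J /\ forall y z, J y -> J z -> ~ I y -> exists r, I (z - r * y).

(** The length of [J / I] is only ever bounded: from above by chains with zero or simple steps, from
    below, in [length_ge], by strict chains. Zero steps are allowed so that a chain survives
    intersections and sums. *)
Fixpoint length_le (R : comPzRingType) (n : nat) (I J : set R) : Prop :=
  if n is n'.+1 then
    exists J', [/\ is_ideal J', length_le n' I J' & simple_step J' J]
  else I = J.

Fixpoint length_ge (R : comPzRingType) (n : nat) (I J : set R) : Prop :=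
  if n is n'.+1 then
    exists C, [/\ is_ideal C, length_ge n' I C, C `<=` J & exists2 z, J z & ~ C z]
  else I `<=` J.

Section Lengths.
Variable R : comPzRingType.
Implicit Types (I J L X Y : set R).

Lemma length_le_sub n I J : length_le n I J -> I `<=` J.
Proof.
elim: n J => [J -> //|n IH J [J' [_ /IH IJ' [J'J _]]]].
exact: subset_trans J'J.
Qed.

Lemma length_ge_sub n I J : length_ge n I J -> I `<=` J.
Proof.
elim: n J => [//|n IH J [C [_ /IH IC CJ _]]].
exact: subset_trans CJ.
Qed.

Lemma length_ge_le_r n I J J' : J `<=` J' -> length_ge n I J -> length_ge n I J'.
Proof.
case: n => [|n] JJ' /=; first by move=> IJ; apply: subset_trans JJ'.
move=> [C [iC IC CJ [z /JJ' Jz Cz]]]; exists C; split => //.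
  exact: subset_trans JJ'.
by exists z.
Qed.

Lemma length_ge_le_l n I I' J : I' `<=` I -> length_ge n I J -> length_ge n I' J.
Proof.
move=> I'I; elim: n J => [J IJ|n IH J [C [iC /IH IC CJ zJ]]] /=.
  exact: subset_trans IJ.
by exists C.
Qed.

Lemma length_le_trans m n I J X : length_le m I J -> length_le n J X ->
  length_le (m + n) I X.
Proof.
move=> IJ; elim: n X => [X <-|n IH X [X' [iX' /IH IX' sX']]]; first by rewrite addn0.
by rewrite addnS; exists X'.
Qed.

Lemma length_ge_trans m n I J X : is_ideal J -> length_ge m I J ->
  length_ge n J X -> length_ge (m + n) I X.
Proof.
move=> iJ IJ; elim: n X => [X JX|n IH X [C [iC /IH IC CX zX]]].
  by rewrite addn0; exact: length_ge_le_r IJ.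
by rewrite addnS; exists C.
Qed.

Lemma length_ge1 I J z : is_ideal I -> I `<=` J -> J z -> ~ I z ->
  length_ge 1 I J.
Proof. by move=> iI IJ Jz Iz; exists I; split => //; exists z. Qed.

Lemma simple_step_refl I : is_ideal I -> simple_step I I.
Proof. by move=> iI; split => // y z Iy _ /(_ Iy). Qed.

Lemma length_le_weaken m n I J : is_ideal J -> (m <= n)%N -> length_le m I J ->
  length_le n I J.
Proof.
move=> iJ /subnK <-; elim: (n - m)%N => [//|k IH] /IH IJ.
by rewrite addSn; exists J; split => //; exact: simple_step_refl.
Qed.

Lemma simple_stepI I J L : is_ideal L -> simple_step I J ->
  simple_step (I `&` L) (J `&` L).
Proof.
move=> iL [IJ sIJ]; split=> [a [/IJ]//|y z [Jy Ly] [Jz Lz] nIy].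
have [|r Ir] := sIJ y z Jy Jz; first by move=> Iy; exact: nIy.
by exists r; split=> //; apply: (idlB iL) => //; exact: (idlM _ iL).
Qed.

Lemma simple_stepD I J L : is_ideal I -> is_ideal L -> simple_step I J ->
  simple_step (id_add I L) (id_add J L).
Proof.
move=> iI iL [IJ sIJ]; split; first exact: add_mono.
move=> y z [j Jj Ly] [j' Jj' Lz] nIy.
have [|r Ir] := sIJ j j' Jj Jj'; first by move=> Ij; apply: nIy; exists j.
exists r; exists (j' - r * j) => //.
have -> : z - r * y - (j' - r * j) = (z - j') - r * (y - j) by ring.
by apply: (idlB iL) => //; exact: (idlM _ iL).
Qed.

Lemma simple_step_scale I X Y a : is_ideal I -> is_ideal X -> simple_step X Y ->
  simple_step (id_add I (id_scale a X)) (id_add I (id_scale a Y)).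
Proof.
move=> iI iX [XY sXY]; split.
  by apply: add_mono => // _ [b /XY Yb ->]; exists b.
move=> y z [i Ii [b Yb yE]] [i' Ii' [c Yc zE]] nIy.
have [|r Xr] := sXY b c Yb Yc.
  by move=> Xb; apply: nIy; exists i => //; exists b.
exists r; exists (i' - r * i); first by apply: (idlB iI) => //; exact: (idlM _ iI).
exists (c - r * b) => //.
have -> : z - r * y - (i' - r * i) = (z - i') - r * (y - i) by ring.
by rewrite yE zE; ring.
Qed.

Lemma length_leD n I J L : is_ideal I -> is_ideal L -> length_le n I J ->
  length_le n (id_add I L) (id_add J L).
Proof.
move=> iI iL; elim: n J => [J -> //|n IH J [J' [iJ' /IH IJ' sJ]]].
exists (id_add J' L); split => //; first exact: ideal_add.
exact: simple_stepD.
Qed.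

Lemma length_le_scale n I X Y a : is_ideal I -> is_ideal X -> length_le n X Y ->
  length_le n (id_add I (id_scale a X)) (id_add I (id_scale a Y)).
Proof.
move=> iI iX; elim: n Y => [Y -> //|n IH Y [Y' [iY' /IH XY' sY]]].
exists (id_add I (id_scale a Y')); split => //.
  by apply: ideal_add => //; exact: ideal_scale.
exact: simple_step_scale.
Qed.

(** Since [colon I a] lies in [X], multiplication by [a] embeds [R / X] into [R / (I + a X)], so a
    strict chain stays strict. *)
Lemma length_ge_scale n I X Y a : is_ideal I -> is_ideal X -> colon I a `<=` X ->
  length_ge n X Y ->
  length_ge n (id_add I (id_scale a X)) (id_add I (id_scale a Y)).
Proof.
move=> iI iX IX; elim: n Y => [Y XY|n IH Y [C [iC XC CY [z Yz nCz]]]].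
  by apply: add_mono => // _ [b /XY Yb ->]; exists b.
exists (id_add I (id_scale a C)); split.
- by apply: ideal_add => //; exact: ideal_scale.
- exact: IH.
- by apply: add_mono => // _ [b /CY Yb ->]; exists b.
exists (z * a); first by apply: sub_addr => //; exists z.
move=> [i Ii [c Cc /eqP]]; rewrite subr_eq addrC -subr_eq -mulrBl => /eqP ai.
apply: nCz; apply: (idlBl iC Cc).
by apply: (length_ge_sub XC); apply: IX; rewrite /colon /= ai.
Qed.

(* Intersecting a strict chain with [J'] makes it collapse at most once. *)
Lemma length_ge_step a I J J' : length_ge a I J -> is_ideal J ->
  is_ideal J' -> I `<=` J' -> simple_step J' J -> length_ge a.-1 I J'.
Proof.
elim: a J J' => [//|a IH J J' [C [iC IC CJ [z Jz nCz]]] iJ iJ' IJ' [J'J sJ]] /=.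
have [CJ'|nCJ'] := pselect (C `<=` J'); first exact: length_ge_le_r IC.
have [y Cy nJ'y] : exists2 y, C y & ~ J' y.
  apply: contrapT => h; apply: nCJ' => y Cy; apply: contrapT => nJ'y.
  by apply: h; exists y.
have [r J'r] := sJ y z (CJ _ Cy) Jz nJ'y.
have iCJ' := ideal_setI iJ' iC.
have st : simple_step (J' `&` C) C.
  have := simple_stepI iC (conj J'J sJ); congr simple_step.
  by apply/setIidPr.
have ICJ' : I `<=` J' `&` C.
  by move=> w Iw; split; [exact: IJ'|exact: length_ge_sub IC _ Iw].
case: a IH IC => [|a] IH IC //; have {}IH := IH _ _ IC iC iCJ' ICJ' st.
exists (J' `&` C); split => //; exists (z - r * y) => // -[_ Czy].
by apply: nCz; apply: (idlBl iC _ Czy); exact: (idlM _ iC).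
Qed.

(** The inequality behind Jordan-Hoelder: removing the top link of the composition chain shortens
    the strict chain by at most one. *)
Lemma length_ge_le a n I J : is_ideal I -> is_ideal J ->
  length_ge a I J -> length_le n I J -> (a <= n)%N.
Proof.
move=> iI; elim: n a J => [|n IH] a J iJ IJ /= h.
  case: a IJ => [//|a [C [_ /length_ge_sub IC CJ [z Jz nCz]]]].
  by case: nCz; apply: IC; rewrite h.
have [J' [iJ' IJ' sJ]] := h.
have := IH _ _ iJ' (length_ge_step IJ iJ iJ' (length_le_sub IJ') sJ) IJ'.
by case: a {IJ}.
Qed.

(** Dropping the zero steps leaves a composition series, so one number bounds the length on both
    sides. *)
Lemma length_exact n I J : is_ideal I -> length_le n I J ->
  exists2 k, (k <= n)%N & length_le k I J /\ length_ge k I J.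
Proof.
move=> iI; elim: n J => [J IJ|n IH J [J' [iJ' /IH[k kn [le ge]] [J'J sJ]]]].
  by exists 0%N => //; split => //; rewrite IJ.
have [JJ'|nJJ'] := pselect (J `<=` J').
  have <- : J' = J by apply/seteqP.
  by exists k => //; exact: leqW.
exists k.+1 => //; split; exists J'; split => //.
apply: contrapT => h; apply: nJJ' => z Jz; apply: contrapT => nz.
by apply: h; exists z.
Qed.

Lemma length_leI n (I J L : set R) : is_ideal L -> length_le n I J ->
  length_le n (I `&` L) (J `&` L).
Proof.
move=> iL; elim: n J => [J -> //|n IH J [J' [iJ' /IH IJ' sJ]]].
by exists (J' `&` L); split => //; [exact: ideal_setI|exact: simple_stepI].
Qed.

(** [Q / P] is a subquotient of [R / A]: intersect the chain with [Q], then add [P]. *)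
Lemma length_le_between n (A P Q : set R) : is_ideal A -> is_ideal P ->
  is_ideal Q -> A `<=` P -> P `<=` Q -> length_le n A setT -> length_le n P Q.
Proof.
move=> iA iP iQ AP PQ /(length_leI iQ)/(length_leD (ideal_setI iA iQ) iP).
congr length_le; apply/seteqP; split.
- by apply: add_min => // z [/AP].
- by apply: sub_addr; exact: ideal_setI.
- by apply: add_min => // z [].
- by move=> z Qz; apply: sub_addl.
Qed.

End Lengths.

(** * Monomials *)

(* Exponents are functions on [nat], of which only the first [d] values
   matter. *)
Definition mdeg (d : nat) (al : nat -> nat) : nat := (\sum_(i < d) al i)%N.

Definition madd (al be : nat -> nat) : nat -> nat := fun i => (al i + be i)%N.

Definition mle (d : nat) (al be : nat -> nat) : Prop :=
  forall i, (i < d)%N -> (al i <= be i)%N.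

(* The position of [al] in a degree-compatible monomial order:
   ['C(s + k, k.+1)] monomials in [k.+1] variables have degree less than [s]. *)
Fixpoint mrank (d : nat) (al : nat -> nat) : nat :=
  if d is k.+1 then ('C(mdeg k.+1 al + k, k.+1) + mrank k al)%N else 0%N.

Lemma mdegS d al : mdeg d.+1 al = (mdeg d al + al d)%N.
Proof. by rewrite /mdeg big_ord_recr. Qed.

Lemma mdegD d al be : mdeg d (madd al be) = (mdeg d al + mdeg d be)%N.
Proof. by rewrite /mdeg big_split. Qed.

Lemma mdeg_ge d al i : (i < d)%N -> (al i <= mdeg d al)%N.
Proof. by move=> lt_id; rewrite /mdeg (bigD1 (Ordinal lt_id)) //= leq_addr. Qed.

Lemma mrank_lt_bin d al : (mrank d al < 'C(mdeg d al + d, d))%N.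
Proof.
elim: d => [|d IH]; first by rewrite bin0.
rewrite /= addnS binS ltn_add2l; apply: leq_trans IH _.
by apply: leq_bin2l; rewrite mdegS -addnA leq_add2l leq_addl.
Qed.

(** The binomial offset exceeds every rank in lower degree, so degree decides first and the first
    [d] exponents break ties: a graded order. *)
Lemma mrankS_lt d al be : (mrank d.+1 al < mrank d.+1 be)%N =
  (mdeg d.+1 al < mdeg d.+1 be)%N ||
  (mdeg d.+1 al == mdeg d.+1 be) && (mrank d al < mrank d be)%N.
Proof.
have lt ga de : (mdeg d.+1 ga < mdeg d.+1 de)%N ->
    (mrank d.+1 ga < mrank d.+1 de)%N.
  move=> h; apply: leq_trans (mrank_lt_bin d.+1 ga) _.
  apply: leq_trans (leq_addr _ _); apply: leq_bin2l.
  by rewrite addnS -addSn leq_add2r.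
case: (ltngtP (mdeg d.+1 al)) => [h|h|e]; rewrite ?orTb ?orFb ?andFb ?andTb; first exact: lt h.
  by apply/negbTE; rewrite -leqNgt; exact: ltnW (lt _ _ h).
by rewrite /= e ltn_add2l.
Qed.

Lemma mrank_deg d al be : (mdeg d al < mdeg d be)%N -> (mrank d al < mrank d be)%N.
Proof.
case: d => [|d]; first by rewrite /mdeg !big_ord0.
by rewrite mrankS_lt => ->.
Qed.

Lemma mrank_degW d al be : (mrank d al <= mrank d be)%N -> (mdeg d al <= mdeg d be)%N.
Proof. by apply: contraLR; rewrite -!ltnNge; exact: mrank_deg. Qed.

Lemma mrank_inj d al be : mrank d al = mrank d be ->
  forall i, (i < d)%N -> al i = be i.
Proof.
elim: d => [//|d IH] e.
have := mrankS_lt d al be; rewrite e ltnn => /esym/negbT.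
have := mrankS_lt d be al; rewrite e ltnn => /esym/negbT.
case: ltngtP => //= edeg nab nba.
have /IH {}IH : mrank d al = mrank d be.
  by apply: anti_leq; rewrite (leqNgt (mrank d al)) (leqNgt (mrank d be)) nab nba.
move=> i; rewrite ltnS leq_eqVlt => /predU1P[->|]; last exact: IH.
move/eqP: edeg; rewrite !mdegS.
have -> : mdeg d al = mdeg d be by apply: eq_bigr => j _; exact: IH.
by rewrite eqn_add2l => /eqP.
Qed.

Lemma eq_mrank d al be : (forall i, (i < d)%N -> al i = be i) ->
  mrank d be = mrank d al.
Proof.
elim: d => //= d IH h; rewrite IH; last by move=> i lt_id; apply: h; exact: ltnW.
by congr ('C(_ + _, _) + _)%N; apply: eq_bigr => i _; rewrite h.
Qed.

Lemma mrankD d al be ga : (mrank d al < mrank d be)%N ->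
  (mrank d (madd ga al) < mrank d (madd ga be))%N.
Proof.
elim: d => [//|d IH]; rewrite !mrankS_lt !mdegD ltn_add2l eqn_add2l.
by case/orP=> [->//|/andP[-> /IH ->]]; rewrite orbT.
Qed.

Lemma mdeg_of_rank d al n : ('C(n + d, d) <= mrank d al)%N -> (n < mdeg d al)%N.
Proof.
move=> h; rewrite ltnNge; apply: contraL h => h; rewrite -ltnNge.
apply: leq_trans (mrank_lt_bin _ _) _; apply: leq_bin2l.
by rewrite leq_add2r.
Qed.

Lemma mdeg_sub d al n : (n <= mdeg d al)%N ->
  exists be ga, [/\ mdeg d be = n & forall i, al i = madd be ga i].
Proof.
elim: n => [_|n IH lt_n].
  exists (fun=> 0%N), al; split => //.
  by rewrite /mdeg big1.
have [be [ga [degbe alE]]] := IH (ltnW lt_n).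
have [[i lt_id] /= gai] : exists i : 'I_d, (0 < ga i)%N.
  apply/existsP; apply: contraLR lt_n; rewrite negb_exists => /forallP ga0.
  rewrite -ltnNge ltnS -degbe; apply: leq_sum => i _.
  by rewrite alE /madd; move: (ga0 i); rewrite -eqn0Ngt => /eqP->; rewrite addn0.
pose e j : nat := j == i.
have ege j : (e j <= ga j)%N by rewrite /e; case: eqP => [->|].
exists (madd be e), (fun j => ga j - e j)%N; split.
  rewrite mdegD degbe -addn1; congr addn.
  rewrite /mdeg (bigD1 (Ordinal lt_id)) //= /e eqxx big1 // => j.
  by rewrite -val_eqE /= => /negbTE->.
by move=> j; rewrite alE /madd -addnA subnKC.
Qed.

Lemma madd_sub d al be : mle d al be ->
  exists ga, forall i, (i < d)%N -> be i = madd ga al i.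
Proof. by move=> h; exists (fun i => be i - al i)%N => i /h; rewrite /madd => /subnK. Qed.

Definition mon (R : comPzRingType) (d : nat) (x : nat -> R) (al : nat -> nat) : R :=
  \prod_(i < d) x i ^+ al i.

Definition mono_ideal (R : comPzRingType) (d : nat) (x : nat -> R)
    (P : set (nat -> nat)) : set R :=
  ideal_gen (mon d x @` P).

(** The [n]-th power of the ideal of the [x i]. The monomial form allows the refinement
    [rank_ideal], where consecutive ideals differ by at most one monomial. *)
Definition deg_ideal (R : comPzRingType) (d : nat) (x : nat -> R) (n : nat) :
  set R := mono_ideal d x [set al | (n <= mdeg d al)%N].

Definition rank_ideal (R : comPzRingType) (d : nat) (x : nat -> R) (n : nat) :
  set R := mono_ideal d x [set al | (n <= mrank d al)%N].

(** The ideal generated by the powers [x i ^+ n]. It defines the same topology as [deg_ideal], and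
    its Frobenius powers are again box ideals. *)
Definition box_ideal (R : comPzRingType) (d : nat) (x : nat -> R) (n : nat) :
  set R := mono_ideal d x [set al | exists2 i, (i < d)%N & (n <= al i)%N].

Section Monomials.
Variables (R : comPzRingType) (d : nat) (x : nat -> R).
Implicit Types (al be ga : nat -> nat) (P Q : set (nat -> nat)).

Local Notation mon := (mon d x).
Local Notation MI := (mono_ideal d x).
Local Notation D := (deg_ideal d x).
Local Notation M := (rank_ideal d x).
Local Notation B := (box_ideal d x).

Lemma monD al be : mon (madd al be) = mon al * mon be.
Proof. by rewrite -big_split; apply: eq_bigr => i _; exact: exprD. Qed.

Lemma eq_mon al be : (forall i, (i < d)%N -> al i = be i) -> mon al = mon be.
Proof. by move=> h; apply: eq_bigr => i _; rewrite h. Qed.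

Lemma mon0 : mon (fun=> 0%N) = 1.
Proof. by rewrite /mon big1. Qed.

Lemma mono_ideal_ideal P : is_ideal (MI P).
Proof. exact: ideal_gen_ideal. Qed.

Lemma mono_idealP P al : P al -> MI P (mon al).
Proof. by move=> Pal; apply: sub_ideal_gen; exists al. Qed.

Lemma mono_ideal_min P I : is_ideal I -> (forall al, P al -> I (mon al)) ->
  MI P `<=` I.
Proof. by move=> iI h; apply: ideal_gen_min => // _ [al /h Pal <-]. Qed.

Lemma mono_ideal_mono P Q : P `<=` Q -> MI P `<=` MI Q.
Proof.
move=> PQ; apply: mono_ideal_min; first exact: mono_ideal_ideal.
by move=> al /PQ; exact: mono_idealP.
Qed.

Lemma mono_ideal_mulmon P Q ga z : (forall al, P al -> Q (madd ga al)) ->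
  MI P z -> MI Q (mon ga * z).
Proof.
move=> PQ; have iQ := ideal_colon (mon ga) (mono_ideal_ideal Q).
rewrite mulrC; apply: mono_ideal_min iQ _ z => al /PQ Qal.
by rewrite /colon /= mulrC -monD; exact: mono_idealP.
Qed.

Lemma mono_ideal_split P Q be z : (forall al, Q al -> P al \/ mon al = mon be) ->
  MI Q z -> exists r, MI P (z - r * mon be).
Proof.
move=> QP; have iP := mono_ideal_ideal P.
pose X := id_add (id_scale (mon be) [set: R]) (MI P).
have iX : is_ideal X by apply: ideal_add => //; exact: ideal_scale.
have : MI Q `<=` X.
  apply: mono_ideal_min => // al /QP[Pal|->].
    by apply: sub_addr; [exact: ideal_scale|exact: mono_idealP].
  by apply: sub_addl => //; exists 1; rewrite ?mul1r.
by move=> h /h [_ [r _ ->]]; exists r.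
Qed.

(** Possibly no monomial has rank [n], as for [d = 0] and [0 < n]; then [z] is already in the next
    ideal and the exponent is a dummy. *)
Lemma rank_ideal_split n z : M n z ->
  exists r al, M n.+1 (z - r * mon al) /\ (M n.+1 z \/ mrank d al = n).
Proof.
have [[be beE] Mz|nbe] := pselect (exists be, mrank d be = n).
  have [|r hr] := mono_ideal_split (P := [set al | (n < mrank d al)%N]) _ (be := be) Mz.
    move=> al /=; rewrite leq_eqVlt => /predU1P[nE|]; last by left.
    by right; apply: eq_mon; apply: mrank_inj; rewrite beE.
  by exists r, be; split => //; right.
move=> Mz; have {}Mz : M n.+1 z.
  apply: mono_ideal_mono Mz => al /=; rewrite leq_eqVlt => /predU1P[nE|//].
  by case: nbe; exists al.
by exists 0, (fun=> 0%N); rewrite mul0r subr0; split => //; left.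
Qed.

Lemma rank_idealS n : M n.+1 `<=` M n.
Proof. by apply: mono_ideal_mono => al /= /ltnW. Qed.

Lemma deg_ideal_le m n : (m <= n)%N -> D n `<=` D m.
Proof. by move=> mn; apply: mono_ideal_mono => al /=; exact: leq_trans. Qed.

Lemma rank_ideal_le m n : (m <= n)%N -> M n `<=` M m.
Proof. by move=> mn; apply: mono_ideal_mono => al /=; exact: leq_trans. Qed.

Lemma deg_ideal0 : D 0 = setT.
Proof.
apply: ideal_eqT; first exact: mono_ideal_ideal.
by rewrite -mon0; exact: mono_idealP.
Qed.

Lemma rank_ideal0 : M 0 = setT.
Proof.
apply: ideal_eqT; first exact: mono_ideal_ideal.
by rewrite -mon0; exact: mono_idealP.
Qed.

Lemma deg_idealM m n a b : D m a -> D n b -> D (m + n) (a * b).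
Proof.
move=> Da Db; have iD := mono_ideal_ideal [set al | (m + n <= mdeg d al)%N].
apply: (mono_ideal_min (ideal_colon b iD) _ Da) => al /= mal.
apply: mono_ideal_mulmon Db => be /= nbe.
by rewrite mdegD leq_add.
Qed.

Lemma deg_idealX n z : D 1 z -> D n (z ^+ n).
Proof.
move=> Dz; elim: n => [|n IH]; first by rewrite deg_ideal0.
by rewrite exprS -add1n; exact: deg_idealM.
Qed.

Lemma deg_ideal_exact n : D n = MI [set al | mdeg d al = n].
Proof.
apply/seteqP; split; last by apply: mono_ideal_mono => al /= ->.
apply: mono_ideal_min => [|al /= /mdeg_sub[be [ga [degbe alE]]]].
  exact: mono_ideal_ideal.
rewrite (eq_mon (fun i _ => alE i)) monD mulrC; apply: (idlM _ (mono_ideal_ideal _)).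
exact: mono_idealP.
Qed.

Lemma deg_ideal_sub_rank al : D (mdeg d al).+1 `<=` M (mrank d al).+1.
Proof. by apply: mono_ideal_mono => be /=; exact: mrank_deg. Qed.

Lemma rank_ideal_sub_deg n : M 'C(n + d, d) `<=` D n.
Proof. by apply: mono_ideal_mono => be /= /mdeg_of_rank/ltnW. Qed.

Lemma mul_mon_rank r al : D 1 r -> M (mrank d al).+1 (r * mon al).
Proof.
move=> Dr; apply: deg_ideal_sub_rank; rewrite -add1n.
by apply: deg_idealM => //; apply: mono_idealP; rewrite /= ?leqnn.
Qed.

Lemma mulmon_rank_ideal ga al z : M (mrank d al).+1 z ->
  M (mrank d (madd ga al)).+1 (mon ga * z).
Proof. by apply: mono_ideal_mulmon => be /=; exact: mrankD. Qed.

Lemma box_ideal_sub_deg n : B n `<=` D n.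
Proof.
apply: mono_ideal_mono => al /= [i lt_id nal].
exact: leq_trans nal (mdeg_ge _ lt_id).
Qed.

Lemma deg_ideal_sub_box n : D (d * n).+1 `<=` B n.
Proof.
apply: mono_ideal_mono => al /= h; apply: contrapT => nal.
move: h; rewrite ltnNge => /negP; apply.
have -> : (d * n = \sum_(i < d) n)%N by rewrite sum_nat_const card_ord.
apply: leq_sum => i _; rewrite leqNgt; apply/negP => /ltnW h.
by apply: nal; exists i.
Qed.

Lemma rank_ideal_sub_box n : M 'C((d * n).+1 + d, d) `<=` B n.
Proof. by apply: subset_trans (@deg_ideal_sub_box n); exact: rank_ideal_sub_deg. Qed.

Lemma box_ideal_gen n I : is_ideal I -> (forall i, (i < d)%N -> I (x i ^+ n)) ->
  B n `<=` I.
Proof.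
move=> iI xI; apply: mono_ideal_min => // al [i lt_id nal].
rewrite /mon (bigD1 (Ordinal lt_id)) //=; apply: idlMr => //.
by rewrite -(subnK nal) exprD; apply: idlM => //; exact: xI.
Qed.

Lemma mem_box_ideal n i : (i < d)%N -> B n (x i ^+ n).
Proof.
move=> lt_id; have -> : x i ^+ n = mon (fun j => if j == i then n else 0%N).
  rewrite /mon (bigD1 (Ordinal lt_id)) //= eqxx big1 ?mulr1 // => j.
  by rewrite -val_eqE /= => /negbTE->; rewrite expr0.
by apply: mono_idealP; exists i => //; rewrite eqxx.
Qed.

Lemma deg_ideal1_gen I : is_ideal I -> (forall i, (i < d)%N -> I (x i)) ->
  D 1 `<=` I.
Proof.
move=> iI xI; apply: mono_ideal_min => // al /= al1.
have [[i lt_id] /= ali] : exists i : 'I_d, (0 < al i)%N.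
  apply/existsP; apply: contraLR al1; rewrite negb_exists => /forallP al0.
  rewrite -eqn0Ngt; apply/eqP/big1 => i _; apply/eqP.
  by rewrite eqn0Ngt; exact: al0.
rewrite /mon (bigD1 (Ordinal lt_id)) //=; apply: idlMr => //.
by rewrite -(prednK ali) exprS; apply: idlMr => //; exact: xI.
Qed.

Lemma mem_deg_ideal1 i : (i < d)%N -> D 1 (x i).
Proof. by move=> lt_id; apply: box_ideal_sub_deg; rewrite -[x i]expr1; exact: mem_box_ideal. Qed.

End Monomials.

(** * Dickson's lemma and the Artin-Rees lemma *)

(** Each index minimizes [g] on the tail beyond the previous index, so later values cannot be
    smaller. *)
Lemma nondecreasing_subsequence (g : nat -> nat) :
  exists f : nat -> nat, (forall n, (f n < f n.+1)%N) /\
    forall m n, (m <= n)%N -> (g (f m) <= g (f n))%N.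
Proof.
have argmin N : exists n, (N <= n)%N /\ forall m, (N <= m)%N -> (g n <= g m)%N.
  pose P v := `[< exists2 n, (N <= n)%N & g n = v >].
  have exP : exists v, P v by exists (g N); apply/asboolP; exists N.
  case: (ex_minnP exP) => v /asboolP[n Nn <-] vmin.
  by exists n; split => // m Nm; apply: vmin; apply/asboolP; exists m.
have [sel selP] := choice argmin.
pose f n := iter n (fun k => sel k.+1) (sel 0%N).
have flt n : (f n < f n.+1)%N by have [] := selP (f n).+1.
have fle m n : (m <= n)%N -> (f m <= f n)%N.
  move=> /subnK <-; elim: (n - m)%N => [//|k IH].
  by apply: leq_trans IH _; rewrite addSn; exact: ltnW.
exists f; split => // m n mn.
case: m mn => [_|m mn]; first by have [_] := selP 0%N; apply.
have [_] := selP (f m).+1; apply.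
exact: leq_trans (flt m) (fle _ _ mn).
Qed.

Lemma dickson_subsequence (d : nat) (F : nat -> nat -> nat) :
  exists f : nat -> nat, (forall m n, (m < n)%N -> (f m < f n)%N) /\
    forall m n, (m <= n)%N -> mle d (F (f m)) (F (f n)).
Proof.
elim: d => [|d [f [flt fle]]]; first by exists id.
have [g [glt gle]] := nondecreasing_subsequence (fun n => F (f n) d).
have gmono m n : (m < n)%N -> (g m < g n)%N.
  by apply: (homo_ltn ltn_trans).
exists (f \o g); split => [m n mn|m n mn i] /=; first by apply: flt; exact: gmono.
rewrite ltnS leq_eqVlt => /predU1P[->|]; first exact: gle.
apply: fle; case: (ltngtP m n) mn => // [/gmono /ltnW //|-> _]; exact: leqnn.
Qed.

Section DicksonBasis.
Variables (R : comPzRingType) (d : nat).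
Hypothesis noR : noetherian R.
Local Notation T := ((nat -> nat) * R)%type.

Definition mono_multiples (n : nat) (F : nat -> T) (al : nat -> nat) : set R :=
  [set c | exists i, [/\ (i < n)%N, mle d (F i).1 al & c = (F i).2]].

(** Along a subsequence with increasing exponents every earlier member divides every later one, and
    the ideals of the coefficients stabilize. *)
Lemma noetherian_dickson (F : nat -> T) :
  exists n, ideal_gen (mono_multiples n F (F n).1) (F n).2.
Proof.
have [f [flt fle]] := dickson_subsequence d (fun n => (F n).1).
pose C n := ideal_gen [set c | exists2 i, (i < n)%N & c = (F (f i)).2].
have [||N CN] := @noetherian_acc _ C noR.
- by move=> n; exact: ideal_gen_ideal.
- by move=> n; apply: ideal_gen_mono => c /= [i /ltnW lt_in ->]; exists i.
exists (f N); have : C N.+1 (F (f N)).2 by apply: sub_ideal_gen; exists N.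
rewrite CN //; apply: ideal_gen_mono => _ [i lt_iN ->].
by exists (f i); split; [exact: flt|apply: fle; exact: ltnW|].
Qed.

(** Hilbert's basis theorem at the level of leading terms: a pair is an exponent with its
    coefficient, and a coefficient counts only where its exponent divides. *)
Lemma dickson_basis (X : set T) : exists n (F : nat -> T),
  (forall i, (i < n)%N -> X (F i)) /\
  forall p, X p -> ideal_gen (mono_multiples n F p.1) p.2.
Proof.
apply: contrapT => nofin.
pose p0 : T := (fun=> 0%N, 0).
(* Without a finite basis every finite history extends by a member that it does not generate; the
   resulting sequence contradicts [noetherian_dickson]. *)
have nxt (h : seq T) : exists p, (forall i, (i < size h)%N -> X (nth p0 h i)) ->
    X p /\ ~ ideal_gen (mono_multiples (size h) (nth p0 h) p.1) p.2.
  have [Xh|] := pselect (forall i, (i < size h)%N -> X (nth p0 h i)); last by exists p0.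
  apply: contrapT => np; apply: nofin; exists (size h), (nth p0 h); split => // p Xp.
  by apply: contrapT => hp; apply: np; exists p.
have [f fP] := choice nxt.
pose H n := iter n (fun h => rcons h (f h)) [::].
pose F n := f (H n).
have sH n : size (H n) = n by elim: n => //= n IH; rewrite size_rcons IH.
have nH n i : (i < n)%N -> nth p0 (H n) i = F i.
  elim: n => //= n IH; rewrite ltnS leq_eqVlt nth_rcons sH => /predU1P[->|lt_in].
    by rewrite ltnn eqxx.
  by rewrite lt_in IH.
have XH n : forall i, (i < size (H n))%N -> X (nth p0 (H n) i).
  rewrite sH; elim: n => [//|n IH] i; rewrite ltnS => le_in.
  rewrite nH // /F; have [|//] := fP (H i); rewrite sH => j lt_ji.
  rewrite nH // -(nH n); last exact: leq_trans le_in.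
  by apply: IH; exact: leq_trans le_in.
have [n] := noetherian_dickson F.
have [_] := fP _ (XH n); rewrite -/(F n) sH => h hn; apply: h.
apply: ideal_gen_mono hn => _ [i [lt_in le_i ->]].
by exists i; rewrite nH.
Qed.

End DicksonBasis.

(** The Rees algebra argument, carried out on leading terms. Elements of [N] are written as forms in
    the [x i], with a leading coefficient for the order by rank within one degree. [dickson_basis]
    gives finitely many elements whose leading terms control all others; [k] bounds their degrees,
    so reducing in degree [n] needs only multipliers from [deg_ideal d x (n - k)]. *)
Lemma artin_rees (R : comPzRingType) (d : nat) (x : nat -> R) (N : set R) :
  noetherian R -> is_ideal N ->
  exists k, forall n, (k <= n)%N -> forall z, N z -> deg_ideal d x n z ->
    ideal_mul (deg_ideal d x (n - k)) N z.
Proof.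
move=> noR iN.
pose T al : set R := mono_ideal d x
  [set be | mdeg d be = mdeg d al /\ (mrank d al < mrank d be)%N].
pose X : set ((nat -> nat) * R) :=
  [set p | exists2 z, N z & T p.1 (z - p.2 * mon d x p.1)].
have [m [F [XF genF]]] := dickson_basis d noR X.
pose k := \max_(i < m) mdeg d (F i).1.
exists k => n kn.
set Y := ideal_mul _ _.
have iY : is_ideal Y by exact: ideal_gen_ideal.
have YN : Y `<=` N by apply: ideal_mul_sub => // a b _; exact: idlM.
pose U i : set R := mono_ideal d x [set al | mdeg d al = n /\ (i <= mrank d al)%N].
(* Here [j] counts the ranks still to be cleared; ['C(n + d, d)] is above every rank in degree
   [n]. *)
suff main j i : (i + j = 'C(n + d, d))%N -> forall z, N z -> U i z -> Y z.
  move=> z Nz; rewrite deg_ideal_exact => Dz; apply: (main _ 0%N (add0n _)) => //.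
  by apply: mono_ideal_mono Dz => al.
elim: j i => [i|j IH i ij z Nz Uz].
  rewrite addn0 => -> z _.
  apply: mono_ideal_min => // al [/= degal /mdeg_of_rank].
  by rewrite degal ltnn.
have Si : (i.+1 + j = 'C(n + d, d))%N by rewrite addSnnS.
have [[al [degal rkal]]|noal] :=
  pselect (exists al, mdeg d al = n /\ mrank d al = i); last first.
  apply: (IH _ Si) => //; apply: mono_ideal_mono Uz => al [degal].
  rewrite leq_eqVlt => /predU1P[rkal|//].
  by case: noal; exists al.
have [|r hr] := mono_ideal_split (P := [set be | mdeg d be = n /\ (i < mrank d be)%N])
    (be := al) _ Uz.
  move=> be [degbe]; rewrite leq_eqVlt => /predU1P[rkbe|]; last by left.
  by right; apply: eq_mon; apply: mrank_inj; rewrite rkal.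
have iT := mono_ideal_ideal d x [set be | mdeg d be = mdeg d al /\ (mrank d al < mrank d be)%N].
have Xr : X (al, r) by exists z => //=; rewrite /T degal rkal.
(* The coefficients at [al] that some element of [Y] can match. They form an ideal, so it is enough
   to match the basis coefficients, which generate an ideal containing [r]. *)
pose W : set R := [set c | exists2 w, Y w & T al (w - c * mon d x al)].
have iW : is_ideal W.
  split.
  - by exists 0; [exact: idl0|rewrite mul0r subr0; exact: (idl0 iT)].
  - move=> a b [u Yu hu] [v Yv hv]; exists (u + v); first exact: (idlD iY).
    by rewrite mulrDl opprD addrACA; exact: (idlD iT).
  - move=> a b [u Yu hu]; exists (a * u); first exact: (idlM _ iY).
    by rewrite -mulrA -mulrBr; exact: (idlM _ iT).
have [w Yw hw] : W r.
  apply: (ideal_gen_min iW) (genF _ Xr) => _ [l [lt_lm le_l ->]].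
  have [y Ny hy] := XF l lt_lm.
  have [ga alE] := madd_sub le_l.
  have degE : mdeg d al = (mdeg d ga + mdeg d (F l).1)%N.
    by rewrite -mdegD; apply: eq_bigr => q _; exact: alE.
  exists (mon d x ga * y).
    apply: mul_ideal_mul => //; apply: mono_idealP => /=.
    rewrite -degal degE leq_subLR addnC leq_add2r.
    exact: (leq_bigmax (Ordinal lt_lm)).
  have -> : mon d x al = mon d x ga * mon d x (F l).1.
    by rewrite -monD; exact: eq_mon.
  have -> : mon d x ga * y - (F l).2 * (mon d x ga * mon d x (F l).1) =
    mon d x ga * (y - (F l).2 * mon d x (F l).1) by ring.
  apply: mono_ideal_mulmon hy => be [degbe rkbe]; split.
    by rewrite mdegD degbe -degE.
  have <- : mrank d (madd ga (F l).1) = mrank d al; last exact: mrankD.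
  exact: eq_mrank.
rewrite -[z](subrK w) addrC; apply: (idlD iY) => //.
apply: (IH _ Si); first by apply: (idlB iN) => //; exact: YN.
have -> : z - w = (z - r * mon d x al) - (w - r * mon d x al) by ring.
apply: (idlB (mono_ideal_ideal d x _)) => //.
by move: hw; rewrite /T degal rkal.
Qed.

(** * Systems of parameters *)

(* The ideal generated by [x 0, ..., x d.-1] consists of the non-units. *)
Definition local_gen (R : comPzRingType) (d : nat) (x : nat -> R) : Prop :=
  ~ deg_ideal d x 1 1 /\
  forall r, ~ deg_ideal d x 1 r -> exists t, r * t = 1.

(* No monomial lies in the ideal of later ones: the associated graded ring is a
   polynomial ring. *)
Definition independent (R : comPzRingType) (d : nat) (x : nat -> R) : Prop :=
  forall al, ~ rank_ideal d x (mrank d al).+1 (mon d x al).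

(** Exponents below [N] in [d] variables form a finite type with [N ^ d] elements, which can be
    counted against lengths; entries from [d] on are filled with 0. *)
Definition box_ext (d N : nat) (b : {ffun 'I_d -> 'I_N}) : nat -> nat :=
  fun i => if insub i is Some j then b j else 0%N.

Lemma box_extE (d N : nat) (b : {ffun 'I_d -> 'I_N}) (i : 'I_d) : box_ext b i = b i.
Proof. by rewrite /box_ext valK. Qed.

Lemma box_extP (d N : nat) (al : nat -> nat) :
  (forall i, (i < d)%N -> (al i < N)%N) ->
  exists b : {ffun 'I_d -> 'I_N}, forall i, (i < d)%N -> al i = box_ext b i.
Proof.
move=> h; exists [ffun i : 'I_d => Ordinal (h i (ltn_ord i))] => i lt_id.
by rewrite -[i]/(val (Ordinal lt_id)) box_extE ffunE.
Qed.

Lemma mrank_box_inj (d N : nat) (b c : {ffun 'I_d -> 'I_N}) :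
  mrank d (box_ext b) = mrank d (box_ext c) -> b = c.
Proof.
move=> /mrank_inj h; apply/ffunP => i; apply: val_inj.
by rewrite /= -!box_extE h.
Qed.

(** * Lengths of the quotients by box ideals *)

Section Local.
Variables (R : comPzRingType) (d : nat) (x : nat -> R).
Hypothesis loc : local_gen d x.

Local Notation mon := (mon d x).
Local Notation D := (deg_ideal d x).
Local Notation M := (rank_ideal d x).
Local Notation B := (box_ideal d x).
Local Notation ext := (@box_ext d _).

Let iMI := mono_ideal_ideal d x.

Lemma local_unit r : D 1 r -> exists t, (1 - r) * t = 1.
Proof.
move=> Dr; apply: loc.2 => D1r; apply: loc.1.
by apply: (idlBl (iMI _) Dr).
Qed.

Lemma proper_sub_deg1 I : is_ideal I -> ~ I 1 -> I `<=` D 1.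
Proof.
move=> iI nI1 z Iz; apply: contrapT => /loc.2[t zt]; apply: nI1.
by rewrite -zt; exact: idlMr.
Qed.

(** [J / I] is generated by [u] and killed by the maximal ideal, so it is at most a line over the
    residue field. *)
Lemma simple_step_gen I J u : is_ideal I -> I `<=` J ->
  (forall z, J z -> exists r, I (z - r * u)) -> (forall a, D 1 a -> I (a * u)) ->
  simple_step I J.
Proof.
move=> iI IJ Ju mu; split=> // y z /Ju[r Iy] /Ju[s Iz] nIy.
have [t rt] : exists t, r * t = 1.
  by apply: loc.2 => /mu Iru; apply: nIy; exact: idlBl Iy.
exists (s * t).
have -> : z - s * t * y = (z - s * u) - (s * t) * (y - r * u) + s * (1 - r * t) * u.
  by ring.
rewrite rt subrr mulr0 mul0r addr0; apply: (idlB iI) => //.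
exact: (idlM _ iI).
Qed.

(** Nakayama: were [a * y] outside [I], then [y] would agree with some [r * (a * y)] modulo [I],
    while [1 - r * a] is a unit. *)
Lemma simple_step_gen_inv I J y : is_ideal I -> is_ideal J -> simple_step I J ->
  J y -> ~ I y -> forall a, D 1 a -> I (a * y).
Proof.
move=> iI iJ [_ sIJ] Jy nIy a Da; apply: contrapT => nay.
have [r] := sIJ _ _ (idlM a iJ Jy) Jy nay.
have [t ut] := local_unit (idlM r (iMI _) Da).
have -> : y - r * (a * y) = (1 - r * a) * y by ring.
by move=> /(idlM t iI); rewrite mulrA [t * _]mulrC ut mul1r.
Qed.

(** A monomial of rank [i] outside the box already lies in [B N], so only box monomials can move the
    filtration. *)
Lemma box_step N i : (forall b : {ffun 'I_d -> 'I_N}, mrank d (ext b) = i ->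
    id_add (B N) (M i.+1) (mon (ext b))) ->
  id_add (B N) (M i) = id_add (B N) (M i.+1).
Proof.
move=> h; have iX : is_ideal (id_add (B N) (M i.+1)) by apply: ideal_add; exact: iMI.
apply/seteqP; split; last by apply: add_mono => //; exact: rank_idealS.
apply: add_min => //; first by apply: sub_addl; exact: iMI.
move=> z /rank_ideal_split[r [al [hz hr]]].
case: hr => [Mz|rkal]; first by apply: sub_addr Mz; exact: iMI.
rewrite -[z](subrK (r * mon al)); apply: (idlD iX).
  by apply: sub_addr hz; exact: iMI.
apply: (idlM _ iX).
have [box|nbox] := pselect (forall j, (j < d)%N -> (al j < N)%N).
  have [b bE] := box_extP box.
  have rkE : mrank d (ext b) = i.
    by rewrite -rkal; exact: eq_mrank.
  by rewrite (eq_mon x bE); exact: h.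
apply: sub_addl; first exact: iMI.
apply: mono_idealP; apply: contrapT => nal; apply: nbox => j lt_jd.
by rewrite ltnNge; apply/negP => h'; apply: nal; exists j.
Qed.

Lemma box_step_simple N (b : {ffun 'I_d -> 'I_N}) :
  simple_step (id_add (B N) (M (mrank d (ext b)).+1)) (id_add (B N) (M (mrank d (ext b)))).
Proof.
set i := mrank d _.
have iX : is_ideal (id_add (B N) (M i.+1)) by apply: ideal_add; exact: iMI.
apply: (simple_step_gen (u := mon (ext b))) => //.
- by apply: add_mono => //; exact: rank_idealS.
- move=> z [w Bw Mz].
  have [|r hr] := mono_ideal_split (P := [set al | (i < mrank d al)%N])
    (be := ext b) _ Mz.
    move=> al /=; rewrite leq_eqVlt => /predU1P[rkE|]; last by left.
    by right; apply: eq_mon; apply: mrank_inj; rewrite -rkE.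
  by exists r, w => //; rewrite addrAC.
- by move=> a Da; apply: sub_addr; [exact: iMI|exact: mul_mon_rank].
Qed.

Lemma box_top N : id_add (B N) (M 'C((d * N).+1 + d, d)) = B N.
Proof.
apply/seteqP; split; last by apply: sub_addl; exact: iMI.
by apply: add_min => //; [exact: iMI|exact: rank_ideal_sub_box].
Qed.

Lemma box_bottom N : id_add (B N) (M 0) = setT.
Proof.
apply/seteqP; split=> // z _; apply: sub_addr; first exact: iMI.
by rewrite rank_ideal0.
Qed.

Definition box_from N (G : {set {ffun 'I_d -> 'I_N}}) (i : nat) :=
  [set b in G | (i <= mrank d (ext b))%N].

Lemma box_from0 N (G : {set {ffun 'I_d -> 'I_N}}) : box_from G 0 = G.
Proof. by apply/setP => b; rewrite inE leq0n andbT. Qed.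

Lemma card_box_from N (G : {set {ffun 'I_d -> 'I_N}}) b : b \in G ->
  #|box_from G (mrank d (ext b))| = #|box_from G (mrank d (ext b)).+1|.+1.
Proof.
move=> Gb; rewrite (cardsD1 b) inE Gb leqnn /= add1n; congr _.+1.
apply: eq_card => c; rewrite !inE; case: (c \in G); rewrite ?andbF //=.
rewrite [RHS]ltn_neqAle; congr andb; rewrite eq_sym; apply/idP/idP.
  by apply: contraNN => /eqP/mrank_box_inj->.
by apply: contraNN => /eqP->.
Qed.

Lemma box_from_skip N (G : {set {ffun 'I_d -> 'I_N}}) i :
  (forall b, b \in G -> mrank d (ext b) <> i) -> box_from G i = box_from G i.+1.
Proof.
move=> h; apply/setP => b; rewrite !inE; case Gb: (b \in G) => //=.
by rewrite [RHS]ltn_neqAle; case: eqP => // e; case: (h b).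
Qed.

(** Each box monomial accounts for at most one simple step, and those outside [G] for none. [G] will
    be the whole box, or the monomials left over by a relation. *)
Lemma box_length_le N (G : {set {ffun 'I_d -> 'I_N}}) :
  (forall b, b \notin G -> id_add (B N) (M (mrank d (ext b)).+1) (mon (ext b))) ->
  length_le #|G| (B N) setT.
Proof.
move=> hG; rewrite -(box_bottom N) -(box_from0 G).
suff main j i : (i + j = 'C((d * N).+1 + d, d))%N ->
    length_le #|box_from G i| (B N) (id_add (B N) (M i)) by exact: main (add0n _).
have iX k : is_ideal (id_add (B N) (M k)) by apply: ideal_add; exact: iMI.
elim: j i => [i|j IH i ij].
  by rewrite addn0 => ->; rewrite box_top; apply: (@length_le_weaken _ 0); [exact: iMI| |].
have {}IH := IH i.+1; rewrite addSnnS in IH; have {}IH := IH ij.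
have [[b Gb rkb]|nob] := pselect (exists2 b, b \in G & mrank d (ext b) = i).
  rewrite -rkb card_box_from // rkb /=; exists (id_add (B N) (M i.+1)).
  by split => //; rewrite -rkb; exact: box_step_simple.
rewrite (@box_step _ i); last first.
  move=> b rkb; rewrite -rkb; apply: hG; apply/negP => Gb; apply: nob.
  by exists b.
by rewrite box_from_skip // => b Gb rkb; apply: nob; exists b.
Qed.

(** Independence excludes only relations with later monomials, while [B N] also contains earlier
    ones. These are removed by increasing rank: a unit coefficient would contradict independence at
    that earlier monomial, and a coefficient in the maximal ideal moves the term to higher rank. *)
Lemma box_length_ge N : independent d x -> length_ge (N ^ d) (B N) setT.
Proof.
move=> ind.
have indB (b : {ffun 'I_d -> 'I_N}) :
    ~ id_add (B N) (M (mrank d (ext b)).+1) (mon (ext b)).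
  pose Bge i : set R := mono_ideal d x
    [set al | (i <= mrank d al)%N /\ exists2 l, (l < d)%N & (N <= al l)%N].
  have Bge_rank i : Bge i `<=` M i by apply: mono_ideal_mono => al [].
  suff main i : (i <= (mrank d (ext b)).+1)%N ->
      ~ exists2 w, Bge i w & M (mrank d (ext b)).+1 (mon (ext b) - w).
    move=> [w Bw Mw]; apply: (main 0%N (leq0n _)); exists w => //.
    by apply: mono_ideal_mono Bw => al.
  move=> ib; rewrite -(subKn ib); elim: (_ - i)%N => [|j IH].
    rewrite subn0 => -[w /Bge_rank Bw Mw]; apply: (ind (ext b)).
    exact: (idlBl (iMI _) Bw).
  rewrite subnS; have := leq_subr j (mrank d (ext b)).+1.
  move: (_ - j)%N IH => k IH kb'.
  have [k0|k0] := posnP k; first by rewrite k0 in IH *.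
  move=> [w Bw Mw]; apply: IH; exists w => //.
  have [[al [rkal [l lt_ld Nal]]]|noal] := pselect (exists al, mrank d al = k.-1 /\
     exists2 l, (l < d)%N & (N <= al l)%N); last first.
    apply: mono_ideal_mono Bw => al [kal hal]; split => //.
    rewrite -(prednK k0) ltn_neqAle kal andbT; apply/eqP => e.
    by apply: noal; exists al.
  have [|r hr] := mono_ideal_split (P := [set al | (k <= mrank d al)%N /\
     exists2 l, (l < d)%N & (N <= al l)%N]) (be := al) _ Bw.
    move=> be [+ hbe]; rewrite leq_eqVlt => /predU1P[e|]; last first.
      by rewrite prednK // => kbe; left.
    by right; apply: eq_mon; apply: mrank_inj; rewrite rkal.
  rewrite -[w](subrK (r * mon al)); apply: (idlD (iMI _)) => //.
  have [Dr|/loc.2[t rt]] := pselect (D 1 r).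
    rewrite deg_ideal_exact in Dr.
    have iC := ideal_colon (mon al) (iMI [set al | (k <= mrank d al)%N /\
     exists2 l, (l < d)%N & (N <= al l)%N]).
    apply: (mono_ideal_min iC _ Dr) => be /= degbe.
    rewrite /colon /= -monD; apply: mono_idealP; split.
      rewrite -(prednK k0) -rkal; apply: mrank_deg.
      by rewrite mdegD degbe.
    by exists l => //; apply: leq_trans Nal _; exact: leq_addl.
  have kb : (k.-1 <= mrank d (ext b))%N.
    by rewrite -ltnS prednK.
  have neq : k.-1 <> mrank d (ext b).
    rewrite -rkal => /mrank_inj /(_ l lt_ld) e; move: Nal; rewrite e leqNgt.
    by rewrite -[l]/(val (Ordinal lt_ld)) box_extE ltn_ord.
  case: (ind al); rewrite rkal prednK //.
  have -> : mon al = t * ((mon (ext b) - (mon (ext b) - w)) - (w - r * mon al)) +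
    (1 - r * t) * mon al by ring.
  rewrite rt subrr mul0r addr0; apply: (idlM _ (iMI _)); apply: (idlB (iMI _)).
    have kb2 : (k <= mrank d (ext b))%N.
      by rewrite -(prednK k0) ltn_neqAle kb andbT; exact/eqP.
    apply: (idlB (iMI _)); first exact: mono_idealP.
    by apply: rank_ideal_le Mw; exact: leqW.
  by apply: mono_ideal_mono hr => be [].
have -> : (N ^ d)%N = #|[set: {ffun 'I_d -> 'I_N}]%SET|.
  by rewrite cardsT card_ffun !card_ord.
rewrite -(box_bottom N) -(box_from0 [set: _]%SET).
suff main j i : (i + j = 'C((d * N).+1 + d, d))%N ->
    length_ge #|box_from [set: {ffun 'I_d -> 'I_N}]%SET i| (B N) (id_add (B N) (M i)).
  exact: main (add0n _).
have iX k : is_ideal (id_add (B N) (M k)) by apply: ideal_add; exact: iMI.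
elim: j i => [i|j IH i ij].
  rewrite addn0 => ->; rewrite box_top.
  rewrite (_ : box_from _ _ = finset.set0) ?cards0 //; apply/setP => b; rewrite !inE /=.
  apply/negbTE/negP => /mdeg_of_rank; rewrite ltnNge => /negP; apply.
  apply: leqW; have -> : (d * N = \sum_(i < d) N)%N by rewrite sum_nat_const card_ord.
  by apply: leq_sum => l _; rewrite box_extE ltnW.
have {}IH := IH i.+1; rewrite addSnnS in IH; have {}IH := IH ij.
have [[b rkb]|nob] := pselect (exists b : {ffun 'I_d -> 'I_N}, mrank d (ext b) = i).
  rewrite -rkb card_box_from ?inE // rkb /=; exists (id_add (B N) (M i.+1)).
  split => //; first by apply: add_mono => //; exact: rank_idealS.
  exists (mon (ext b)); last by rewrite -rkb; exact: indB.
  by apply: sub_addr; [exact: iMI|apply: mono_idealP; rewrite /= rkb].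
rewrite (@box_step _ i); last by move=> b rkb; case: nob; exists b.
by rewrite box_from_skip // => b Gb rkb; apply: nob; exists b.
Qed.

Lemma box_length_le_full N : length_le (N ^ d) (B N) setT.
Proof.
have -> : (N ^ d)%N = #|[set: {ffun 'I_d -> 'I_N}]%SET|.
  by rewrite cardsT card_ffun !card_ord.
by apply: box_length_le => b; rewrite inE.
Qed.

End Local.

(** * Growth of lengths along chains of primes *)

Section NoetherianLocal.
Variables (R : comPzRingType) (d : nat) (x : nat -> R).
Hypothesis noR : noetherian R.
Hypothesis loc : local_gen d x.

Local Notation D := (deg_ideal d x).
Local Notation B := (box_ideal d x).

Let iMI := mono_ideal_ideal d x.

(** Artin-Rees puts [z], up to an element of [I], into the maximal ideal times [I + (z)]; Nakayama
    concludes. *)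
Lemma krull_intersection I z : is_ideal I -> (forall n, id_add I (D n) z) -> I z.
Proof.
move=> iI hz; have igz := ideal_gen_ideal [set z].
pose N := id_add I (ideal_gen [set z]).
have iN : is_ideal N by exact: ideal_add.
have [k hk] := artin_rees d x noR iN.
have [y Iy Dzy] := hz k.+1.
have [m Dm Izm] : exists2 m, D 1 m & I (z - y - m * z).
  have Nzy : N (z - y).
    apply: (idlB iN); first by apply: sub_addr => //; exact: sub_ideal_gen.
    exact: sub_addl.
  have := hk k.+1 (leqnSn k) _ Nzy Dzy; rewrite subSnn.
  exact: (ideal_mul_add_gen1 (iMI _) iI).
have [t mt] := local_unit loc Dm.
have -> : z = t * ((z - y - m * z) + y) + (1 - (1 - m) * t) * z by ring.
rewrite mt subrr mul0r addr0; apply: (idlM _ iI).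
exact: (idlD iI).
Qed.

(* By the Artin-Rees lemma, passing from [R / P 0] to [R / P 1] lowers the
   growth of lengths by a degree. *)
Lemma prime_chain_growth j P : prime_chain j P -> forall C, exists n c,
  length_ge c (id_add (P 0%N) (D n)) setT /\ (C * n ^ j < c * n)%N.
Proof.
(* The inequality says that the length exceeds [C n^(j-1)]; the factor [n] on the right avoids a
   negative exponent at [j = 0]. *)
elim: j P => [|j IH] P [prP sP] C.
  have [iP0 P01 _] := prP 0%N isT.
  exists C.+1, 1%N; split; last by rewrite expn0 muln1 mul1n.
  apply: (@length_ge1 _ _ _ 1) => //; first exact: ideal_add iP0 (iMI _).
  move=> h; apply: loc.1; move: h; apply: (add_min (iMI _)).
    exact: (proper_sub_deg1 loc).
  exact: deg_ideal_le.
have [iP0 P01 prP0] := prP 0%N isT; have [iP1 P11 prP1] := prP 1%N isT.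
have [P01sub [a [P1a P0a]]] : P 0%N `<=` P 1%N /\ exists a, P 1%N a /\ ~ P 0%N a.
  have [s ns] := sP 0%N isT; split => //; apply: contrapT => h; apply: ns => a P1a.
  by apply: contrapT => P0a; apply: h; exists a.
have iga := ideal_gen_ideal [set a].
have iN : is_ideal (id_add (P 0%N) (ideal_gen [set a])) by exact: ideal_add.
have [k hk] := artin_rees d x noR iN.
have iPD n : is_ideal (id_add (P 0%N) (D n)) by exact: ideal_add iP0 (iMI _).
(* Modulo [P 0] the element [a] is a nonzerodivisor, so Artin-Rees bounds by [k] how much deeper
   multiplication by [a] can push an element. *)
have colonP n : (k <= n)%N ->
    colon (id_add (P 0%N) (D n)) a `<=` id_add (P 0%N) (D (n - k)).
  move=> kn y [u P0u Dyu].
  have [m Dm P0m] : exists2 m, D (n - k) m & P 0%N (y * a - u - m * a).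
    have Nyu : id_add (P 0%N) (ideal_gen [set a]) (y * a - u).
      apply: (idlB iN); last exact: sub_addl.
      by apply: sub_addr => //; apply/ideal_gen1P; exists y.
    exact: (ideal_mul_add_gen1 (iMI _) iP0 (hk n kn _ Nyu Dyu)).
  exists (y - m); last by rewrite opprB addrC subrK.
  case: (prP0 (y - m) a) => //; rewrite mulrBl.
  have -> : y * a - m * a = (y * a - u - m * a) + u by ring.
  exact: idlD.
(* The multiples of [a] in the quotient at depth [n'] have at least the length of the quotient at
   depth [n' - k], and what remains maps onto the quotient for [P 1]: every [k] further powers gain
   another [c]. *)
have iter_len c n i : length_ge c (id_add (P 1%N) (D n)) setT ->
    length_ge (i * c) (id_add (P 0%N) (D (n + i * k))) setT.
  move=> hc; elim: i => [//|i IHi]; set n' := (n + i.+1 * k)%N.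
  have nE : (n + i * k = n' - k)%N by rewrite /n' mulSn addnCA addKn.
  have kn' : (k <= n')%N by rewrite /n' mulSn addnCA leq_addr.
  pose J := id_add (id_add (P 0%N) (D n')) (id_scale a setT).
  have iJ : is_ideal J by apply: ideal_add => //; exact: ideal_scale.
  rewrite mulSn addnC; apply: (length_ge_trans iJ).
    have iC := ideal_colon a (iPD n').
    apply: (length_ge_le_l (@sub_addl _ _ _ (ideal_scale a iC))).
    apply: length_ge_scale => //.
    by apply: length_ge_le_l IHi; rewrite nE; exact: colonP.
  apply: length_ge_le_l hc; have iX := ideal_add iP1 (iMI [set al | (n <= mdeg d al)%N]).
  apply: add_min => //.
    apply: add_min => // [z P0z|z Dz]; first by apply: (sub_addl (iMI _)); exact: P01sub.
    apply: sub_addr => //; apply: deg_ideal_le Dz; exact: leq_addr.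
  by move=> _ [b _ ->]; apply: (idlM _ iX); exact: (sub_addl (iMI _)).
(* Gaining [c] a total of [n] times gives length [n * c] at depth [n * k.+1]; the factor [k.+1 ^ j]
   in the constant pays for the greater depth. *)
have [|n [c [hc lt]]] := IH (fun i => P i.+1) _ (C * k.+1 ^ j)%N.
  by split=> i ij; [exact: prP|exact: sP].
exists (n * k.+1)%N, (n * c)%N; split.
  by rewrite mulnS; exact: iter_len.
have n0 : (0 < n)%N by case: n lt {hc} => //; rewrite muln0.
have -> : (C * (n * k.+1) ^ j.+1 = (C * k.+1 ^ j * n ^ j) * (n * k.+1))%N.
  by rewrite expnMn !expnS; nia.
have -> : (n * c * (n * k.+1) = (c * n) * (n * k.+1))%N by nia.
by rewrite ltn_pmul2r // muln_gt0 n0.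
Qed.

(** The [i]-th entry has at most [al i] choices and each other entry has [n]; the factor [n] on the
    left avoids the exponent [d.-1]. *)
Lemma card_box_small n (al : nat -> nat) (i : 'I_d) :
  (#|[set b : {ffun 'I_d -> 'I_n} | (b i < al i)%N]%SET| * n <= al i * n ^ d)%N.
Proof.
pose F (j : 'I_d) : {pred 'I_n} := if j == i then [pred v : 'I_n | (v < al i)%N] else predT.
have -> : #|[set b : {ffun 'I_d -> 'I_n} | (b i < al i)%N]%SET| = #|family F|.
  apply: eq_card => b; rewrite inE; apply/idP/familyP => [h j|/(_ i)]; last by rewrite /F eqxx inE.
  by rewrite /F; case: eqP => [->|_]; rewrite inE.
rewrite card_family foldrE big_map big_enum /= (bigD1 i) //=.
rewrite (eq_bigr (fun=> n)) => [|j ji]; last first.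
  by rewrite /F (negbTE ji) card_ord.
rewrite prod_nat_const.
have -> : #|(fun j : 'I_d => j != i)| = d.-1 by rewrite cardC1 card_ord.
rewrite -mulnA -expnSr prednK; last exact: leq_ltn_trans (ltn_ord i).
rewrite leq_mul2r /F eqxx; apply/orP; right.
have [ain|nai] := leqP (al i) n; last first.
  by apply: leq_trans (ltnW nai); rewrite -[leqRHS]card_ord; exact: max_card.
rewrite -[leqRHS]card_ord; apply: leq_trans (leq_image_card (widen_ord ain) predT).
apply: subset_leq_card; apply/fintype.subsetP => v; rewrite inE => vai.
have -> : v = widen_ord ain (Ordinal vai) by apply: val_inj.
by apply: map_f; rewrite mem_enum.
Qed.

(* A relation between monomials would cut the growth of [R / m^n] down to
   degree [d - 1]. *)
Lemma prime_chain_independent (P : nat -> set R) : prime_chain d P -> independent d x.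
Proof.
move=> chP al hal.
(* The constant comes from counting the box monomials not divisible by [mon d x al]: coordinate [i]
   accounts for at most [al i] times [n^(d-1)] of them. *)
have [n [c [hc lt]]] := prime_chain_growth chP (\sum_(i < d) al i)%N.
pose G := [set b : {ffun 'I_d -> 'I_n} | [exists i : 'I_d, (b i < al i)%N]]%SET.
have hG : length_le #|G| (B n) setT.
  apply: box_length_le => // b; rewrite inE negb_exists => /forallP ge.
  apply: sub_addr; first exact: iMI.
  have [|ga bE] := @madd_sub d al (box_ext b).
    move=> i lt_id; rewrite -[i]/(val (Ordinal lt_id)) box_extE leqNgt.
    exact: ge.
  have := mulmon_rank_ideal (ga := ga) hal; rewrite -monD -(eq_mon x bE).
  rewrite (_ : mrank d (madd ga al) = mrank d (box_ext b)) //.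
  exact: eq_mrank.
have cG : (c <= #|G|)%N.
  apply: (length_ge_le (iMI _) (ideal_setT _) _ hG); apply: length_ge_le_l hc.
  move=> z /box_ideal_sub_deg Dz; apply: sub_addr => //.
  by have [] := chP.1 0%N isT.
move: lt; rewrite ltnNge => /negP; apply.
apply: leq_trans (leq_mul cG (leqnn n)) _.
have GE : (#|G| <= \sum_(i < d) #|[set b : {ffun 'I_d -> 'I_n} | (b i < al i)%N]%SET|)%N.
  have -> : G = (\bigcup_(i < d) [set b : {ffun 'I_d -> 'I_n} | (b i < al i)%N])%SET.
    apply/setP => b; rewrite inE; apply/existsP/bigcupP => [[i h]|[i _]].
      by exists i => //; rewrite inE.
    by rewrite inE; exists i.
  apply: (big_ind2 (fun (X : {set _}) m => #|X| <= m)%N) => [|X m Y m' Xm Ym|//].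
    by rewrite cards0.
  apply: leq_trans (leq_add Xm Ym); rewrite cardsU; exact: leq_subr.
apply: leq_trans (leq_mul GE (leqnn n)) _.
by rewrite !big_distrl /=; apply: leq_sum => i _; exact: card_box_small.
Qed.

End NoetherianLocal.

Lemma regular_local_system (R : comPzRingType) : regular_local_ring R ->
  exists d (x : nat -> R), local_gen d x /\ independent d x.
Proof.
move=> [noR [m [maxm unim]] [d [x [[[P chP] _] maxx]]]].
pose y i := nth 0 x i.
have mE : m = ideal_gen [set` x] by apply: unim.
have DE : deg_ideal d y 1 = ideal_gen [set` x].
  apply/seteqP; split.
    apply: deg_ideal1_gen => [|i lt_id]; first exact: ideal_gen_ideal.
    by apply: sub_ideal_gen; rewrite /= mem_nth // size_tuple.
  apply: ideal_gen_min => [|a /= /(nthP 0)[i + <-]]; first exact: mono_ideal_ideal.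
  by rewrite size_tuple; exact: mem_deg_ideal1.
have [_ nm1 _] := maxx.
have loc : local_gen d y.
  split; first by rewrite DE.
  rewrite DE => r nr; apply: contrapT => nunit; apply: nr.
  (* A maximal member of this family is a maximal ideal, hence the unique one, and it contains
     [r]. *)
  pose F := [set I | [/\ is_ideal I, I r & ~ I 1]].
  have Fr : F (ideal_gen [set r]).
    split; [exact: ideal_gen_ideal|exact: sub_ideal_gen|].
    by move=> /ideal_gen1P[t]; rewrite mulrC => e; apply: nunit; exists t.
  have [||I [iI Ir nI1] Imax] := @noetherian_max _ F noR; first by move=> I [].
    by exists (ideal_gen [set r]).
  rewrite -mE (unim I) //; split => // J iJ IJ nJ1; apply: Imax => //.
  by split => //; exact: IJ.
exists d, y; split => //.
exact: prime_chain_independent noR loc _ chP.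
Qed.

(** * Complete local rings *)

Lemma field_noetherian (F : fieldType) : noetherian F.
Proof.
move=> I iI; have [[a Ia a0]|noa] := pselect (exists2 a, I a & a != 0).
  exists [:: 1]; have I1 : I 1 by rewrite -(mulVf a0); exact: (idlM _ iI).
  rewrite (ideal_eqT iI I1); apply/esym/ideal_eqT; first exact: ideal_gen_ideal.
  by apply: sub_ideal_gen; rewrite /= mem_head.
exists [::]; apply/seteqP; split => [a Ia|a /ideal_gen_nil ->]; last exact: idl0.
have [->|a0] := eqVneq a 0; first exact: (idl0 (ideal_gen_ideal _)).
by case: noa; exists a.
Qed.

Section Complete.
Variables (R : comPzRingType) (d : nat) (x : nat -> R).

Local Notation mon := (mon d x).
Local Notation D := (deg_ideal d x).
Local Notation M := (rank_ideal d x).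

Definition separated := forall z, (forall n, D n z) -> z = 0.
Definition complete := forall u : nat -> R, (forall n, D n (u n.+1 - u n)) ->
  exists y, forall n, D n (y - u n).

Hypothesis loc : local_gen d x.
Hypothesis sep : separated.
Hypothesis compl : complete.

Let iMI := mono_ideal_ideal d x.

Definition id_closure (I : set R) : set R := [set z | forall n, id_add I (D n) z].

Lemma ideal_closure I : is_ideal I -> is_ideal (id_closure I).
Proof.
move=> iI; have iX n : is_ideal (id_add I (D n)) by exact: ideal_add iI (iMI _).
split; first by move=> n; exact: (idl0 (iX n)).
  by move=> a b ha hb n; apply: (idlD (iX n)).
by move=> a b hb n; apply: (idlM _ (iX n)).
Qed.

(* The elements whose initial monomials generate all the initial monomials
   of [I] form a standard basis; division by it converges. *)
Lemma standard_basis I : is_ideal I -> exists s : seq R,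
  [set` s] `<=` I /\ id_closure I `<=` ideal_gen [set` s].
Proof.
move=> iI; have iC := ideal_closure iI.
(* With all coefficients equal to 1 in a field, [dickson_basis] is Dickson's lemma proper: an
   exponent divisible by no basis exponent would put 1 into the zero ideal. *)
pose X : set ((nat -> nat) * rat) :=
  [set p | p.2 = 1 /\ exists2 y, I y & M (mrank d p.1).+1 (y - mon p.1)].
have [n [F [XF genF]]] := dickson_basis d (@field_noetherian rat) X.
have /choice[y yP] : forall i, exists y, (i < n)%N ->
    I y /\ M (mrank d (F i).1).+1 (y - mon (F i).1).
  move=> i; have [lt_in|] := boolP (i < n)%N; last by exists 0.
  by have [_ [z Iz Mz]] := XF i lt_in; exists z.
pose D0 := \max_(i < n) mdeg d (F i).1.
pose U m k : set R := mono_ideal d x [set al | (m <= mdeg d al)%N /\ (k <= mrank d al)%N].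
pose comb (c : nat -> R) := \sum_(i < n) c i * y i.
have Icomb c : I (comb c).
  by apply: idl_sum => // i _; apply: (idlM _ iI); exact: (yP _ (ltn_ord i)).1.
have Ccomb c : id_closure I (comb c) by move=> k; exact: (sub_addl (iMI _)).
have combB c e : comb (fun i => c i + e i) = comb c + comb e.
  by rewrite /comb -big_split; apply: eq_bigr => i _; rewrite mulrDl.
have step m k z : id_closure I z -> U m k z -> exists c : nat -> R,
    (forall i, D (m - D0) (c i)) /\ U m k.+1 (z - comb c).
  move=> Cz Uz.
  have stop : U m k.+1 z -> exists c : nat -> R,
    (forall i, D (m - D0) (c i)) /\ U m k.+1 (z - comb c).
    move=> h; exists (fun=> 0); split; first by move=> _; exact: (idl0 (iMI _)).
    by rewrite /comb big1 ?subr0 // => i _; rewrite mul0r.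
  have [[al [degal rkal]]|noal] :=
    pselect (exists al, (m <= mdeg d al)%N /\ mrank d al = k); last first.
    apply: stop; apply: mono_ideal_mono Uz => al [degal].
    rewrite leq_eqVlt => /predU1P[rkal|//].
    by case: noal; exists al.
  have [|r hr] := mono_ideal_split
     (P := [set be | (m <= mdeg d be)%N /\ (k < mrank d be)%N]) (be := al) _ Uz.
    move=> be [degbe]; rewrite leq_eqVlt => /predU1P[rkbe|]; last by left.
    by right; apply: eq_mon; apply: mrank_inj; rewrite rkal.
  (* A coefficient in the maximal ideal raises the rank of its term; a unit makes [al] an initial
     exponent of [I], hence divisible by a basis exponent. *)
  have [Dr|/loc.2[t rt]] := pselect (D 1 r).
    apply: stop; rewrite -[z](subrK (r * mon al)); apply: (idlD (iMI _)) => //.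
    have iA := ideal_colon (mon al) (iMI [set be | (m <= mdeg d be)%N /\ (k < mrank d be)%N]).
    apply: (mono_ideal_min iA _ Dr) => be /= degbe.
    rewrite /colon /= -monD; apply: mono_idealP; split => /=.
      by rewrite mdegD (leq_trans degal) // leq_addl.
    by rewrite -rkal; apply: mrank_deg; rewrite mdegD -add1n leq_add2r.
  have [i [lt_in le_i]] : exists i, (i < n)%N /\ mle d (F i).1 al.
    apply: contrapT => noi; have : X (al, 1).
      split => //=; have [w Iw Dzw] := Cz (mdeg d al).+1.
      exists (t * w); first exact: (idlM _ iI).
      have -> : t * w - mon al = t * ((z - r * mon al) - (z - w)) - (1 - r * t) * mon al.
        by ring.
      rewrite rt subrr mul0r subr0; apply: (idlM _ (iMI _)); apply: (idlB (iMI _)).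
        by apply: mono_ideal_mono hr => be []; rewrite rkal.
      exact: deg_ideal_sub_rank.
    move=> /genF /=; rewrite (_ : mono_multiples _ _ _ _ = [set` [::]]).
      by move=> /ideal_gen_nil /eqP; rewrite oner_eq0.
    apply/seteqP; split => // c [i [lt_in le_i _]].
    by case: noi; exists i.
  have [ga alE] := madd_sub le_i.
  have [Iy My] := yP i lt_in.
  have monE : mon al = mon ga * mon (F i).1 by rewrite -monD; exact: eq_mon.
  have degE : mdeg d al = (mdeg d ga + mdeg d (F i).1)%N.
    by rewrite -mdegD; apply: eq_bigr => q _; exact: alE.
  exists (fun j => if j == i then r * mon ga else 0); split.
    move=> j; case: eqP => _; last exact: (idl0 (iMI _)).
    apply: (idlM _ (iMI _)); apply: mono_idealP => /=.
    rewrite leq_subLR (leq_trans degal) // degE addnC leq_add2r.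
    exact: (leq_bigmax (Ordinal lt_in)).
  rewrite /comb (bigD1 (Ordinal lt_in)) //= eqxx big1 ?addr0; last first.
    by move=> j; rewrite -val_eqE /= => /negbTE->; rewrite mul0r.
  have -> : z - r * mon ga * y i =
      (z - r * mon al) - r * (mon ga * (y i - mon (F i).1)) by rewrite monE; ring.
  apply: (idlB (iMI _)) => //; apply: (idlM _ (iMI _)).
  have := mulmon_rank_ideal (ga := ga) My; rewrite (eq_mrank alE) rkal.
  apply: mono_ideal_mono => be /= kbe; split => //.
  by apply: leq_trans degal _; apply: mrank_degW; rewrite rkal; exact: ltnW.
have stepD m z : exists c : nat -> R, id_closure I z -> D m z ->
    (forall i, D (m - D0) (c i)) /\ D m.+1 (z - comb c).
  have [[Cz Dz]|nz] := pselect (id_closure I z /\ D m z); last first.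
    by exists (fun=> 0) => Cz Dz; case: nz.
  suff [c [Dc hc]] : exists c : nat -> R,
      (forall i, D (m - D0) (c i)) /\ U m 'C(m + d, d) (z - comb c).
    exists c => _ _; split => //.
    by apply: mono_ideal_mono hc => al [_ /mdeg_of_rank].
  elim: 'C(m + d, d) => [|k [c [Dc hc]]].
    exists (fun=> 0); split; first by move=> _; exact: (idl0 (iMI _)).
    rewrite /comb big1 ?subr0; last by move=> i _; rewrite mul0r.
    by apply: mono_ideal_mono Dz => al.
  have [|e [De he]] := step _ _ _ _ hc; first exact: (idlB iC).
  exists (fun i => c i + e i); split; first by move=> i; exact: (idlD (iMI _) (Dc i) (De i)).
  by rewrite combB opprD addrA.
have [f fP] := choice (fun mz : nat * R => stepD mz.1 mz.2).
exists [seq y i | i <- iota 0 n]; split.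
  move=> _ /= /mapP[i + ->]; rewrite mem_iota => /andP[_ lt_in].
  exact: (yP i lt_in).1.
move=> w Cw.
pose Z m := iteri m (fun l z => z - comb (f (l, z))) w.
have ZP m : id_closure I (Z m) /\ D m (Z m).
  elim: m => [|m [CZ DZ]]; first by rewrite deg_ideal0.
  have [_ hD] := fP (m, _) CZ DZ; split => //=.
  exact: (idlB iC).
pose c m i := f (m, Z m) i.
have Dc m i : D (m - D0) (c m i).
  by have [CZ DZ] := ZP m; have [h _] := fP (m, _) CZ DZ; exact: h.
(* Cancelling a term of degree [m] takes a coefficient of degree at least [m - D0]; the shift by
   [D0] makes up for this, so that successive sums differ by an element of [D m]. *)
pose u i m := \sum_(l < m + D0) c l i.
have ZE m : Z m = w - comb (fun i => \sum_(l < m) c l i).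
  elim: m => [|m IH].
    by rewrite /comb big1 ?subr0 // => i _; rewrite big_ord0 mul0r.
  have -> : Z m.+1 = Z m - comb (c m) by [].
  rewrite IH -addrA -opprD -combB; congr (_ - _).
  by apply: eq_bigr => i _; rewrite big_ord_recr.
have /choice[v vP] : forall i, exists v, forall m, D m (v - u i m).
  move=> i; apply: compl => m.
  rewrite /u addSn big_ord_recr /= [_ + c _ i]addrC addrK.
  by have := Dc (m + D0)%N i; rewrite addnK.
have -> : w = comb v.
  apply/eqP; rewrite -subr_eq0; apply/eqP; apply: sep => m.
  have -> : w - comb v = Z (m + D0)%N - comb (fun i => v i - u i m).
    rewrite ZE -addrA -opprD -combB; congr (_ - _).
    by apply: eq_bigr => i _; rewrite /u addrC subrK.
  apply: (idlB (iMI _)).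
    by apply: deg_ideal_le (ZP _).2; exact: leq_addr.
  by apply: (idl_sum _ (iMI _)) => i _; exact: (idlMr _ (iMI _) (vP i m)).
apply: (idl_sum _ (ideal_gen_ideal _)) => i _; apply: (idlM _ (ideal_gen_ideal _)).
apply: sub_ideal_gen; apply/mapP; exists (val i) => //.
by rewrite mem_iota /=.
Qed.

Lemma closed_ideal I : is_ideal I -> id_closure I `<=` I.
Proof.
move=> iI; have [s [sI h]] := standard_basis iI.
by apply: subset_trans h _; exact: ideal_gen_min.
Qed.

Lemma complete_noetherian : noetherian R.
Proof.
move=> I iI; have [s [sI h]] := standard_basis iI; exists s.
apply/seteqP; split; last exact: ideal_gen_min.
by apply: subset_trans h => z Iz n; exact: (sub_addl (iMI _)).
Qed.

End Complete.

(** * Frobenius powers *)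

(** Stands for characteristic [p] with [q] a power of [p]; in this form it passes to the completion
    by density. *)
Definition frob_exponent (R : comPzRingType) (q : nat) : Prop :=
  forall a b : R, (a + b) ^+ q = a ^+ q + b ^+ q.

Definition frob_root (R : comPzRingType) (q : nat) (a : set R) : set R :=
  \bigcap_(I in [set I | is_ideal I /\ a `<=` frobenius_power q I]) I.

Section FrobeniusPower.
Variables (R : comPzRingType) (q : nat).
Hypothesis frobq : frob_exponent R q.
Hypothesis q_gt0 : (0 < q)%N.
Implicit Types (A I J X : set R).

Local Notation FP := (@frobenius_power R q).

Lemma ideal_frob I : is_ideal (FP I). Proof. exact: ideal_gen_ideal. Qed.

Lemma mem_frob I a : I a -> FP I (a ^+ q).
Proof. by move=> Ia; apply: sub_ideal_gen; exists a. Qed.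

Lemma frob_min I X : is_ideal X -> (forall a, I a -> X (a ^+ q)) -> FP I `<=` X.
Proof. by move=> iX h; apply: ideal_gen_min => // _ [a /h Xa <-]. Qed.

Lemma frob_mono I J : I `<=` J -> FP I `<=` FP J.
Proof.
by move=> IJ; apply: frob_min; [exact: ideal_frob|move=> a /IJ; exact: mem_frob].
Qed.

Lemma frob_pre_ideal X : is_ideal X -> is_ideal [set a | X (a ^+ q)].
Proof.
move=> iX; split => /=.
- by rewrite expr0n eqn0Ngt q_gt0; exact: idl0.
- by move=> a b Xa Xb; rewrite frobq; exact: idlD.
- by move=> a b Xb; rewrite exprMn; exact: idlM.
Qed.

Lemma frob_gen_min A X : is_ideal X -> (forall a, A a -> X (a ^+ q)) ->
  FP (ideal_gen A) `<=` X.
Proof.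
move=> iX h; apply: frob_min => // a.
exact: (ideal_gen_min (frob_pre_ideal iX)).
Qed.

Lemma frob_setT : FP setT = setT.
Proof.
by apply: ideal_eqT; [exact: ideal_frob|rewrite -(expr1n _ q); exact: mem_frob].
Qed.

Lemma frob_add I J : FP (id_add I J) `<=` id_add (FP I) (FP J).
Proof.
have iX := ideal_add (ideal_frob I) (ideal_frob J).
apply: frob_min => // z [a Ia Jza]; rewrite -[z](subrK a) addrC frobq.
apply: (idlD iX).
  by apply: (sub_addl (ideal_frob J)); exact: mem_frob.
by apply: (sub_addr (ideal_frob I)); exact: mem_frob.
Qed.

Lemma frob_sub I : is_ideal I -> FP I `<=` I.
Proof.
move=> iI; apply: frob_min => // a Ia.
by rewrite -(prednK q_gt0) exprS; exact: idlMr.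
Qed.

Lemma frob_root_ideal A : is_ideal (frob_root q A).
Proof. by apply: ideal_bigcap => I []. Qed.

Lemma frob_root_min A I : is_ideal I -> A `<=` FP I -> frob_root q A `<=` I.
Proof. by move=> iI AI z; apply. Qed.

End FrobeniusPower.

Lemma frob_comp (R : comPzRingType) (q r : nat) (I : set R) :
  frob_exponent R q -> (0 < q)%N ->
  frobenius_power q (frobenius_power r I) = frobenius_power (r * q) I.
Proof.
move=> frobq q_gt0; apply/seteqP; split.
  apply: frob_gen_min => //; first exact: ideal_frob.
  by move=> _ [a Ia <-]; rewrite -exprM; exact: mem_frob.
apply: frob_min; first exact: ideal_frob.
by move=> a Ia; rewrite exprM; apply: mem_frob; exact: mem_frob.
Qed.

(** * Flatness of Frobenius for ideals of finite colength *)

Section FrobeniusFlat.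
Variables (R : comPzRingType) (d : nat) (x : nat -> R) (q : nat).
Hypothesis loc : local_gen d x.
Hypothesis ind : independent d x.
Hypothesis frobq : frob_exponent R q.
Hypothesis q_gt0 : (0 < q)%N.

Local Notation D := (deg_ideal d x).
Local Notation B := (box_ideal d x).
Local Notation FP := (@frobenius_power R q).

Let iMI := mono_ideal_ideal d x.

Lemma frob_box N : FP (B N) = B (q * N).
Proof.
apply/seteqP; split.
  apply: (frob_gen_min frobq q_gt0 (iMI _)) => _ [al [i lt_id Nal] <-].
  rewrite /mon -prodrXl (bigD1 (Ordinal lt_id)) //= -exprM.
  apply: (idlMr _ (iMI _)); rewrite -(subnK Nal) mulnDl exprD mulnC.
  by apply: (idlM _ (iMI _)); rewrite mulnC; exact: mem_box_ideal.
apply: box_ideal_gen; first exact: ideal_frob.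
by move=> i lt_id; rewrite mulnC exprM; apply: mem_frob; exact: mem_box_ideal.
Qed.

(** If [Y / X] is not zero, then [FP Y / FP X] is cyclic and killed by the Frobenius power of the
    maximal ideal, which is the box ideal [B q], of colength at most [q ^ d]. *)
Lemma simple_step_frob X Y : is_ideal X -> is_ideal Y -> simple_step X Y ->
  length_le (q ^ d) (FP X) (FP Y).
Proof.
move=> iX iY sXY; have [YX|nYX] := pselect (Y `<=` X).
  have -> : Y = X by apply/seteqP; split => //; exact: sXY.1.
  by apply: (@length_le_weaken _ 0); [exact: ideal_frob| |].
have [y Yy nXy] : exists2 y, Y y & ~ X y.
  apply: contrapT => h; apply: nYX => y Yy; apply: contrapT => nXy.
  by apply: h; exists y.
have iFX := ideal_frob q X.
have := length_le_scale (y ^+ q) iFX (iMI _) (box_length_le_full loc q).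
congr length_le; apply/seteqP; split.
- apply: add_min => // _ [b Bb ->].
  have iC := ideal_colon (y ^+ q) iFX.
  apply: (box_ideal_gen iC _ Bb) => i lt_id.
  rewrite /colon /= -exprMn; apply: mem_frob.
  apply: (simple_step_gen_inv loc iX iY sXY Yy nXy); exact: mem_deg_ideal1.
- exact: (sub_addl (ideal_scale _ (iMI _))).
- apply: add_min; [exact: ideal_frob|exact: frob_mono sXY.1|].
  by move=> _ [b _ ->]; apply: (idlM _ (ideal_frob _ _)); exact: mem_frob.
have iZ := ideal_add iFX (ideal_scale (y ^+ q) (ideal_setT R)).
apply: frob_min => // z Yz.
have [r Xr] := sXY.2 y z Yy Yz nXy.
rewrite -[z](subrK (r * y)) frobq; apply: (idlD iZ).
  by apply: (sub_addl (ideal_scale _ (ideal_setT R))); exact: mem_frob.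
by apply: (sub_addr iFX); exists (r ^+ q); rewrite ?exprMn.
Qed.

Lemma length_le_frob n X Y : is_ideal X -> is_ideal Y -> length_le n X Y ->
  length_le (n * q ^ d) (FP X) (FP Y).
Proof.
move=> iX; elim: n Y => [Y _ -> //|n IH Y iY [Y' [iY' /(IH _ iY') le sY]]].
by rewrite mulSn addnC; apply: length_le_trans le _; exact: simple_step_frob.
Qed.

(* Frobenius multiplies lengths by [q ^ d]; were the inclusion strict, the box
   ideal [B (q * N)] would have length less than [(q * N) ^ d]. *)
Lemma frob_colon_primary N I a z : is_ideal I -> D N `<=` I ->
  FP I (z * a ^+ q) -> FP (colon I a) z.
Proof.
move=> iI DI Iza; apply: contrapT => nz.
have iL := ideal_colon a iI; have iFI := ideal_frob q I.
have iFL := ideal_frob q (colon I a); have iL' := ideal_colon (a ^+ q) iFI.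
set L := colon I a in nz iL iFL; set L' := colon (FP I) (a ^+ q) in iL'.
have LL' : FP L `<=` L'.
  by apply: frob_min => // y Ly; rewrite /L' /colon /= -exprMn; exact: mem_frob.
have iaT := ideal_scale a (ideal_setT R).
pose X := id_add I (id_scale a setT).
have iX : is_ideal X by exact: ideal_add.
have IX : I `<=` X by exact: sub_addl.
have BI : B N `<=` I by apply: subset_trans DI; exact: box_ideal_sub_deg.
have IL : I `<=` L by exact: sub_colon.
have full := box_length_le_full loc N.
have [n1 _ [le1 ge1]] := length_exact (iMI _) (length_le_between (iMI _) (iMI _) iI
  (@subset_refl _ _) BI full).
have [n2 _ [le2 ge2]] := length_exact iL (length_le_between (iMI _) iL (ideal_setT R)
  (subset_trans BI IL) (@subsetT _ _) full).
have [n3 _ [le3 ge3]] := length_exact iX (length_le_between (iMI _) iX (ideal_setT R)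
  (subset_trans BI IX) (@subsetT _ _) full).
(* Multiplication by [a] identifies [R / L] with [X / I], so the three lengths add up along [B N],
   [I], [X] and the whole ring. *)
have low : (n1 + n2 + n3 <= N ^ d)%N.
  apply: (length_ge_le (iMI _) (ideal_setT R) _ full).
  apply: (length_ge_trans iX _ ge3); apply: (length_ge_trans iI ge1).
  apply: (length_ge_le_l _ (length_ge_scale iI iL (@subset_refl _ _) ge2)).
  exact: (sub_addl (ideal_scale _ iL)).
have := length_le_frob iL (ideal_setT R) le2; rewrite frob_setT => le2q.
have [m _ [lem gem]] := length_exact iL' (length_le_between iFL iL' (ideal_setT R)
  LL' (@subsetT _ _) le2q).
(* The element [z] of [L'] outside [FP L] makes the colength of [L'] strictly smaller than the bound
   for [FP L]. *)
have lt_m : (m < n2 * q ^ d)%N.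
  apply: (length_ge_le iFL (ideal_setT R) _ le2q).
  by rewrite -add1n; apply: (length_ge_trans iL' _ gem); apply: (length_ge1 iFL LL' Iza).
have le_m : length_le m (FP I) (FP X).
  have := length_le_scale (a ^+ q) iFI iL' lem.
  congr length_le; apply/seteqP; split.
  - by apply: add_min => // _ [b Lb ->].
  - exact: (sub_addl (ideal_scale _ iL')).
  - apply: add_min; [exact: ideal_frob|exact: frob_mono|].
    move=> _ [b _ ->]; apply: (idlM _ (ideal_frob _ _)); apply: mem_frob.
    by apply: (sub_addr iI); exists 1; rewrite ?mul1r.
  move=> w /(frob_add frobq); apply: add_mono => //.
  apply: frob_min; first exact: ideal_scale.
  by move=> _ [b _ ->]; exists (b ^+ q); rewrite ?exprMn.
have le1q := length_le_frob (iMI _) iI le1.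
have := length_le_frob iX (ideal_setT R) le3; rewrite frob_setT => le3q.
have := length_le_trans (length_le_trans le1q le_m) le3q.
rewrite frob_box => /(length_ge_le (iMI _) (ideal_setT R) (box_length_ge loc _ ind)).
rewrite expnMn => h.
have : ((n1 + n2 + n3) * q ^ d <= n1 * q ^ d + m + n3 * q ^ d)%N.
  by apply: leq_trans h; rewrite mulnC leq_mul2l low orbT.
by rewrite !mulnDl leq_add2r leq_add2l leqNgt lt_m.
Qed.

(** The generators of [I] are stripped off one at a time. If [z] is [r * b ^+ q] modulo [FP X], the
    colon formula puts [r] into the Frobenius power of [colon (id_add J X) b]; a multiple of [b] in
    [J + X] has its part from [J] in [I] as well, hence lies in [X]. *)
Lemma frob_setI_primary N I J : noetherian R -> is_ideal I -> is_ideal J ->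
  D N `<=` J -> FP I `&` FP J `<=` FP (I `&` J).
Proof.
move=> noR iI iJ DJ z [Iz Jz]; have iQ := ideal_setI iI iJ.
have [s sE] := noR I iI.
have igs := @ideal_gen_ideal R; have sI : [set` s] `<=` I by rewrite sE; exact: sub_ideal_gen.
have {Iz} : FP (id_add (I `&` J) (ideal_gen [set` s])) z.
  by apply: frob_mono Iz; rewrite {1}sE; exact: (sub_addr iQ).
elim: s sI {sE} => [_|b s IH bsI].
  apply: frob_mono; apply: (add_min iQ) => // a /ideal_gen_nil->.
  exact: (idl0 iQ).
have sI : [set` s] `<=` I by move=> a sa; apply: bsI; rewrite /= inE sa orbT.
have Ib : I b by apply: bsI; rewrite /= mem_head.
set X := id_add (I `&` J) (ideal_gen [set` s]) in IH *.
have iX : is_ideal X by exact: ideal_add.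
have XI : X `<=` I by apply: add_min => //; exact: ideal_gen_min.
have iFX := ideal_frob q X.
move=> Xbz; apply: IH => //.
have [w Xw [r _ zw]] : id_add (FP X) (id_scale (b ^+ q) setT) z.
  apply: (frob_min _ _ Xbz); first by apply: ideal_add => //; exact: ideal_scale.
  move=> a [u Qu /ideal_gen_cons[r hr]].
  have Xa : X (a - r * b) by exists u => //; rewrite addrAC.
  have aE : a ^+ q = (a - r * b) ^+ q + r ^+ q * b ^+ q by rewrite -exprMn -frobq subrK.
  exists ((a - r * b) ^+ q); first exact: mem_frob.
  by exists (r ^+ q) => //; rewrite aE addrC addKr.
have iJX := ideal_add iJ iX.
have : FP (colon (id_add J X) b) r.
  apply: (@frob_colon_primary N); [by []|by move=> y /DJ; exact: sub_addl|].
  rewrite -zw; apply: (idlB (ideal_frob _ _)).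
    by apply: frob_mono Jz; exact: sub_addl.
  by apply: frob_mono Xw; exact: sub_addr.
have iC := ideal_colon (b ^+ q) iFX.
move=> /(frob_min iC) h; rewrite -[z](subrK w) zw; apply: (idlD iFX) => //.
apply: h => t [j Jj Xtb]; rewrite /colon /= -exprMn; apply: mem_frob.
rewrite -[t * b](subrK j); apply: (idlD iX) => //.
apply: (sub_addl (igs _)); split => //.
have -> : j = t * b - (t * b - j) by ring.
by apply: (idlB iI); [exact: idlM|exact: XI].
Qed.

End FrobeniusFlat.

(** * Chevalley's theorem and Frobenius roots in complete rings *)

Section FrobeniusRoot.
Variables (R : comPzRingType) (d : nat) (x : nat -> R).
Hypothesis loc : local_gen d x.
Hypothesis sep : separated d x.
Hypothesis compl : complete d x.

Local Notation D := (deg_ideal d x).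

Let iMI := mono_ideal_ideal d x.
Let noR : noetherian R := complete_noetherian loc sep compl.

(** For each [N] some member is least modulo [D N]. An element of it is corrected successively into
    the members chosen for [N + 1], [N + 2], and so on; the limit lies in every member because
    ideals are closed. *)
Lemma chevalley (Fam : set (set R)) :
  Fam setT -> (forall L, Fam L -> is_ideal L) ->
  (forall L L', Fam L -> Fam L' -> Fam (L `&` L')) ->
  forall N, exists2 L, Fam L & L `<=` id_add (\bigcap_(L in Fam) L) (D N).
Proof.
move=> FT iF FI.
have iDa L N : Fam L -> is_ideal (id_add L (D N)) by move=> /iF iL; exact: ideal_add iL (iMI _).
(* A member of greatest colength after adding [D N] is least there: intersecting it with another
   member could only raise the colength, which is at most [N ^ d]. *)
have low N : exists L, Fam L /\ forall L', Fam L' -> L `<=` id_add L' (D N).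
  pose P n := `[< exists2 L, Fam L & length_ge n (id_add L (D N)) setT >].
  have exP : exists n, P n.
    exists 0%N; apply/asboolP; exists setT => //.
  have bd n : P n -> (n <= N ^ d)%N.
    move=> /asboolP[L FL ge].
    apply: (length_ge_le (iMI _) (ideal_setT R) _ (box_length_le_full loc N)).
    apply: length_ge_le_l ge => z /box_ideal_sub_deg Dz.
    by apply: (sub_addr (iF L FL)).
  have [n /asboolP[L FL ge] nmax] := ex_maxnP exP bd.
  exists L; split=> // L' FL' z Lz; apply: contrapT => nz.
  have FLL := FI _ _ FL FL'; suff /nmax : P n.+1 by rewrite ltnn.
  apply/asboolP; exists (L `&` L') => //; rewrite -add1n.
  apply: (length_ge_trans (iDa L N FL) _ ge).
  apply: (@length_ge1 _ _ _ z); first exact: iDa.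
  - by apply: add_mono => // w [].
  - exact: (sub_addl (iMI _)).
  - by move=> h; apply: nz; apply: add_mono h => // w [].
have [L LP] := choice low.
move=> N; exists (L N); first exact: (LP N).1.
move=> z Lz.
have nxt (p : nat * R) : exists y, id_add (L p.1) (D p.1) p.2 ->
    L p.1.+1 y /\ D p.1 (y - p.2).
  have [[l Ll Dl]|] := pselect (id_add (L p.1) (D p.1) p.2); last by exists 0.
  have [l' Ll' Dl'] := (LP p.1).2 _ (LP p.1.+1).1 _ Ll.
  exists l' => _; split => //.
  have -> : l' - p.2 = - (l - l') - (p.2 - l) by ring.
  by apply: (idlB (iMI _)) => //; exact: (idlN (iMI _)).
have [f fP] := choice nxt.
pose u := fix u k := if k is k'.+1 then f ((N + k')%N, u k') else z.
have uL k : L (N + k)%N (u k).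
  elim: k => [|k IH]; first by rewrite addn0.
  rewrite addnS; apply: (fP ((N + k)%N, u k) _).1 => /=.
  exact: (sub_addl (iMI _)).
have uD k : D (N + k) (u k.+1 - u k).
  by apply: (fP ((N + k)%N, u k) _).2 => /=; exact: (sub_addl (iMI _)).
have [k|y yP] := compl (u := u).
  by apply: deg_ideal_le (uD k); exact: leq_addl.
have uND k : D N (u k - z).
  elim: k => [|k IH]; first by rewrite subrr; exact: (idl0 (iMI _)).
  have -> : u k.+1 - z = (u k.+1 - u k) + (u k - z) by ring.
  by apply: (idlD (iMI _)) => //; apply: deg_ideal_le (uD k); exact: leq_addr.
exists y.
  move=> L' FL'; apply: (closed_ideal loc sep compl (iF _ FL')) => k.
  have [l Ll Dl] := (LP (N + k)%N).2 _ FL' _ (uL k).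
  exists l => //; have -> : y - l = (y - u k) + (u k - l) by ring.
  apply: (idlD (iMI _) (yP k)); apply: deg_ideal_le Dl; exact: leq_addl.
have -> : z - y = - (u N - z) - (y - u N) by ring.
exact: (idlB (iMI _) (idlN (iMI _) (uND N)) (yP N)).
Qed.

Hypothesis ind : independent d x.

Section Exponent.
Variable q : nat.
Hypothesis frobq : frob_exponent R q.
Hypothesis q_gt0 : (0 < q)%N.

Local Notation FP := (@frobenius_power R q).

Lemma frob_closure_sub I N : FP (id_add I (D N)) `<=` id_add (FP I) (D N).
Proof.
move=> z /(frob_add frobq); apply: add_mono => //.
exact: (frob_sub q_gt0 (iMI _)).
Qed.

(* By Chevalley's theorem the ideals of finite colength whose Frobenius power
   contains [A] are cofinal with their intersection. *)
Lemma frob_root_sub A : A `<=` FP (frob_root q A).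
Proof.
pose Fam := [set L | [/\ is_ideal L, exists N, D N `<=` L & A `<=` FP L]].
have iF L : Fam L -> is_ideal L by case.
have FamI L L' : Fam L -> Fam L' -> Fam (L `&` L').
  move=> [iL [N DL] AL] [iL' [N' DL'] AL']; split; first exact: ideal_setI.
    exists (maxn N N') => z Dz; split.
      by apply: DL; apply: deg_ideal_le Dz; exact: leq_maxl.
    by apply: DL'; apply: deg_ideal_le Dz; exact: leq_maxr.
  move=> z Az; apply: (frob_setI_primary loc ind frobq q_gt0 noR iL iL' DL').
  by split; [exact: AL|exact: AL'].
have FamT : Fam setT.
  by split => //; [exists 0%N|rewrite frob_setT].
have iC : is_ideal (\bigcap_(L in Fam) L) by exact: ideal_bigcap.
have AC : A `<=` FP (\bigcap_(L in Fam) L).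
  move=> z Az; apply: (closed_ideal loc sep compl (ideal_frob _ _)) => N.
  have [L [_ _ AL] LC] := chevalley FamT iF FamI N.
  by apply: frob_closure_sub; apply: frob_mono LC _ (AL _ Az).
apply: subset_trans AC _; apply: frob_mono => z Cz I [iI AI].
apply: (closed_ideal loc sep compl iI) => N; apply: Cz; split.
- exact: ideal_add iI (iMI _).
- by exists N; exact: (sub_addr iI).
- by apply: subset_trans AI _; apply: frob_mono; exact: (sub_addl (iMI _)).
Qed.

Lemma frob_rootP A I : is_ideal I -> A `<=` FP I <-> frob_root q A `<=` I.
Proof.
move=> iI; split; first exact: frob_root_min.
by move=> /(@frob_mono _ q) h; apply: subset_trans h; exact: frob_root_sub.
Qed.

(** The case of finite colength applies to each [I + D N], so the root of [z] lies in every
    [colon (id_add I (D N)) a]; as [I] is closed, it lies in [colon I a]. *)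
Lemma frob_colon I a z : is_ideal I -> FP I (z * a ^+ q) -> FP (colon I a) z.
Proof.
move=> iI Iza; have iC := ideal_colon a iI.
suff h : [set z] `<=` FP (colon I a) by exact: h.
apply/(frob_rootP _ iC) => w rw; apply: (closed_ideal loc sep compl iI) => N.
have iIN : is_ideal (id_add I (D N)) by exact: ideal_add iI (iMI _).
have : [set z] `<=` FP (colon (id_add I (D N)) a).
  move=> _ ->; apply: (frob_colon_primary loc ind frobq q_gt0 iIN (@sub_addr _ _ _ iI)).
  by apply: frob_mono Iza; exact: (sub_addl (iMI _)).
by move=> /(frob_rootP _ (ideal_colon a iIN)); apply.
Qed.

End Exponent.
End FrobeniusRoot.

(** * Stabilization *)

(* Modulo a prime [P] the ideals [J k] cut out of [(v)] finite-dimensional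
   spaces, which cannot decrease forever. *)
Lemma generic_stabilization (R : comPzRingType) (P : set R) (J : nat -> set R)
    (v : seq R) :
  is_prime_ideal P -> (forall k, is_ideal (J k)) -> (forall k, J k.+1 `<=` J k) ->
  (forall b w k, P b -> w \in v -> J k (b * w)) ->
  exists K, forall k, (K <= k)%N -> exists2 t, ~ P t &
    forall y, ideal_gen [set` v] y -> J k y -> J k.+1 (t * y).
Proof.
move=> [iP P1 prP] iJ sJ; elim: v => [_|w v IH PJ].
  exists 0%N => k _; exists 1 => // y /ideal_gen_nil-> _.
  by rewrite mulr0; exact: idl0.
have [|K hK] := IH; first by move=> b z k Pb zv; apply: PJ => //; rewrite inE zv orbT.
have Pw b k : P b -> J k (b * w) by move=> Pb; apply: PJ => //; exact: mem_head.
have igv := ideal_gen_ideal [set` v].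
(* The coefficients of [w] occurring in [J k]. If each [A k] leaves [P], an element of [J k.+1]
   serves to eliminate [w] after multiplication by an element outside [P]; otherwise, from some [k]
   on, the coefficient of [w] is in [P] and its term lies in all [J k]. *)
pose A k := [set a | exists2 z, ideal_gen [set` v] z & J k (a * w + z)].
have [out|] := pselect (forall k, exists2 a, A k a & ~ P a).
  exists K => k Kk; have [t1 nt1 h1] := hK k Kk.
  have [t2 [z vz Jz] nt2] := out k.+1.
  exists (t1 * t2); first by case/prP.
  move=> y /ideal_gen_cons[b vy] Jy.
  have -> : t1 * t2 * y = t1 * (t2 * y - b * (t2 * w + z)) + (t1 * b) * (t2 * w + z).
    by ring.
  apply: (idlD (iJ _)); last exact: (idlM _ (iJ _)).
  apply: h1; last first.
    by apply: (idlB (iJ _)); apply: (idlM _ (iJ _)) => //; exact: sJ.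
  have -> : t2 * y - b * (t2 * w + z) = t2 * (y - b * w) - b * z by ring.
  by apply: (idlB igv); exact: (idlM _ igv).
move=> /existsNP[k1 nout].
have Jle m n : (m <= n)%N -> J n `<=` J m.
  move=> /subnK <-; elim: (n - m)%N => [//|i IHi]; rewrite addSn.
  exact: subset_trans (sJ _) IHi.
exists (maxn K k1) => k; rewrite geq_max => /andP[Kk k1k].
have [t nt h] := hK k Kk; exists t => // y /ideal_gen_cons[b vy] Jy.
have Pb : P b.
  apply: contrapT => nPb; apply: nout; exists b => //.
  by exists (y - b * w) => //; rewrite addrC subrK; exact: Jle Jy.
rewrite -[y](subrK (b * w)) mulrDr; apply: (idlD (iJ _)).
  by apply: h => //; apply: (idlB (iJ _)) => //; exact: Pw.
by apply: (idlM _ (iJ _)); exact: Pw.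
Qed.

(** Frobenius roots are known through the ideals containing them, and this is enough to compare
    them. *)
Lemma ideal_ext (R : comPzRingType) (X Y : set R) : is_ideal X -> is_ideal Y ->
  (forall I, is_ideal I -> X `<=` I <-> Y `<=` I) -> X = Y.
Proof. by move=> iX iY h; apply/seteqP; split; [apply/(h Y iY)|apply/(h X iX)]. Qed.

Lemma id_scale_sub (R : comPzRingType) (a : R) (X I : set R) :
  id_scale a X `<=` I <-> X `<=` colon I a.
Proof.
split=> [h z Xz|h _ [z Xz ->]]; last exact: h.
by apply: h; exists z.
Qed.

Section Stabilization.
Variables (R : comPzRingType) (q : nat).
Hypothesis noR : noetherian R.
Hypothesis q_gt1 : (1 < q)%N.
Hypothesis rootP : forall A I : set R, is_ideal I ->
  A `<=` frobenius_power q I <-> frob_root q A `<=` I.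
Hypothesis colonP : forall (I : set R) a z, is_ideal I ->
  frobenius_power q I (z * a ^+ q) -> frobenius_power q (colon I a) z.
Variable u : R.

Let q_gt0 : (0 < q)%N := ltnW q_gt1.

Local Notation FP := (@frobenius_power R q).

(** For [q = p ^ e] this is [X |-> I_e(u X)]; it behaves like the image of [X] under a
    [q]-inverse-linear map. *)
Definition cartier (X : set R) : set R := frob_root q (id_scale u X).

Lemma cartier_ideal X : is_ideal (cartier X).
Proof. exact: frob_root_ideal. Qed.

Lemma cartierP X I : is_ideal I -> cartier X `<=` I <-> X `<=` colon (FP I) u.
Proof. by move=> iI; rewrite -rootP // id_scale_sub. Qed.

Lemma cartier_mono X Y : X `<=` Y -> cartier X `<=` cartier Y.
Proof.
move=> XY; apply/cartierP; first exact: cartier_ideal.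
by apply: subset_trans XY _; apply/cartierP; first exact: cartier_ideal.
Qed.

(** The analogue of [phi (a^q y) = a phi y] for ideals; the colon formula supplies it. *)
Lemma cartier_scale a X z : cartier X z -> cartier (id_scale (a ^+ q) X) (z * a).
Proof.
set Y := cartier (id_scale _ _); suff : cartier X `<=` colon Y a by apply.
have iY : is_ideal Y by exact: cartier_ideal.
apply/cartierP => [|y Xy]; first exact: ideal_colon.
apply: colonP => //; rewrite mulrAC.
suff : id_scale (a ^+ q) X `<=` colon (FP Y) u by apply; exists y.
exact/cartierP.
Qed.

Definition cartier_iter k : set R := iter k cartier setT.
Local Notation C := cartier_iter.

Lemma cartier_iter_ideal k : is_ideal (C k).
Proof. by case: k => [|k]; [exact: ideal_setT|exact: cartier_ideal]. Qed.

Lemma cartier_iterS k : C k.+1 `<=` C k.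
Proof. by elim: k => [//|k IH]; exact: cartier_mono. Qed.

Lemma cartier_iter_stable : exists K, forall k, (K <= k)%N -> C k = C K.
Proof.
have iC := cartier_iter_ideal.
(* The colon ideal of [C k.+1] by [C k]. It increases with [k]: if [a] moves [C k] into [C k.+1], so
   does [a ^+ q], and applying [cartier] gives the claim for [k.+1]. *)
pose A k := [set a | forall z, C k z -> C k.+1 (z * a)].
have iA k : is_ideal (A k).
  split=> [z _|a b Aa Ab z Cz|a b Ab z Cz].
  - by rewrite mulr0; exact: (idl0 (iC _)).
  - by rewrite mulrDr; apply: (idlD (iC _)); [exact: Aa|exact: Ab].
  - by rewrite mulrCA; apply: (idlM _ (iC _)); exact: Ab.
have Aq a k : A k a -> id_scale (a ^+ q) (C k) `<=` C k.+1.
  move=> Aa _ [z Cz ->]; rewrite -(prednK q_gt0) exprS mulrA.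
  by apply: (idlMr _ (iC _)); exact: Aa.
have sA k : A k `<=` A k.+1.
  by move=> a Aa z /(cartier_scale (a := a)); apply: cartier_mono; exact: Aq.
have [N AN] := noetherian_acc noR iA sA.
have [A1|nA1] := pselect (A N 1).
  have SC k : (N <= k)%N -> C k.+1 = C k.
    move=> Nk; apply/seteqP; split; first exact: cartier_iterS.
    move=> z Cz; rewrite -[z]mulr1.
    by move: A1; rewrite -(AN k) //; apply.
  exists N => k /subnK <-; elim: (k - N)%N => [//|i IH].
  by rewrite addSn SC ?leq_addl.
have [s nAs prP] := noetherian_associated_prime noR (iA N) nA1.
pose J j := C (N.+1 + j)%N.
(* As [1 < q], the power [a ^+ q] has two factors to spend: one moves [C N] into [C N.+1], the other
   keeps the result in [Y = a C N.+1]. Hence [Y] lies in [cartier Y], and so in all later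
   iterates. *)
have AJ a z : A N a -> C N.+1 z -> forall j, J j (z * a).
  move=> Aa Cz j; pose Y := id_scale a (C N.+1).
  have YC : Y `<=` cartier Y.
    move=> _ [w Cw ->]; apply: (cartier_mono _ (cartier_scale (a := a) Cw)).
    move=> _ [y Cy ->]; exists (y * a * a ^+ (q - 2)).
      by apply: (idlMr _ (iC _)); exact: Aa.
    by rewrite -mulrA -exprSr -mulrA -exprS; congr (y * a ^+ _); lia.
  have YCj : Y `<=` iter j cartier Y.
    elim: j => [//|j IH]; apply: subset_trans YC _.
    by rewrite iterS; exact: cartier_mono.
  have CJ : iter j cartier Y `<=` J j.
    rewrite /J; elim: j {YCj} => [|j IH].
      by rewrite addn0 => _ [w Cw ->]; apply: (idlMr _ (iC _)).
    by rewrite addnS /= ; apply: cartier_mono.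
  by apply: CJ; apply: YCj; exists z.
(* For [b] in the prime [colon (A N) s], the product [b * s] is in [A N], so [b] sends [s C N.+1]
   into every [J k]. *)
have [v vE] := noR (ideal_scale s (iC N.+1)).
have [||b w k Pb wv|K hK] := generic_stabilization (J := J) (v := v) prP.
- by move=> k; exact: iC.
- by move=> k; rewrite /J addnS; exact: cartier_iterS.
- have [z Cz ->] : id_scale s (C N.+1) w by rewrite vE; exact: sub_ideal_gen.
  by rewrite mulrCA; exact: AJ.
(* This [t] moves [s C (N.+1 + K)] into the next iterate, so [t * s] is in the stable colon ideal
   and [t] in the prime after all. *)
have [t nPt ht] := hK K (leqnn K); case: nPt.
have -> : A N = A (N.+1 + K)%N by rewrite (AN (N.+1 + K)%N) //; lia.
have CJ : C (N.+1 + K)%N `<=` C N.+1.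
  elim: (K) => [|i IH]; first by rewrite addn0.
  by rewrite addnS; apply: subset_trans IH; exact: cartier_iterS.
move=> z Cz; rewrite mulrCA -addnS.
apply: ht; last exact: (idlMr _ (iC _)).
by rewrite -vE; exists z => //; exact: CJ.
Qed.

End Stabilization.

(** The flatness of Frobenius as it is used on ideals: least roots exist, and Frobenius powers
    commute with colons by an element. *)
Definition frobenius_flat (R : comPzRingType) (p : nat) : Prop :=
  [/\ noetherian R, forall e, frob_exponent R (p ^ e),
      forall e (A I : set R), is_ideal I ->
        A `<=` frobenius_power (p ^ e) I <-> frob_root (p ^ e) A `<=` I &
      forall e (I : set R) a z, is_ideal I ->
        frobenius_power (p ^ e) I (z * a ^+ (p ^ e)) ->
        frobenius_power (p ^ e) (colon I a) z].

Definition power_root (R : comPzRingType) (p : nat) (g : R) (e n : nat) : set R :=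
  frob_root (p ^ e) [set g ^+ n].

(** * Calculus of the ideals [I_e(g^n)] *)

Section PowerRoot.
Variables (R : comPzRingType) (p : nat).
Hypothesis p_gt1 : (1 < p)%N.
Hypothesis flatR : frobenius_flat R p.
Variable g : R.

Local Notation FP e := (@frobenius_power R (p ^ e)).
Local Notation J := (power_root p g).

Let noR : noetherian R. Proof. by case: flatR. Qed.
Let frobp e : frob_exponent R (p ^ e). Proof. by case: flatR. Qed.
Let rootP e (A I : set R) : is_ideal I ->
  A `<=` frobenius_power (p ^ e) I <-> frob_root (p ^ e) A `<=` I.
Proof. by case: flatR => _ _ h _; exact: h. Qed.
Let colonP e (I : set R) a z : is_ideal I ->
  frobenius_power (p ^ e) I (z * a ^+ (p ^ e)) -> frobenius_power (p ^ e) (colon I a) z.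
Proof. by case: flatR => _ _ _; apply. Qed.
Let pe_gt0 e : (0 < p ^ e)%N. Proof. by rewrite expn_gt0 ltnW. Qed.

Lemma power_root_ideal e n : is_ideal (J e n).
Proof. exact: frob_root_ideal. Qed.

Lemma power_rootP e n I : is_ideal I -> J e n `<=` I <-> FP e I (g ^+ n).
Proof. by move=> iI; rewrite -rootP //; split => [h|h _ ->]; [exact: h|]. Qed.

Lemma frob_colonE e I a z : is_ideal I -> FP e (colon I a) z <-> FP e I (z * a ^+ (p ^ e)).
Proof.
move=> iI; split; last exact: colonP.
have iC := ideal_colon (a ^+ (p ^ e)) (ideal_frob (p ^ e) I).
apply: (frob_min iC) => b; rewrite /colon /= -exprMn; exact: mem_frob.
Qed.

Lemma frob_mul e e' I : FP e' (FP e I) = FP (e + e') I.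
Proof. by rewrite frob_comp ?expnD //; exact: pe_gt0. Qed.

(** By the colon formula, [1] is in the Frobenius power of [colon I a], hence in [colon I a]
    itself. *)
Lemma frob_memX e I a : is_ideal I -> FP e I (a ^+ (p ^ e)) <-> I a.
Proof.
move=> iI; split; last exact: mem_frob.
rewrite -[X in FP e I X]mul1r => /colonP h.
have {h} := frob_sub (pe_gt0 e) (ideal_colon a iI) (h iI).
by rewrite /colon /= mul1r.
Qed.

Lemma frob0 I : is_ideal I -> FP 0 I = I.
Proof.
move=> iI; apply/seteqP; split; first exact: frob_sub.
by move=> a Ia; rewrite -[a]expr1; exact: mem_frob.
Qed.

Lemma power_root_mono e m n : (m <= n)%N -> J e n `<=` J e m.
Proof.
move=> mn; apply/power_rootP; first exact: power_root_ideal.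
rewrite -(subnK mn) exprD; apply: (idlM _ (ideal_frob _ _)).
by apply/power_rootP; first exact: power_root_ideal.
Qed.

(** Thus [J e n] depends only on [n / p^e] and may be read as the test ideal at this exponent. *)
Lemma power_root_scale e k n : J (e + k) (n * p ^ k) = J e n.
Proof.
apply: ideal_ext; [exact: power_root_ideal..|move=> I iI].
rewrite !power_rootP // -frob_mul exprM.
by rewrite frob_memX //; exact: ideal_frob.
Qed.

Lemma power_rootS e n : J e.+1 n = frob_root (p ^ 1) (J e n).
Proof.
apply: ideal_ext; [exact: power_root_ideal|exact: frob_root_ideal|move=> I iI].
by rewrite -rootP // !power_rootP ?frob_mul //; exact: ideal_frob.
Qed.

(** Skoda's theorem for a principal ideal: the colon formula strips the factor [g ^+ (p ^ e)] and
    replaces [I] by [colon I g]. *)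
Lemma power_rootD e n : J e (n + p ^ e) = id_scale g (J e n).
Proof.
apply: ideal_ext; [exact: power_root_ideal|exact: ideal_scale (power_root_ideal _ _)|].
move=> I iI; rewrite id_scale_sub power_rootP // power_rootP; last exact: ideal_colon.
by rewrite frob_colonE // exprD.
Qed.

(** With [q = p ^ e], multiplying by [g ^+ n] before the last root adds [n q^k] to the exponent
    under the combined root. The iterates thus sit at the exponents
    [n (1 + q + ... + q^(k-1)) / q^k]. *)
Lemma power_root_cartier e n k :
  J (e * k) (n * \sum_(i < k) p ^ (e * i))%N = cartier_iter (p ^ e) (g ^+ n) k.
Proof.
apply: ideal_ext; [exact: power_root_ideal|exact: cartier_iter_ideal|].
elim: k => [|k IH] I iI; rewrite power_rootP //.
  rewrite muln0 big_ord0 muln0 expr0 frob0 //.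
  by split => [/(ideal_eqT iI) ->//|]; apply.
rewrite (cartierP (@rootP e) _ _ iI) -IH; last exact: ideal_colon (ideal_frob _ _).
rewrite power_rootP; last exact: ideal_colon (ideal_frob _ _).
rewrite frob_colonE; last exact: ideal_frob.
by rewrite frob_mul -mulnS -exprM -exprD big_ord_recr /= mulnDr.
Qed.

Lemma power_root_stable e n : (0 < e)%N -> exists K, forall k, (K <= k)%N ->
  J (e * k) (n * \sum_(i < k) p ^ (e * i))%N = J (e * K) (n * \sum_(i < K) p ^ (e * i))%N.
Proof.
move=> e_gt0; have q_gt1 : (1 < p ^ e)%N by rewrite -{1}(expn0 p) ltn_exp2l.
have [K hK] := cartier_iter_stable noR q_gt1 (@rootP e) (@colonP e) (g ^+ n).
by exists K => k Kk; rewrite !power_root_cartier hK.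
Qed.

End PowerRoot.

(** * Completion *)

(* An element of the completion is a compatible sequence of canonical
   representatives of classes modulo the [deg_ideal d x n]. *)
Definition adic_rep (R : comPzRingType) (d : nat) (x : nat -> R) (n : nat) (r : R) : R :=
  xget 0 [set t | deg_ideal d x n (r - t)].

Record adic (R : comPzRingType) (d : nat) (x : nat -> R) : Type := Adic {
  adic_val :> nat -> R;
  adic_canonical : forall n, adic_rep d x n (adic_val n) = adic_val n;
  adic_compatible : forall n, deg_ideal d x n (adic_val n.+1 - adic_val n) }.

Section Adic.
Variables (R : comPzRingType) (d : nat) (x : nat -> R).

Local Notation D := (deg_ideal d x).
Local Notation S := (adic d x).
Local Notation rep := (adic_rep d x).

Let iMI := mono_ideal_ideal d x.
Let iD n : is_ideal (D n) := iMI _.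

HB.instance Definition _ := gen_eqMixin S.
HB.instance Definition _ := gen_choiceMixin S.

Lemma adic_repP n r : D n (rep n r - r).
Proof.
rewrite -opprB; apply: (idlN (iD n)); apply: (@xgetPex _ 0 [set t | D n (r - t)]).
by exists r; rewrite /= subrr; exact: (idl0 (iD n)).
Qed.

Lemma eq_adic_rep n r s : D n (r - s) -> rep n r = rep n s.
Proof.
move=> Drs; congr (xget 0 _); apply/seteqP; split => t /= h.
  have -> : s - t = (r - t) - (r - s) by ring.
  exact: (idlB (iD n)).
have -> : r - t = (s - t) + (r - s) by ring.
exact: (idlD (iD n)).
Qed.

Lemma adic_ext (a b : S) : (forall n, D n (a n - b n)) -> a = b.
Proof.
case: a b => [a ca ha] [b cb hb] /= h.
have {h} e : a = b.
  by apply/funext => n; rewrite -ca -cb; apply: eq_adic_rep; exact: h.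
by case: b / e cb hb => cb hb; congr Adic; exact: Prop_irrelevance.
Qed.

Section Make.
Variables (u : nat -> R) (hu : forall n, D n (u n.+1 - u n)).

Lemma adic_make_canonical n : rep n (rep n (u n)) = rep n (u n).
Proof. by apply: eq_adic_rep; exact: adic_repP. Qed.

Lemma adic_make_compatible n : D n (rep n.+1 (u n.+1) - rep n (u n)).
Proof.
have -> : rep n.+1 (u n.+1) - rep n (u n) =
  (rep n.+1 (u n.+1) - u n.+1) + (u n.+1 - u n) - (rep n (u n) - u n) by ring.
apply: (idlB (iD n)); last exact: adic_repP.
apply: (idlD (iD n)) => //.
by apply: deg_ideal_le (leqnSn n) _ _; exact: adic_repP.
Qed.

Definition adic_make : S := Adic adic_make_canonical adic_make_compatible.

Lemma adic_makeE n : D n (adic_make n - u n).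
Proof. exact: adic_repP. Qed.

End Make.

Lemma adic_const_subproof (r : R) n : D n (r - r).
Proof. by rewrite subrr; exact: (idl0 (iD n)). Qed.

Lemma adic_add_subproof (a b : S) n : D n (a n.+1 + b n.+1 - (a n + b n)).
Proof.
rewrite opprD addrACA.
by apply: (idlD (iD n)); exact: adic_compatible.
Qed.

Lemma adic_opp_subproof (a : S) n : D n (- a n.+1 - - a n).
Proof.
by rewrite -opprD; apply: (idlN (iD n)); exact: adic_compatible.
Qed.

Lemma adic_mul_subproof (a b : S) n : D n (a n.+1 * b n.+1 - a n * b n).
Proof.
have -> : a n.+1 * b n.+1 - a n * b n =
  b n.+1 * (a n.+1 - a n) + a n * (b n.+1 - b n) by ring.
apply: (idlD (iD n)); apply: (idlM _ (iD n)); exact: adic_compatible.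
Qed.

Definition adic_const (r : R) : S := adic_make (adic_const_subproof r).
Definition adic_add (a b : S) : S := adic_make (adic_add_subproof a b).
Definition adic_opp (a : S) : S := adic_make (adic_opp_subproof a).
Definition adic_mul (a b : S) : S := adic_make (adic_mul_subproof a b).

Lemma adic_constE r n : D n (adic_const r n - r).
Proof. exact: adic_makeE. Qed.

Lemma adic_addE a b n : D n (adic_add a b n - (a n + b n)).
Proof. exact: (adic_makeE (adic_add_subproof a b)). Qed.

Lemma adic_oppE a n : D n (adic_opp a n - - a n).
Proof. exact: (adic_makeE (adic_opp_subproof a)). Qed.

Lemma adic_mulE a b n : D n (adic_mul a b n - a n * b n).
Proof. exact: (adic_makeE (adic_mul_subproof a b)). Qed.

Lemma adic_addA : associative adic_add.
Proof.
move=> a b c; apply: adic_ext => n.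
have -> : adic_add a (adic_add b c) n - adic_add (adic_add a b) c n =
  (adic_add a (adic_add b c) n - (a n + adic_add b c n))
  + (adic_add b c n - (b n + c n))
  - ((adic_add (adic_add a b) c n - (adic_add a b n + c n))
  + (adic_add a b n - (a n + b n))) by ring.
by apply: (idlB (iD n)); apply: (idlD (iD n)); exact: adic_addE.
Qed.

Lemma adic_addC : commutative adic_add.
Proof.
move=> a b; apply: adic_ext => n.
have -> : adic_add a b n - adic_add b a n =
  (adic_add a b n - (a n + b n)) - (adic_add b a n - (b n + a n)) by ring.
by apply: (idlB (iD n)); exact: adic_addE.
Qed.

Lemma adic_add0 : left_id (adic_const 0) adic_add.
Proof.
move=> a; apply: adic_ext => n.
have -> : adic_add (adic_const 0) a n - a n =
  (adic_add (adic_const 0) a n - (adic_const 0 n + a n)) + (adic_const 0 n - 0) by ring.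
by apply: (idlD (iD n)); [exact: adic_addE|exact: adic_constE].
Qed.

Lemma adic_addN : left_inverse (adic_const 0) adic_opp adic_add.
Proof.
move=> a; apply: adic_ext => n.
have -> : adic_add (adic_opp a) a n - adic_const 0 n =
  (adic_add (adic_opp a) a n - (adic_opp a n + a n)) + (adic_opp a n - - a n)
  - (adic_const 0 n - 0) by ring.
apply: (idlB (iD n)); last exact: adic_constE.
by apply: (idlD (iD n)); [exact: adic_addE|exact: adic_oppE].
Qed.

Lemma adic_mulA : associative adic_mul.
Proof.
move=> a b c; apply: adic_ext => n.
have -> : adic_mul a (adic_mul b c) n - adic_mul (adic_mul a b) c n =
  (adic_mul a (adic_mul b c) n - a n * adic_mul b c n)
  + a n * (adic_mul b c n - b n * c n)
  - ((adic_mul (adic_mul a b) c n - adic_mul a b n * c n)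
  + c n * (adic_mul a b n - a n * b n)) by ring.
by apply: (idlB (iD n)); apply: (idlD (iD n)); try apply: (idlM _ (iD n)); exact: adic_mulE.
Qed.

Lemma adic_mulC : commutative adic_mul.
Proof.
move=> a b; apply: adic_ext => n.
have -> : adic_mul a b n - adic_mul b a n =
  (adic_mul a b n - a n * b n) - (adic_mul b a n - b n * a n) by ring.
by apply: (idlB (iD n)); exact: adic_mulE.
Qed.

Lemma adic_mul1 : left_id (adic_const 1) adic_mul.
Proof.
move=> a; apply: adic_ext => n.
have -> : adic_mul (adic_const 1) a n - a n =
  (adic_mul (adic_const 1) a n - adic_const 1 n * a n) + a n * (adic_const 1 n - 1).
  by ring.
apply: (idlD (iD n)); first exact: adic_mulE.
by apply: (idlM _ (iD n)); exact: adic_constE.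
Qed.

Lemma adic_mulDl : left_distributive adic_mul adic_add.
Proof.
move=> a b c; apply: adic_ext => n.
have -> : adic_mul (adic_add a b) c n - adic_add (adic_mul a c) (adic_mul b c) n =
  ((adic_mul (adic_add a b) c n - adic_add a b n * c n)
  + c n * (adic_add a b n - (a n + b n)))
  - ((adic_add (adic_mul a c) (adic_mul b c) n - (adic_mul a c n + adic_mul b c n))
  + ((adic_mul a c n - a n * c n) + (adic_mul b c n - b n * c n))) by ring.
apply: (idlB (iD n)); apply: (idlD (iD n)).
- exact: adic_mulE.
- by apply: (idlM _ (iD n)); exact: adic_addE.
- exact: adic_addE.
- by apply: (idlD (iD n)); exact: adic_mulE.
Qed.

HB.instance Definition _ :=
  GRing.isZmodule.Build S adic_addA adic_addC adic_add0 adic_addN.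
HB.instance Definition _ :=
  GRing.Zmodule_isComPzRing.Build S adic_mulA adic_mulC adic_mul1 adic_mulDl.

Lemma adic_const_additive : zmod_morphism adic_const.
Proof.
move=> a b; apply: adic_ext => n.
have -> : adic_const (a - b) n - (adic_const a - adic_const b) n =
  (adic_const (a - b) n - (a - b)) - ((adic_const a - adic_const b) n -
     (adic_const a n + (- adic_const b) n)) - ((- adic_const b) n - - adic_const b n)
  - (adic_const a n - a) + (adic_const b n - b) by ring.
apply: (idlD (iD n)); last exact: adic_constE.
apply: (idlB (iD n)); last exact: adic_constE.
apply: (idlB (iD n)); last exact: adic_oppE.
by apply: (idlB (iD n)); [exact: adic_constE|exact: adic_addE].
Qed.

Lemma adic_const_multiplicative : monoid_morphism adic_const.
Proof.
split => // a b; apply: adic_ext => n.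
have -> : adic_const (a * b) n - (adic_const a * adic_const b) n =
  (adic_const (a * b) n - a * b) -
  ((adic_const a * adic_const b) n - adic_const a n * adic_const b n) -
  (adic_const b n * (adic_const a n - a) + a * (adic_const b n - b)) by ring.
apply: (idlB (iD n)).
  by apply: (idlB (iD n)); [exact: adic_constE|exact: adic_mulE].
by apply: (idlD (iD n)); apply: (idlM _ (iD n)); exact: adic_constE.
Qed.

HB.instance Definition _ :=
  GRing.isZmodMorphism.Build R S adic_const adic_const_additive.
HB.instance Definition _ :=
  GRing.isMonoidMorphism.Build R S adic_const adic_const_multiplicative.

End Adic.

(** * Comparison of a local ring with its completion *)

Section Completion.
Variables (R : comPzRingType) (d : nat) (x : nat -> R).

Local Notation D := (deg_ideal d x).
Local Notation S := (adic d x).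
Local Notation ext := (@box_ext d _).

Let iMI := mono_ideal_ideal d x.
Let iD n : is_ideal (D n) := iMI _.

Definition adic_map : {rmorphism R -> S} := @adic_const R d x.
Local Notation f := adic_map.
Local Notation y := (f \o x).

Lemma adic_valD (a b : S) n : D n ((a + b) n - (a n + b n)).
Proof. exact: adic_addE. Qed.

Lemma adic_valM (a b : S) n : D n ((a * b) n - a n * b n).
Proof. exact: adic_mulE. Qed.

Lemma adic_val0 n : D n ((0 : S) n).
Proof. by rewrite -[X in D n X]subr0; exact: adic_constE. Qed.

Lemma adic_valB (a b : S) n : D n ((a - b) n - (a n - b n)).
Proof.
have -> : (a - b) n - (a n - b n) =
  ((a - b) n - (a n + (- b) n)) + ((- b) n - - b n) by ring.
by apply: (idlD (iD n)); [exact: adic_valD|exact: adic_oppE].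
Qed.

Lemma adic_val_sum (T : Type) (s : seq T) (P : pred T) (F : T -> S) n :
  D n ((\sum_(i <- s | P i) F i) n - \sum_(i <- s | P i) F i n).
Proof.
elim: s => [|t s IH].
  by rewrite !big_nil subr0; exact: adic_val0.
rewrite !big_cons; case: (P t) => //.
set A := \sum_(i <- s | P i) F i in IH *.
have -> : (F t + A) n - (F t n + \sum_(i <- s | P i) F i n) =
  ((F t + A) n - (F t n + A n)) + (A n - \sum_(i <- s | P i) F i n) by ring.
by apply: (idlD (iD n)) => //; exact: adic_valD.
Qed.

Lemma adic_map_mon al : f (mon d x al) = mon d y al.
Proof. by rewrite /mon rmorph_prod; apply: eq_bigr => i _; rewrite rmorphXn. Qed.

Lemma adic_map_val r n : D n (f r n - r).
Proof. exact: adic_constE. Qed.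

Lemma adic_compat_le (s : S) m n : (m <= n)%N -> D m (s n - s m).
Proof.
move=> /subnK <-; elim: (n - m)%N => [|k IH].
  by rewrite add0n subrr; exact: (idl0 (iD m)).
have -> : s (k.+1 + m)%N - s m = (s (k + m).+1 - s (k + m)%N) + (s (k + m)%N - s m).
  by rewrite addSn; ring.
apply: (idlD (iD m)) => //; apply: (deg_ideal_le (leq_addl k m)).
exact: adic_compatible.
Qed.

Definition adic_level n : set S := [set s | D n (s n)].

Lemma adic_level_ideal n : is_ideal (adic_level n).
Proof.
split; rewrite /adic_level /=; first exact: adic_val0.
  by move=> a b Da Db; apply: (idlBl (iD n) _ (@adic_valD a b n)); exact: (idlD (iD n)).
by move=> a b Db; apply: (idlBl (iD n) _ (@adic_valM a b n)); exact: (idlM _ (iD n)).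
Qed.

(** The monomials on the right are finitely many and do not depend on [j], while the coefficients
    become small with [j]: a series of such elements can be summed coefficient by coefficient. *)
Lemma deg_ideal_coeffs n j z : D (n + j) z ->
  exists c : {ffun 'I_d -> 'I_n.+1} -> R, (forall b, D j (c b)) /\
    z = \sum_(b | mdeg d (ext b) == n) c b * mon d x (ext b).
Proof.
pose X := [set z | exists c : {ffun 'I_d -> 'I_n.+1} -> R, (forall b, D j (c b)) /\
    z = \sum_(b | mdeg d (ext b) == n) c b * mon d x (ext b)].
have iX : is_ideal X.
  split.
  - exists (fun=> 0); split => [b|]; first exact: (idl0 (iD j)).
    by rewrite big1 // => b _; rewrite mul0r.
  - move=> _ _ [c [Dc ->]] [c' [Dc' ->]]; exists (fun b => c b + c' b); split.
      by move=> b; exact: (idlD (iD j) (Dc b) (Dc' b)).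
    by rewrite -big_split; apply: eq_bigr => b _; rewrite mulrDl.
  - move=> a _ [c [Dc ->]]; exists (fun b => a * c b); split.
      by move=> b; exact: (idlM _ (iD j) (Dc b)).
    by rewrite big_distrr; apply: eq_bigr => b _; rewrite /= mulrA.
move: z; apply: (mono_ideal_min iX) => al /= nj.
have [be [ga [degbe alE]]] := mdeg_sub (leq_trans (leq_addr j n) nj).
have [|b bE] := @box_extP d n.+1 be.
  by move=> i lt_id; rewrite ltnS -degbe; exact: mdeg_ge.
have degb : mdeg d (ext b) = n.
  by apply: etrans degbe; apply: eq_bigr => i _; rewrite bE.
exists (fun b' => if b' == b then mon d x ga else 0); split.
  move=> b'; case: eqP => _; last exact: (idl0 (iD j)).
  apply: mono_idealP; move: nj; rewrite /=.
  have -> : mdeg d al = (mdeg d be + mdeg d ga)%N.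
    by rewrite -mdegD; apply: eq_bigr => i _; exact: alE.
  by rewrite degbe leq_add2l.
rewrite (bigD1 b) /=; last by rewrite degb.
rewrite eqxx big1 ?addr0 => [|b' /andP[_ /negbTE->]]; last by rewrite mul0r.
by rewrite mulrC -(eq_mon x bE) -monD; apply: eq_mon.
Qed.

(** A compatible sequence vanishing at level [n] is a priori an infinite sum; collecting its terms
    along the monomials of degree [n] makes it a finite combination over the completion. *)
Lemma deg_ideal_adic n : deg_ideal d y n = adic_level n.
Proof.
apply/seteqP; split.
  apply: mono_ideal_min => [|al nal]; first exact: adic_level_ideal.
  rewrite -adic_map_mon; apply: (idlBl (iD n) _ (@adic_map_val _ n)).
  exact: mono_idealP.
move=> s Ds.
have [c0 [_ sn]] : exists c : {ffun 'I_d -> 'I_n.+1} -> R, (forall b, D 0 (c b)) /\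
    s n = \sum_(b | mdeg d (ext b) == n) c b * mon d x (ext b).
  by apply: deg_ideal_coeffs; rewrite addn0.
have /choice[c cP] : forall j, exists c : {ffun 'I_d -> 'I_n.+1} -> R,
    (forall b, D j (c b)) /\ s (n + j).+1 - s (n + j)%N =
    \sum_(b | mdeg d (ext b) == n) c b * mon d x (ext b).
  by move=> j; apply: deg_ideal_coeffs; exact: adic_compatible.
pose v b j := c0 b + \sum_(l < j) c l b.
have vD b j : D j (v b j.+1 - v b j).
  by rewrite /v big_ord_recr /= addrA [_ + c j b]addrC addrK; exact: (cP j).1.
have sE j : s (n + j)%N = \sum_(b | mdeg d (ext b) == n) v b j * mon d x (ext b).
  elim: j => [|j IH].
    by rewrite addn0 sn; apply: eq_bigr => b _; rewrite /v big_ord0 addr0.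
  rewrite addnS; have -> : s (n + j).+1 = (s (n + j).+1 - s (n + j)%N) + s (n + j)%N.
    by ring.
  rewrite (cP j).2 IH -big_split.
  by apply: eq_bigr => b _; rewrite /v big_ord_recr /=; ring.
pose V b : S := adic_make (vD b).
have -> : s = \sum_(b | mdeg d (ext b) == n) V b * mon d y (ext b).
  apply: adic_ext => k.
  set T := \sum_(b | _) _.
  have -> : s k - T k = - (s (n + k)%N - s k) - (T k - s (n + k)%N) by ring.
  apply: (idlB (iD k)).
    by apply: (idlN (iD k)); apply: adic_compat_le; exact: leq_addl.
  pose Tk := \sum_(b | mdeg d (ext b) == n) (V b * mon d y (ext b)) k.
  have -> : T k - s (n + k)%N = (T k - Tk) + (Tk - s (n + k)%N) by ring.
  apply: (idlD (iD k)); first exact: adic_val_sum.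
  rewrite sE -sumrB; apply: (idl_sum _ (iD k)) => b _.
  have -> : (V b * mon d y (ext b)) k - v b k * mon d x (ext b) =
    ((V b * mon d y (ext b)) k - V b k * mon d y (ext b) k) +
    (mon d y (ext b) k * (V b k - v b k) + v b k * (mon d y (ext b) k - mon d x (ext b))).
    by ring.
  apply: (idlD (iD k)); first exact: adic_valM.
  apply: (idlD (iD k)); apply: (idlM _ (iD k)); first exact: adic_makeE.
  by rewrite -adic_map_mon; exact: adic_map_val.
apply: (idl_sum _ (mono_ideal_ideal _ _ _)) => b /eqP degb.
apply: (idlM _ (mono_ideal_ideal _ _ _)); apply: mono_idealP.
by rewrite /= degb.
Qed.

Lemma adic_separated : separated d y.
Proof.
move=> s hs; apply: adic_ext => n.
have := hs n; rewrite deg_ideal_adic /adic_level /= => Ds.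
by apply: (idlB (iD n)) => //; exact: adic_val0.
Qed.

Lemma adic_complete : complete d y.
Proof.
move=> u hu.
have hu' n : D n (u n.+1 n - u n n).
  have := hu n; rewrite deg_ideal_adic /adic_level /= => Ds.
  have -> : u n.+1 n - u n n = (u n.+1 - u n) n - ((u n.+1 - u n) n - (u n.+1 n - u n n)).
    by ring.
  by apply: (idlB (iD n)) => //; exact: adic_valB.
have wD n : D n (u n.+1 n.+1 - u n n).
  have -> : u n.+1 n.+1 - u n n = (u n.+1 n.+1 - u n.+1 n) + (u n.+1 n - u n n) by ring.
  by apply: (idlD (iD n)) => //; exact: adic_compatible.
exists (adic_make wD) => n; rewrite deg_ideal_adic /adic_level /=.
apply: (idlBl (iD n) _ (@adic_valB (adic_make wD) (u n) n)).
exact: (adic_makeE wD).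
Qed.

Lemma adic_map_deg n r : deg_ideal d y n (f r) -> D n r.
Proof.
rewrite deg_ideal_adic /adic_level /= => Dr.
have -> : r = f r n - (f r n - r) by ring.
by apply: (idlB (iD n)) => //; exact: adic_map_val.
Qed.

Lemma adic_map_dense n (s : S) : exists r, deg_ideal d y n (s - f r).
Proof.
exists (s n); rewrite deg_ideal_adic /adic_level /=.
apply: (idlBl (iD n) _ (@adic_valB s (f (s n)) n)); rewrite -opprB.
by apply: (idlN (iD n)); exact: adic_map_val.
Qed.

(** Elements of the extended ideal are limits of elements of [I]. With Krull's intersection theorem
    this takes the place of faithful flatness. *)
Lemma adic_ext_ideal (I : set R) n s : is_ideal I -> ideal_gen (f @` I) s ->
  exists2 r, I r & deg_ideal d y n (s - f r).
Proof.
move=> iI; have iDS := mono_ideal_ideal d y [set al | (n <= mdeg d al)%N].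
have iX : is_ideal [set s | exists2 r, I r & deg_ideal d y n (s - f r)].
  split.
  - by exists 0; [exact: idl0|rewrite rmorph0 subr0; exact: (idl0 iDS)].
  - move=> a b [r Ir ha] [t It hb]; exists (r + t); first exact: idlD.
    by rewrite rmorphD opprD addrACA; exact: (idlD iDS).
  - move=> a b [r Ir hb]; have [t ht] := adic_map_dense n a.
    exists (t * r); first exact: idlM.
    have -> : a * b - f (t * r) = a * (b - f r) + f r * (a - f t) by rewrite rmorphM; ring.
    by apply: (idlD iDS); apply: (idlM _ iDS).
apply: (ideal_gen_min iX) => _ [r Ir <-]; exists r => //.
by rewrite subrr; exact: (idl0 iDS).
Qed.

Lemma adic_frob_exponent q : frob_exponent R q -> frob_exponent S q.
Proof.
move=> frobq a b; apply/eqP; rewrite -subr_eq0; apply/eqP.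
apply: adic_separated => n; have iDS := mono_ideal_ideal d y [set al | (n <= mdeg d al)%N].
have [r hr] := adic_map_dense n a; have [t ht] := adic_map_dense n b.
have pow u v m : deg_ideal d y n (u - v) -> deg_ideal d y n (u ^+ m - v ^+ m).
  by move=> h; rewrite subrXX; exact: (idlMr _ iDS).
have -> : (a + b) ^+ q - (a ^+ q + b ^+ q) =
  ((a + b) ^+ q - (f r + f t) ^+ q) - ((a ^+ q - f r ^+ q) + (b ^+ q - f t ^+ q))
  + ((f r + f t) ^+ q - f r ^+ q - f t ^+ q) by ring.
have -> : (f r + f t) ^+ q - f r ^+ q - f t ^+ q = 0.
  by rewrite -rmorphD -!rmorphXn frobq rmorphD; ring.
rewrite addr0; apply: (idlB iDS).
  by apply: pow; rewrite opprD addrACA; exact: (idlD iDS).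
by apply: (idlD iDS); exact: pow.
Qed.

Lemma adic_independent : independent d x -> independent d y.
Proof.
move=> ind al hal; apply: (ind al).
have iM := iMI [set be | ((mrank d al).+1 <= mrank d be)%N].
have igM := ideal_gen_ideal (f @` rank_ideal d x (mrank d al).+1).
have : ideal_gen (f @` rank_ideal d x (mrank d al).+1) (mon d y al).
  apply: (mono_ideal_min igM _ hal) => be rkbe; rewrite -adic_map_mon.
  by apply: sub_ideal_gen; exists (mon d x be) => //; exact: mono_idealP.
move=> /(adic_ext_ideal (mdeg d al).+1 iM)[r Mr].
rewrite -adic_map_mon -rmorphB => /adic_map_deg h.
rewrite -[mon d x al](subrK r); apply: (idlD iM) => //.
exact: deg_ideal_sub_rank.
Qed.

Lemma adic_local : local_gen d x -> local_gen d y.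
Proof.
move=> loc; have iDS := mono_ideal_ideal d y [set al | (1 <= mdeg d al)%N].
split; first by move=> h; apply: loc.1; apply: adic_map_deg; rewrite rmorph1.
move=> s ns; have [r hr] := adic_map_dense 1 s.
have nr : ~ D 1 r.
  move=> Dr; apply: ns; rewrite -[s](subrK (f r)).
  suff Dfr : deg_ideal d y 1 (f r) by exact: (idlD iDS hr Dfr).
  rewrite deg_ideal_adic /adic_level /=.
  exact: (idlBl (iD 1) Dr (@adic_map_val _ _)).
have [t rt] := loc.2 r nr.
pose e := 1 - s * f t.
have De : deg_ideal d y 1 e.
  have -> : e = - f t * (s - f r) + (1 - f r * f t) by rewrite /e; ring.
  by rewrite -rmorphM rt rmorph1 subrr addr0; exact: (idlM _ iDS).
(* The geometric series inverts [1 - e = s * f t]. *)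
have [n|w wP] := adic_complete (u := fun n => \sum_(i < n) e ^+ i).
  by rewrite big_ord_recr /= [_ + e ^+ n]addrC addrK; exact: deg_idealX.
exists (f t * w).
have -> : s * (f t * w) = (1 - e) * w by rewrite /e; ring.
apply/eqP; rewrite -subr_eq0; apply/eqP; apply: adic_separated => n.
have iDn := mono_ideal_ideal d y [set al | (n <= mdeg d al)%N].
have -> : (1 - e) * w - 1 = (1 - e) * (w - \sum_(i < n) e ^+ i)
   - (1 - (1 - e) * \sum_(i < n) e ^+ i) by ring.
have -> : 1 - (1 - e) * \sum_(i < n) e ^+ i = e ^+ n.
  set T := \sum_(i < n) _; have -> : 1 - (1 - e) * T = 1 + (e - 1) * T by ring.
  by rewrite -subrX1 addrC subrK.
apply: (idlB iDn); first exact: (idlM _ iDn (wP n)).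
exact: deg_idealX.
Qed.

End Completion.

Lemma complete_frobenius_flat (R : comPzRingType) (d : nat) (x : nat -> R) (p : nat) :
  local_gen d x -> independent d x -> separated d x -> complete d x ->
  (0 < p)%N -> (forall e, frob_exponent R (p ^ e)) -> frobenius_flat R p.
Proof.
move=> loc ind sep compl p_gt0 frobp.
have pe_gt0 e : (0 < p ^ e)%N by rewrite expn_gt0 p_gt0.
split => //; first exact: complete_noetherian loc sep compl.
  by move=> e A I; apply: (frob_rootP loc sep compl ind (frobp e) (pe_gt0 e)).
by move=> e I a z; apply: (frob_colon loc sep compl ind (frobp e) (pe_gt0 e)).
Qed.

Lemma frob_exponent_pchar (R : comNzRingType) (p e : nat) : prime p ->
  p \in [pchar R] -> frob_exponent R (p ^ e).
Proof.
move=> p_prime charR a b; apply: exprDn_pchar.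
by rewrite pnatX pnatE // charR.
Qed.

Lemma frob_adicE (R : comPzRingType) (d : nat) (x : nat -> R) (q : nat) (I : set R) a :
  noetherian R -> local_gen d x -> frob_exponent R q -> (0 < q)%N -> is_ideal I ->
  frobenius_power q I a <->
  frobenius_power q (ideal_gen (adic_map d x @` I)) (adic_map d x a).
Proof.
move=> noR loc frobq q_gt0 iI; set f := adic_map d x; split.
  have iX : is_ideal [set b | frobenius_power q (ideal_gen (f @` I)) (f b)].
    have iF := ideal_frob q (ideal_gen (f @` I)).
    split; rewrite /= ?rmorph0; first exact: (idl0 iF).
      by move=> b c hb hc; rewrite rmorphD; exact: (idlD iF).
    by move=> b c hc; rewrite rmorphM; exact: (idlM _ iF).
  move: a; apply: (frob_min iX) => b Ib; rewrite /= rmorphXn.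
  by apply: mem_frob; apply: sub_ideal_gen; exists b.
move=> h.
have {}h : ideal_gen (f @` frobenius_power q I) (f a).
  apply: (frob_gen_min (adic_frob_exponent frobq) q_gt0 (ideal_gen_ideal _) _ h).
  move=> _ [b Ib <-]; rewrite -rmorphXn.
  by apply: sub_ideal_gen; exists (b ^+ q) => //; exact: mem_frob.
apply: (krull_intersection noR loc (ideal_frob q I)) => n.
have [r Ir] := adic_ext_ideal n (ideal_frob q I) h.
by rewrite -rmorphB => /adic_map_deg hr; exists r.
Qed.

(** [Phi X] is the intersection of the ideals of [R] whose extension contains [X]. It may identify
    different [X], which is harmless for transporting equalities. *)
Lemma regular_power_root (R : comNzRingType) (p : nat) (g : R) : prime p ->
  p \in [pchar R] -> regular_local_ring R ->
  exists (S : comPzRingType) (h : S) (Phi : set S -> set R), frobenius_flat S p /\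
    forall e n, Ie p e (ideal_pow (ideal_gen [set g]) n) = Phi (power_root p h e n).
Proof.
move=> p_prime charR regR.
have [d [x [loc ind]]] := regular_local_system regR.
have [noR _ _] := regR.
have frobp e := frob_exponent_pchar e p_prime charR.
have p_gt0 := prime_gt0 p_prime.
have pe_gt0 e : (0 < p ^ e)%N by rewrite expn_gt0 p_gt0.
pose f := adic_map d x.
have flatS : frobenius_flat (adic d x) p.
  apply: (complete_frobenius_flat (adic_local loc) (adic_independent ind)) => //.
  - exact: adic_separated.
  - exact: adic_complete.
  - by move=> e; exact: adic_frob_exponent.
exists (adic d x : comPzRingType), (f g),
  (fun X => \bigcap_(I in [set I | is_ideal I /\ X `<=` ideal_gen (f @` I)]) I).
split => // e n; rewrite /Ie; congr (\bigcap_(I in _) I).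
apply/seteqP; split => I /= [iI h]; split => //.
  apply/(power_rootP flatS _ _ _ (ideal_gen_ideal _)); rewrite -rmorphXn.
  apply/(frob_adicE _ noR loc (frobp e) (pe_gt0 e) iI).
  by apply: h; rewrite ideal_pow_gen1; exact: sub_ideal_gen.
rewrite ideal_pow_gen1; apply/ideal_gen1_sub; first exact: ideal_frob.
apply/(frob_adicE _ noR loc (frobp e) (pe_gt0 e) iI); rewrite rmorphXn.
exact/(power_rootP flatS _ _ _ (ideal_gen_ideal _)).
Qed.

(** * Jumping numbers *)

Definition ceil_exponent (K : realType) (p : nat) (c : K) (e : nat) : nat :=
  `|Num.ceil (c * (p ^ e)%:R)|%N.

(* Values lie in (0, 1], so that integers are sent to 1. *)
Definition upper_frac (K : realType) (c : K) : K := c - (Num.ceil c - 1)%:~R.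

Section CeilExponent.
Variables (K : realType) (p : nat).
Hypothesis p_gt1 : (1 < p)%N.
Implicit Types c : K.

Let p_gt0 : (0 < p)%N := ltnW p_gt1.
Let pe_gt0 e : (0 : K) < (p ^ e)%:R. Proof. by rewrite ltr0n expn_gt0 p_gt0. Qed.

Lemma ceil_exponentE c e : 0 <= c ->
  (ceil_exponent p c e)%:Z = Num.ceil (c * (p ^ e)%:R).
Proof.
move=> c0; rewrite /ceil_exponent gez0_abs // ceil_ge0.
by apply: lt_le_trans (mulr_ge0 c0 (ltW (pe_gt0 e))); rewrite ltrN10.
Qed.

Lemma ceil_exponent_mono c c' e : 0 <= c -> c <= c' ->
  (ceil_exponent p c e <= ceil_exponent p c' e)%N.
Proof.
move=> c0 cc'; rewrite -lez_nat !ceil_exponentE ?(le_trans c0) //.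
by apply: le_ceil; rewrite ler_wpM2r // ltW.
Qed.

Lemma ceil_exponentS c e : 0 <= c ->
  (ceil_exponent p c e.+1 <= ceil_exponent p c e * p ^ 1)%N.
Proof.
move=> c0; rewrite -lez_nat PoszM !ceil_exponentE // ceil_le_int.
rewrite expnSr natrM mulrA intrM expn1 ler_wpM2r ?ler0n //.
exact: ceil_ge.
Qed.

Lemma ceil_exponentMp c e : ceil_exponent p (c * p%:R) e = ceil_exponent p c e.+1.
Proof. by rewrite /ceil_exponent expnS natrM mulrA. Qed.

Lemma ceil_exponentD1 c e : 0 <= c ->
  ceil_exponent p (c + 1) e = (ceil_exponent p c e + p ^ e)%N.
Proof.
move=> c0; apply/eqP; rewrite -eqz_nat PoszD !ceil_exponentE ?addr_ge0 //.
rewrite mulrDl mul1r ceilDrz ?natr_int //; apply/eqP; congr (_ + _).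
by rewrite -[(p ^ e)%:R]/((p ^ e)%:Z%:~R) intrKceil.
Qed.

Lemma ceil_exponent_frac n e k :
  ceil_exponent p (n%:R / (p ^ e)%:R : K) (e + k) = (n * p ^ k)%N.
Proof.
rewrite /ceil_exponent expnD natrM mulrA divfK ?gt_eqF ?pe_gt0 // -natrM.
by rewrite -[(n * _)%:R]/((n * p ^ k)%:Z%:~R) intrKceil.
Qed.

Lemma upper_frac_itv c : 0 < upper_frac c <= 1.
Proof.
have /andP[lo hi] := ceil_itv c; rewrite /upper_frac subr_gt0 lo /=.
by rewrite intrB lerBlDr addrC subrK.
Qed.

Lemma upper_fracDz c (m : int) : upper_frac (c + m%:~R) = upper_frac c.
Proof.
rewrite /upper_frac ceilDrz ?intr_int // intrKceil !intrB intrD.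
by ring.
Qed.

Lemma upper_frac_comp j k c :
  upper_frac ((p ^ k)%:R * upper_frac ((p ^ j)%:R * c)) = upper_frac ((p ^ (k + j))%:R * c).
Proof.
rewrite {2}/upper_frac mulrBr mulrA -natrM -expnD.
set m := Num.ceil _ - 1.
have -> : - ((p ^ k)%:R * m%:~R) = (- ((p ^ k)%:Z * m))%:~R :> K.
  by rewrite mulrNz intrM.
exact: upper_fracDz.
Qed.

End CeilExponent.

(** * Jumps of a family of ideals with the formal properties of [I_e(g^n)] *)

Section Jumps.
Variables (K : realType) (p : nat) (S : comPzRingType).
Hypothesis p_gt1 : (1 < p)%N.
Hypothesis noS : noetherian S.
Variables (J : nat -> nat -> set S) (root shift : set S -> set S).
Hypothesis iJ : forall e n, is_ideal (J e n).
Hypothesis J_mono : forall e m n, (m <= n)%N -> J e n `<=` J e m.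
Hypothesis J_scale : forall e k n, J (e + k) (n * p ^ k) = J e n.
Hypothesis J_S : forall e n, J e.+1 n = root (J e n).
Hypothesis J_D : forall e n, J e (n + p ^ e) = shift (J e n).
Hypothesis J_stable : forall e n, (0 < e)%N -> exists k0, forall k, (k0 <= k)%N ->
  J (e * k) (n * \sum_(i < k) p ^ (e * i))%N = J (e * k0) (n * \sum_(i < k0) p ^ (e * i))%N.
Implicit Types c : K.

Let p_gt0 : (0 < p)%N := ltnW p_gt1.
Let pe_gt0 e : (0 : K) < (p ^ e)%:R. Proof. by rewrite ltr0n expn_gt0 p_gt0. Qed.

Local Notation N := (@ceil_exponent K p).

Definition J_lim c : set S := \bigcup_e J e (N c e).

Lemma J_limP c : 0 <= c -> exists E, forall e, (E <= e)%N -> J e (N c e) = J_lim c.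
Proof.
move=> c0.
have asc e : J e (N c e) `<=` J e.+1 (N c e.+1).
  rewrite -(J_scale e 1) addn1; apply: J_mono.
  exact: ceil_exponentS.
have [E hE] := noetherian_acc noS (fun e => iJ e (N c e)) asc.
exists E => e Ee; rewrite (hE e Ee); apply/seteqP; split => [z Jz|z [k _ Jz]].
  by exists E.
rewrite -(hE (maxn E k)) ?leq_maxl //.
have le m n : (m <= n)%N -> J m (N c m) `<=` J n (N c n).
  move=> /subnK <-; elim: (n - m)%N => [//|i IH].
  by apply: subset_trans IH _; rewrite addSn; exact: asc.
exact: le (leq_maxr _ _) _ Jz.
Qed.

Lemma J_lim2 c c' : 0 <= c -> 0 <= c' -> exists e0, forall e, (e0 <= e)%N ->
  J e (N c e) = J_lim c /\ J e (N c' e) = J_lim c'.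
Proof.
move=> /J_limP[E hE] /J_limP[E' hE']; exists (maxn E E') => e.
by rewrite geq_max => /andP[Ee E'e]; rewrite hE // hE'.
Qed.

Lemma J_lim_ideal c : 0 <= c -> is_ideal (J_lim c).
Proof. by move=> /J_limP[E hE]; rewrite -(hE E). Qed.

Lemma J_lim_anti c c' : 0 <= c -> c <= c' -> J_lim c' `<=` J_lim c.
Proof.
move=> c0 cc'; have [e /(_ e (leqnn e))[<- <-]] := J_lim2 c0 (le_trans c0 cc').
by apply: J_mono; exact: ceil_exponent_mono.
Qed.

Lemma J_lim_root c : 0 <= c -> J_lim c = root (J_lim (c * p%:R)).
Proof.
move=> c0; have [E hE] := J_limP c0.
have [|E' hE'] := @J_limP (c * p%:R); first by rewrite mulr_ge0.
pose e := maxn E E'; rewrite -(hE e.+1); last exact: leqW (leq_maxl _ _).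
by rewrite -(hE' e) ?leq_maxr // J_S ceil_exponentMp.
Qed.

Lemma J_lim_shift c : 0 <= c -> J_lim (c + 1) = shift (J_lim c).
Proof.
move=> c0; have [|e /(_ e (leqnn e))[<- <-]] := @J_lim2 c (c + 1) c0.
  by rewrite addr_ge0.
by rewrite ceil_exponentD1 // J_D.
Qed.

Lemma J_lim_frac n e : J_lim (n%:R / (p ^ e)%:R : K) = J e n.
Proof.
have [|E hE] := @J_limP (n%:R / (p ^ e)%:R); first by rewrite divr_ge0.
by rewrite -(hE (e + E)%N) ?leq_addl // ceil_exponent_frac // J_scale.
Qed.

(* The stable chain computes [J_lim] along [c (1 - p ^ (- e k))], which
   increases to [c = n / (p ^ e - 1)]. *)
Lemma J_lim_left_constant e n : (0 < e)%N -> (0 < n)%N ->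
  exists c0 : K, [/\ 0 <= c0, c0 < n%:R / ((p ^ e)%:R - 1) &
    forall c, c0 <= c -> c < n%:R / ((p ^ e)%:R - 1) -> J_lim c = J_lim c0].
Proof.
move=> e_gt0 n_gt0; have [k0 hk] := J_stable n e_gt0.
have q_gt1 : (1 : K) < (p ^ e)%:R.
  by rewrite ltr1n -{1}(expn0 p) ltn_exp2l.
have q1_gt0 : 0 < (p ^ e)%:R - 1 :> K by rewrite subr_gt0.
set a := n%:R / _.
have a_gt0 : 0 < a by rewrite divr_gt0 // ltr0n.
pose ck k : K := (n * \sum_(i < k) p ^ (e * i))%:R / (p ^ (e * k))%:R.
have ckE k : ck k = a - a / (p ^ (e * k))%:R.
  have -> : ck k = a * (((p ^ e)%:R - 1) * (\sum_(i < k) p ^ (e * i))%:R) / (p ^ (e * k))%:R.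
    by rewrite /ck /a natrM mulrA divfK // gt_eqF.
  have -> : ((p ^ e)%:R - 1) * (\sum_(i < k) p ^ (e * i))%:R = (p ^ (e * k))%:R - 1 :> K.
    have expE i : (p ^ (e * i))%:R = (p ^ e)%:R ^+ i :> K by rewrite expnM natrX.
    by rewrite expE subrX1 natr_sum; congr (_ * _); apply: eq_bigr => i _; rewrite expE.
  by rewrite mulrBr mulr1 mulrBl mulfK // gt_eqF.
have ck_ge0 k : 0 <= ck k by rewrite divr_ge0.
have ck_lt k : ck k < a by rewrite ckE gtrBl divr_gt0.
have Jck k : (k0 <= k)%N -> J_lim (ck k) = J_lim (ck k0).
  by move=> k0k; rewrite !J_lim_frac hk.
exists (ck k0); split => // c lec ltc.
(* The gap [a - ck k] equals [a / p^(e k)], and [p^(e k)] exceeds [k], so an Archimedean bound for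
   [a / (a - c)] suffices. *)
have [k le_ck] : exists k, (k0 <= k)%N && (c <= ck k).
  have ac_gt0 : 0 < a - c by rewrite subr_gt0.
  pose m := (Num.bound (a / (a - c))).
  exists (maxn k0 m); rewrite leq_maxl /= ckE lerBrDl -lerBrDr.
  rewrite ler_pdivrMr // mulrC -ler_pdivrMr //.
  apply: le_trans (ltW (archi_boundP _)) _; first by rewrite divr_ge0 // ltW.
  rewrite ler_nat -/m; apply: leq_trans (leq_maxr k0 m) _.
  set M := maxn k0 m; apply: leq_trans (ltnW (ltn_expl M p_gt1)) _.
  by rewrite leq_exp2l // leq_pmull.
have /andP[k0k cck] := le_ck.
apply/seteqP; split; first exact: J_lim_anti.
by rewrite -(Jck k k0k); apply: J_lim_anti => //; exact: le_trans lec.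
Qed.

Lemma J_lim_max (X : set K) : X !=set0 -> (forall c, X c -> 0 <= c) ->
  exists2 c, X c & forall c', X c' -> J_lim c `<=` J_lim c' -> J_lim c' = J_lim c.
Proof.
move=> [c Xc] X0; have [||I [b Xb <-] Imax] := @noetherian_max _ (J_lim @` X) noS.
- by move=> _ [b /X0 b0 <-]; exact: J_lim_ideal.
- by exists (J_lim c), c.
exists b => // c' Xc'; apply: Imax.
by exists c'.
Qed.

Definition jumps : set K :=
  [set c | 0 < c /\ forall eps, 0 < eps -> eps <= c -> J_lim c <> J_lim (c - eps)].

Lemma jumps_neq c c1 c' : jumps c1 -> 0 <= c -> c < c1 -> c1 <= c' ->
  J_lim c <> J_lim c'.
Proof.
move=> [c1_gt0 jc1] c0 cc1 c1c' e.
have := jc1 (c1 - c); rewrite subr_gt0 subKr gerBl => /(_ cc1 c0); apply.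
apply/seteqP; split; first by apply: J_lim_anti => //; exact: ltW.
by rewrite e; apply: J_lim_anti => //; exact: le_trans (ltW cc1).
Qed.

(** The ideal at [c] is [root] of the ideal at [c * p], so constancy just to the left of [c * p]
    would descend to [c]. *)
Lemma jumpsMp c : jumps c -> jumps (c * p%:R).
Proof.
move=> [c0 jc]; have p0 : 0 < p%:R :> K by rewrite ltr0n.
split; first exact: mulr_gt0.
move=> eps eps0 epsc e; apply: (jc (eps / p%:R)).
- exact: divr_gt0.
- by rewrite ler_pdivrMr.
rewrite J_lim_root ?(ltW c0) // e [RHS]J_lim_root ?subr_ge0 ?ler_pdivrMr //.
by rewrite mulrBl divfK // gt_eqF.
Qed.

Lemma jumpsB1 c : 1 < c -> jumps c -> jumps (c - 1).
Proof.
move=> c1 [c0 jc]; split; first by rewrite subr_gt0.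
move=> eps eps0 epsc e; apply: (jc eps eps0).
  by apply: le_trans epsc _; rewrite gerBl.
rewrite -[c in LHS](subrK 1) J_lim_shift; last by rewrite subr_ge0 ltW.
rewrite e -J_lim_shift ?subr_ge0 //; congr J_lim; ring.
Qed.

Lemma jumpsBn c n : n%:R < c -> jumps c -> jumps (c - n%:R).
Proof.
elim: n => [|n IH] nc jc; first by rewrite subr0.
have -> : c - n.+1%:R = (c - n%:R) - 1 by rewrite -addn1 natrD; ring.
apply: jumpsB1; first by rewrite ltrBrDl -natr1 in nc *.
by apply: IH => //; apply: lt_trans nc; rewrite ltr_nat.
Qed.

Lemma jumps_upper_frac c k : jumps c -> jumps (upper_frac ((p ^ k)%:R * c)).
Proof.
move=> jc; have {jc} : jumps ((p ^ k)%:R * c).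
  elim: k => [|k IH]; first by rewrite mul1r.
  by rewrite expnSr natrM mulrAC; exact: jumpsMp.
move: (_ * c) => b jb; have b0 : 0 < b by case: jb.
have cb : 0 <= Num.ceil b - 1 by rewrite subr_ge0 -gtz0_ge1 ceil_gt0.
rewrite /upper_frac -(gez0_abs cb); apply: jumpsBn => //.
rewrite -[_%:R]/(`|Num.ceil b - 1|%N%:Z%:~R) (gez0_abs cb).
exact: ceilB1_lt.
Qed.

Definition left_acc : set K :=
  [set c | forall eps, 0 < eps -> exists c1, [/\ jumps c1, c - eps < c1 & c1 < c]].

Lemma left_acc_gt0 c : left_acc c -> 0 < c.
Proof.
by move=> /(_ 1 ltr01)[c1 [[c10 _] _ c1c]]; exact: lt_trans c1c.
Qed.

(** Where [J_lim] is maximal the point is least: below it there would be a jump in between, and thus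
    a strictly larger ideal. *)
Lemma left_acc_min (X : set K) : X `<=` left_acc -> X !=set0 ->
  exists2 c, X c & forall c', X c' -> c <= c'.
Proof.
move=> XA X0; have [|c Xc cmax] := J_lim_max X0.
  by move=> c /XA/left_acc_gt0/ltW.
exists c => // c' Xc'; rewrite leNgt; apply/negP => c'c.
have c'0 := ltW (left_acc_gt0 (XA _ Xc')).
have [|c1 [jc1]] := XA _ Xc (c - c'); first by rewrite subr_gt0.
rewrite subKr => c'c1 c1c; apply: (jumps_neq jc1 c'0 c'c1 (ltW c1c)).
by apply: cmax => //; apply: J_lim_anti => //; exact: ltW.
Qed.

(** With values in (0, 1], [upper_frac] is continuous from the left even at integers, so
    approximation from below survives reduction modulo 1. The bound [del] keeps the ceiling
    constant. *)
Lemma left_acc_upper_frac c k : left_acc c -> left_acc (upper_frac ((p ^ k)%:R * c)).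
Proof.
move=> Ac; have c0 := left_acc_gt0 Ac.
set b := (p ^ k)%:R * c; have /andP[lo hi] := ceil_itv b.
have fr0 : 0 < upper_frac b by rewrite subr_gt0.
move=> eps eps0; pose del := Num.min eps (upper_frac b).
have del0 : 0 < del by rewrite lt_min eps0.
have [|c1 [jc1 lt1 lt2]] := Ac (del / (p ^ k)%:R); first exact: divr_gt0.
have lt1' : b - del < (p ^ k)%:R * c1.
  by rewrite -ltr_pdivrMl // mulrBr mulKf ?gt_eqF // mulrC in lt1 *.
have lt2' : (p ^ k)%:R * c1 < b by rewrite ltr_pM2l.
have deleps : del <= eps by rewrite ge_min lexx.
have delfr : del <= upper_frac b by rewrite ge_min lexx orbT.
have ceilE : Num.ceil ((p ^ k)%:R * c1) = Num.ceil b.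
  apply: ceil_def; apply/andP; split; last exact: le_trans (ltW lt2') hi.
  apply: le_lt_trans lt1'; rewrite /upper_frac in delfr.
  by rewrite lerBrDl -lerBrDr.
exists (upper_frac ((p ^ k)%:R * c1)); split; first exact: jumps_upper_frac.
  by rewrite /upper_frac ceilE; lra.
by rewrite /upper_frac ceilE; lra.
Qed.

(* Among the points that are minimal in their orbit under multiplication by
   [p] modulo 1, the greatest is periodic. *)
Lemma left_acc_empty c : ~ left_acc c.
Proof.
move=> Ac0.
pose psi k (b : K) := upper_frac ((p ^ k)%:R * b).
have psiA k b : left_acc b -> left_acc (psi k b) by exact: left_acc_upper_frac.
have psi_itv k b : 0 < psi k b <= 1 by exact: upper_frac_itv.
pose M := [set b | [/\ left_acc b, b <= 1 & forall k, b <= psi k b]].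
have orbit_min b j : left_acc b -> exists k, M (psi (k + j)%N b).
  move=> Ab; have [||_ [k _ <-] kmin] := @left_acc_min [set psi (k + j)%N b | k in setT].
  - by move=> _ [k _ <-]; exact: psiA.
  - by exists (psi (0 + j)%N b), 0%N.
  exists k; split; [exact: psiA|by have /andP[] := psi_itv (k + j)%N b|].
  move=> l; rewrite /psi upper_frac_comp // addnA; apply: kmin.
  by exists (l + k)%N.
have M0 : M !=set0 by have [k Mk] := orbit_min c 0%N Ac0; exists (psi (k + 0)%N c).
have supM : has_sup M by split => //; exists 1 => b [].
pose b := sup M.
have leb y : M y -> y <= b by move=> My; apply: ub_le_sup => //; exact: supM.2.
have b1 : b <= 1 by apply: ge_sup => // y [].
have Ab : left_acc b.
  move=> eps eps0; have [y My] := sup_adherent eps0 supM.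
  rewrite -/b => lty; have [Ay _ _] := My.
  have [|c1 [jc1 lt1 lt2]] := Ay (y - (b - eps)); first by rewrite subr_gt0.
  exists c1; split => //; first by rewrite subKr in lt1.
  exact: lt_le_trans lt2 (leb _ My).
(* The supremum is itself minimal in its orbit: otherwise some [y] in [M] close to [b], with the
   same ceiling, would satisfy [psi k y <= psi k b < y]. *)
have bmin k : b <= psi k b.
  rewrite leNgt; apply/negP => lt_psi.
  have psi0 : 0 < psi k b by have /andP[] := psi_itv k b.
  pose eps := Num.min (b - psi k b) (psi k b / (p ^ k)%:R).
  have eps0 : 0 < eps by rewrite lt_min subr_gt0 lt_psi divr_gt0.
  have [y My] := sup_adherent eps0 supM; rewrite -/b => lty.
  have yb := leb _ My; have [_ _ /(_ k) ymin] := My.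
  have eps1 : eps <= b - psi k b by rewrite ge_min lexx.
  have eps2 : eps * (p ^ k)%:R <= psi k b by rewrite -ler_pdivlMr // ge_min lexx orbT.
  have /andP[lo hi] := ceil_itv ((p ^ k)%:R * b).
  have pyb : (p ^ k)%:R * y <= (p ^ k)%:R * b by rewrite ler_pM2l.
  have ceilE : Num.ceil ((p ^ k)%:R * y) = Num.ceil ((p ^ k)%:R * b).
    apply: ceil_def; apply/andP; split; last exact: le_trans hi.
    rewrite /psi /upper_frac in eps2.
    have : (p ^ k)%:R * (b - eps) < (p ^ k)%:R * y by rewrite ltr_pM2l.
    by rewrite mulrBr [_ * eps]mulrC => h; lra.
  by move: ymin eps1; rewrite /psi /upper_frac ceilE => h1 h2; lra.
(* The shift by 1 makes the period positive. The point found is at most [b] as a member of [M] and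
   at least [b] by [bmin], so [b] is periodic. *)
have [k Mk] := orbit_min b 1%N Ab.
have /eqP := le_anti (introT andP (conj (leb _ Mk) (bmin (k + 1)%N))).
have b0 := left_acc_gt0 Ab.
rewrite addn1 /psi /upper_frac; set e := k.+1; set m := Num.ceil _ - 1 => /eqP bE.
have q_gt1 : (1 : K) < (p ^ e)%:R.
  by rewrite ltr1n -{1}(expn0 p) ltn_exp2l.
have q1_gt0 : 0 < (p ^ e)%:R - 1 :> K by rewrite subr_gt0.
have mE : m%:~R = b * ((p ^ e)%:R - 1) :> K by rewrite mulrBr mulr1 [b * _]mulrC -[X in _ - X]bE; ring.
have m_gt0 : 0 < m by rewrite -(ltr0z K) mE mulr_gt0.
have mabs : m = `|m|%N :> int by rewrite gtz0_abs.
have bfrac : b = `|m|%N%:R / ((p ^ e)%:R - 1).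
  by rewrite -[_%:R]/(`|m|%N%:Z%:~R) -mabs mE mulfK // gt_eqF.
have [||c0 [c00 c0b hc0]] := @J_lim_left_constant e `|m|%N => //.
  by rewrite absz_gt0 gt_eqF.
rewrite -bfrac in c0b hc0.
have [|c1 [jc1]] := Ab (b - c0); first by rewrite subr_gt0.
rewrite subKr => lt1 lt2.
apply: (jumps_neq jc1 c00 lt1 (lexx _)); apply/esym; apply: hc0 => //.
exact: ltW.
Qed.

(** Approach from the left is excluded by [left_acc_empty]. From the right, a jump beyond [l] with
    maximal [J_lim] cannot exist, because a jump closer to [l] has a strictly larger ideal. *)
Lemma jumps_discrete : limit_point jumps = set0.
Proof.
apply/seteqP; split => // l ll.
have : ~ left_acc l by exact: left_acc_empty.
move=> /existsNP[eps /not_implyP[eps0 nleft]].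
pose X := [set c | jumps c /\ l < c].
have right del : 0 < del -> exists c, X c /\ c < l + del.
  move=> del0; pose r := Num.min eps del.
  have r0 : 0 < r by rewrite lt_min eps0.
  have [y [yl jy]] := ll _ (nbhsx_ballx l r r0).
  rewrite /ball /= => lyr.
  have r1 : r <= eps by rewrite ge_min lexx.
  have r2 : r <= del by rewrite ge_min lexx orbT.
  have : `|l - y| < r by [].
  rewrite ltr_norml => /andP[h1 h2].
  have [ly|yl'|e] := ltgtP l y; last by rewrite e eqxx in yl.
    by exists y; split => //; lra.
  by case: nleft; exists y; split => //; lra.
have [c2 [Xc2 _]] := right 1 ltr01.
have [||c [jc lc] cmax] := @J_lim_max X; first by exists c2.
  by move=> c [[/ltW]].
have [|c' [[jc' lc'] c'c]] := right (c - l); first by rewrite subr_gt0.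
have {}c'c : c' < c by rewrite addrC subrK in c'c.
have c'0 : 0 <= c' by case: jc' => /ltW.
apply: (jumps_neq jc c'0 c'c (lexx c)); apply: cmax => //.
by apply: J_lim_anti => //; exact: ltW.
Qed.

(** The orbit of [c] under multiplication by [p] modulo 1 consists of jumps in (0, 1]. By
    discreteness it repeats, and then [(p^j - p^i) c] is an integer for some [i < j]. *)
Lemma jumps_rational c : jumps c -> exists r : rat, c = ratr r.
Proof.
move=> jc; pose psi k := upper_frac ((p ^ k)%:R * c).
have [inj|ninj] := pselect (injective psi).
  have infE : infinite_set (range psi).
    apply/infiniteP; rewrite (card_le_eqr (inj_card_eq _)) //.
    by move=> i j _ _; exact: inj.
  have bdE : bounded_set (range psi).
    exists 1; split => // r r1 _ [k _ <-]; have /andP[h0 h1] := upper_frac_itv ((p ^ k)%:R * c).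
    by rewrite /= gtr0_norm // (le_trans h1) // ltW.
  have [l ll] := infinite_bounded_limit_point_nonempty infE bdE.
  have : limit_point jumps l.
    move=> U /ll[w [wl [k _ wE] Uw]]; exists w; split => //.
    by rewrite -wE; exact: jumps_upper_frac.
  by rewrite jumps_discrete.
have [i [j [ij e]]] : exists i j, (i < j)%N /\ psi i = psi j.
  apply: contrapT => nij; apply: ninj => i j e; apply: contrapT => /eqP.
  rewrite neq_ltn => /orP[lt|lt]; apply: nij; first by exists i, j.
  by exists j, i.
move: e; rewrite /psi /upper_frac.
set m := Num.ceil _ - 1; set m' := Num.ceil _ - 1 => e.
have pp : (p ^ j)%:R - (p ^ i)%:R != 0 :> K.
  by rewrite subr_eq0 eqr_nat gtn_eqF // ltn_exp2l.
exists ((m' - m)%:~R / ((p ^ j)%:R - (p ^ i)%:R)).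
rewrite fmorph_div rmorph_int [X in _ / X]rmorphB !rmorph_nat /=.
apply: (canRL (mulfK pp)); rewrite intrB mulrBr mulrC [c * _]mulrC.
by move: e; lra.
Qed.

End Jumps.

Theorem theorem6p5 (K : realType) (p : nat) (R : comNzRingType)
    (p_prime : prime p) (charR : p \in [pchar R])
    (R_excellent : excellent R) (R_regular : regular_local_ring R) (g : R) :
  limit_point (F_jumping K p (ideal_gen [set g])) = set0 /\
  (forall c : K, F_jumping K p (ideal_gen [set g]) c ->
     exists r : rat, c = ratr r).
Proof.
have [S [h [Phi [flatS IeE]]]] := regular_power_root g p_prime charR R_regular.
have p_gt1 := prime_gt1 p_prime; have [noS _ _ _] := flatS.
have iJ e n : is_ideal (power_root p h e n) by exact: power_root_ideal.
have Jmono e m n : (m <= n)%N -> power_root p h e n `<=` power_root p h e m.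
  exact: power_root_mono.
have Jscale e k n : power_root p h (e + k) (n * p ^ k) = power_root p h e n.
  exact: power_root_scale.
have JS e n : power_root p h e.+1 n = frob_root (p ^ 1) (power_root p h e n).
  exact: power_rootS.
have JD e n : power_root p h e (n + p ^ e) = id_scale h (power_root p h e n).
  exact: power_rootD.
have Jstable e n := power_root_stable p_gt1 flatS h n (e := e).
have tauE (c : K) : 0 <= c ->
    test_ideal p (ideal_gen [set g]) c = Phi (J_lim p (power_root p h) c).
  move=> c0; apply: test_ideal_stable.
  have [E hE] := J_limP p_gt1 noS iJ Jmono Jscale c0.
  by exists E => // e Ee; rewrite /test_ideal_stage IeE -(hE e Ee).
(* Equal ideals [J_lim] have equal images under [Phi], so every jump of [R] is a jump of [S]; both
   claims pass to subsets. *)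
have sub : F_jumping K p (ideal_gen [set g]) `<=` jumps p (power_root p h).
  move=> c [c0 jc]; split => // eps eps0 epsc e; apply: (jc eps eps0 epsc).
  by rewrite !tauE ?subr_ge0 ?(ltW c0) // e.
split=> [|c /sub jc]; last first.
  exact: (jumps_rational p_gt1 noS iJ Jmono Jscale JS JD Jstable jc).
apply/seteqP; split => // l ll.
rewrite -(jumps_discrete K p_gt1 noS iJ Jmono Jscale JS JD Jstable) => U /ll.
by move=> [c [cl /sub jc Uc]]; exists c.
Qed.
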